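(* Let $(\mathcal{L},\Phi)$ be a left $B$-coquasi-bialgebroid, and let $\Sigma\in \mathrm{Hom}_{B^{e}-}(\mathcal{L}\otimes_{B^e}\mathcal{L},B)$ be a unital convolution-invertible element, with convolution inverse $\Sigma^{-1}$, such that $\Sigma(X,Y\,\overline{b})=\Sigma(X,Y\,b)$ for all $X,Y\in\mathcal{L}$, $b\in B$. Define a new product on $\mathcal{L}$ by $$X\cdot_{\Sigma}Y:=\Sigma(X_{(1)},Y_{(1)})\,\overline{\Sigma^{-1}(X_{(3)},Y_{(3)})}\,X_{(2)}Y_{(2)} .$$ Then the underlying $B$-coalgebroid $\mathcal{L}$, equipped with the new product, is a left $B$-coquasi-bialgebroid, denoted $\mathcal{L}^{\Sigma}$, with the twisted $3$-cocycle given by $$\Phi^{\Sigma}(X,Y,Z)=\Sigma\big(X_{(1)},\Sigma(Y_{(1)},Z_{(1)})\,Y_{(2)}Z_{(2)}\big)\,\Phi(X_{(2)},Y_{(3)},Z_{(3)})\,\Sigma^{-1}\big(\overline{\Sigma^{-1}(X_{(4)},Y_{(5)})}\,X_{(3)}Y_{(4)},Z_{(4)}\big)$$ for all $X,Y,Z\in\mathcal{L}$.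
   Context: $k$ is a field, $B$ a unital associative $k$-algebra, $\overline{B}$ its opposite algebra with the antiisomorphism $b\mapsto\overline{b}$, and $B^e=B\otimes\overline{B}$. $B$ is a left $B^e$-module by $(b\overline{c})\cdot a=bac$. For $B^e$-bimodules $M,N$: $M\diamond_B N:=M\otimes N/\langle \overline{b}m\otimes n-m\otimes bn\rangle$, and the Takeuchi product $M\times_B N\subseteq M\diamond_B N$ consists of the elements $\sum_i m_i\otimes n_i$ with $\sum_i m_i\overline{b}\otimes n_i=\sum_i m_i\otimes n_i b$ for all $b\in B$; $B^e$ acts on it from the left by $b\overline{c}(m\otimes n)=bm\otimes\overline{c}n$. The triple product $M\times_B P\times_B N$ is defined analogously: take the quotient of $M\otimes P\otimes N$ by $\overline{b}m\otimes p\otimes n=m\otimes bp\otimes n$ and $m\otimes\overline{b}p\otimes n=m\otimes p\otimes bn$, and the elements invariant in the sense $\sum m\overline{b}\otimes p\otimes n=\sum m\otimes pb\otimes n$, $\sum m\otimes p\overline{b}\otimes n=\sum m\otimes p\otimes nb$. A left $B$-coalgebroid ($\times_B$-coalgebra) is a $B^e$-bimodule $\mathcal{L}$ with left $B^e$-module maps $\Delta:\mathcal{L}\to\mathcal{L}\times_B\mathcal{L}$, $\Delta(X)=X_{(1)}\otimes X_{(2)}$, and $\varepsilon:\mathcal{L}\to B$, such that $\Delta$ is coassociative (the two iterated coproducts agree in $\mathcal{L}\times_B\mathcal{L}\times_B\mathcal{L}$) and $\varepsilon(X_{(1)})X_{(2)}=X=\overline{\varepsilon(X_{(2)})}X_{(1)}$.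 Iterated coproducts are written $X_{(1)}\otimes X_{(2)}\otimes X_{(3)}\otimes\cdots$. A left $B$-coquasi-bialgebroid is a unital, not necessarily associative algebra $\mathcal{L}$ with algebra maps $s:B\to\mathcal{L}$, $t:\overline{B}\to\mathcal{L}$ with commuting images, which is also a left $B$-coalgebroid for the $B^e$-bimodule structure given by multiplication with $s,t$ (write $bX=s(b)X$, $\overline{b}X=t(b)X$, $Xb=Xs(b)$, $X\overline{b}=Xt(b)$), such that: (i) $\Delta:\mathcal{L}\to\mathcal{L}\times_B\mathcal{L}$ is an algebra map (factorwise product on the target). (ii) $\varepsilon(1)=1_B$ and $\varepsilon(X\varepsilon(Y))=\varepsilon(XY)=\varepsilon(X\overline{\varepsilon(Y)})$. (iii) There is a convolution-invertible $\Phi\in\mathrm{Hom}_{B^e-}(\mathcal{L}\otimes_{B^e}\mathcal{L}\otimes_{B^e}\mathcal{L},B)$ (an invertible normalised $3$-cocycle) such that for all $X,Y,Z,W\in\mathcal{L}$, $b\in B$: (1) $\Phi(1,X,Y)=\Phi(X,1,Y)=\Phi(X,Y,1)=\varepsilon(XY)$; (2) $\Phi(X,Y,Zb)=\Phi(X,Y,Z\overline{b})$; (3) $\Phi(X_{(1)},Y_{(1)},Z_{(1)}W_{(1)})\Phi(X_{(2)}Y_{(2)},Z_{(2)},W_{(2)})=\Phi(X_{(1)},\Phi(Y_{(1)},Z_{(1)},W_{(1)})Y_{(2)}Z_{(2)},W_{(2)})\Phi(X_{(2)},Y_{(3)},Z_{(3)})$; (4) $\Phi(X_{(1)},Y_{(1)},Z_{(1)})\,(X_{(2)}Y_{(2)})Z_{(2)}=\overline{\Phi(X_{(2)},Y_{(2)},Z_{(2)})}\,X_{(1)}(Y_{(1)}Z_{(1)})$.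 Here $\mathrm{Hom}_{B^e-}$ denotes left $B^e$-linear maps and $\mathcal{L}\otimes_{B^e}\mathcal{L}$ uses right and left multiplication by $s,t$. The convolution product on $\mathrm{Hom}_{B^e-}(\mathcal{L}\otimes_{B^e}\mathcal{L},B)$ is $(f\star g)(X,Y)=f(X_{(1)},Y_{(1)})g(X_{(2)},Y_{(2)})$ with unit $(X,Y)\mapsto\varepsilon(XY)$, and similarly for three arguments with unit $\varepsilon(XYZ):=\varepsilon((XY)Z)=\varepsilon(X(YZ))$. An element $\Sigma$ is unital if $\Sigma(1,X)=\Sigma(X,1)=\varepsilon(X)$. *)

(* Defs.v *)
From HB Require Import structures.
From mathcomp Require Import all_boot all_order all_algebra.
From mathcomp Require Import ring_quotient boolp.
From mathcomp Require Import freeg.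

Set Implicit Arguments.
Unset Strict Implicit.
Unset Printing Implicit Defensive.

Import GRing.Theory Quotient.

Local Open Scope ring_scope.

(* The n-fold balanced tensor product L (x) ... (x) L: the free k-module on
   n.-tuple L, modulo multilinearity in each slot and, for every two adjacent
   slots, the relations  ra c x (x) y = x (x) la c y  (c : C).                *)
Section BalancedTensor.
Variables (k : fieldType) (L : lmodType k) (C : Type) (ra la : C -> L -> L).
Variable n : nat.

Inductive tensor_rel : {freeg (n.-tuple L) / k} -> Prop :=
| TensorLinear (u v : seq L) (a : k) (x y : L) (p q r : n.-tuple L) of
    tval p = u ++ x :: v & tval q = u ++ y :: v &
    tval r = u ++ (a *: x + y) :: v :
    tensor_rel (<< r >> - (a *: << p >> + << q >>))
| TensorBalanced (u v : seq L) (c : C) (x y : L) (p q : n.-tuple L) of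
    tval p = u ++ ra c x :: y :: v & tval q = u ++ x :: la c y :: v :
    tensor_rel (<< p >> - << q >>).

Inductive tensor_span : {freeg (n.-tuple L) / k} -> Prop :=
| TensorSpan0 : tensor_span 0
| TensorSpanS a f g of tensor_rel f & tensor_span g : tensor_span (a *: f + g).

Lemma tensor_spanP a f g :
  tensor_span f -> tensor_span g -> tensor_span (a *: f + g).
Proof.
move=> + sg; elim=> [|b f' g' rf _ IH]; first by rewrite scaler0 add0r.
by rewrite scalerDr scalerA -addrA; apply: TensorSpanS.
Qed.

Definition tensor_null : {pred {freeg (n.-tuple L) / k}} :=
  fun f => `[< tensor_span f >].

Lemma tensor_null_zmod : zmod_closed tensor_null.
Proof.
split=> [|f g /asboolP sf /asboolP sg]; apply/asboolP.
  exact: TensorSpan0.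
by rewrite addrC -scaleN1r; apply: tensor_spanP.
Qed.
HB.instance Definition _ :=
  GRing.isZmodClosed.Build {freeg (n.-tuple L) / k} tensor_null tensor_null_zmod.

Lemma tensor_nullZ a f : f \in tensor_null -> a *: f \in tensor_null.
Proof.
move=> /asboolP sf; apply/asboolP; rewrite -[X in tensor_span X]addr0.
by apply: tensor_spanP => //; exact: TensorSpan0.
Qed.

Definition tensor : Type := quot tensor_null.
HB.instance Definition _ := GRing.Zmodule.on tensor.

Definition tensor_pi (f : {freeg (n.-tuple L) / k}) : tensor :=
  (\pi_(quot tensor_null) f)%qT.

Definition tensor_scale (a : k) (f : tensor) : tensor :=
  tensor_pi (a *: repr (f : quot tensor_null)).

Lemma tensor_piD f g : tensor_pi (f + g) = tensor_pi f + tensor_pi g.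
Proof. exact: pi_addr. Qed.

Lemma tensor_piZ a f : tensor_pi (a *: f) = tensor_scale a (tensor_pi f).
Proof.
apply/eqP; rewrite /tensor_scale /tensor_pi -idealrBE -scalerBr.
by apply: tensor_nullZ; rewrite idealrBE reprK.
Qed.

Lemma tensor_piP (f : tensor) : exists g, f = tensor_pi g.
Proof. by exists (repr (f : quot tensor_null)); rewrite /tensor_pi reprK. Qed.

Fact tensor_scaleA a b f :
  tensor_scale a (tensor_scale b f) = tensor_scale (a * b) f.
Proof. by have [g ->] := tensor_piP f; rewrite -!tensor_piZ scalerA. Qed.

Fact tensor_scale1 : left_id 1 tensor_scale.
Proof. by move=> f; have [g ->] := tensor_piP f; rewrite -tensor_piZ scale1r. Qed.

Fact tensor_scaleDr : right_distributive tensor_scale +%R.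
Proof.
move=> a f g; have [f' ->] := tensor_piP f; have [g' ->] := tensor_piP g.
by rewrite -tensor_piD -!tensor_piZ -tensor_piD scalerDr.
Qed.

Fact tensor_scaleDl f : {morph tensor_scale^~ f : a b / a + b}.
Proof.
by move=> a b; have [g ->] := tensor_piP f; rewrite -!tensor_piZ -tensor_piD scalerDl.
Qed.

HB.instance Definition _ := GRing.Zmodule_isLmodule.Build k tensor
  tensor_scaleA tensor_scale1 tensor_scaleDr tensor_scaleDl.

Definition pure (w : n.-tuple L) : tensor := tensor_pi << w >>.

End BalancedTensor.

Section Coquasi.
Variables (k : fieldType) (B : algType k).

(* A B^e-bimodule, presented by its four commuting actions
   lact b X = bX,  lbact b X = \bar b X,  ract X b = Xb,  rbact X b = X \bar b.
   Recall \bar b \bar c = \bar (cb).                                          *)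
Record bimodule := Bimodule {
  bimodule_sort :> lmodType k;
  lact : B -> bimodule_sort -> bimodule_sort;
  lbact : B -> bimodule_sort -> bimodule_sort;
  ract : bimodule_sort -> B -> bimodule_sort;
  rbact : bimodule_sort -> B -> bimodule_sort;
  lact_linear b : linear (lact b);
  lbact_linear b : linear (lbact b);
  ract_linear b : linear (ract^~ b);
  rbact_linear b : linear (rbact^~ b);
  lact_linearB X : linear (lact^~ X);
  lbact_linearB X : linear (lbact^~ X);
  ract_linearB X : linear (ract X);
  rbact_linearB X : linear (rbact X);
  lact1 X : lact 1 X = X;
  lbact1 X : lbact 1 X = X;
  ract1 X : ract X 1 = X;
  rbact1 X : rbact X 1 = X;
  lactM b c X : lact (b * c) X = lact b (lact c X);
  lbactM b c X : lbact (c * b) X = lbact b (lbact c X);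
  ractM b c X : ract X (b * c) = ract (ract X b) c;
  rbactM b c X : rbact X (c * b) = rbact (rbact X b) c;
  lact_lbact b c X : lact b (lbact c X) = lbact c (lact b X);
  ract_rbact b c X : ract (rbact X c) b = rbact (ract X b) c;
  lact_ract b c X : ract (lact b X) c = lact b (ract X c);
  lact_rbact b c X : rbact (lact b X) c = lact b (rbact X c);
  lbact_ract b c X : ract (lbact b X) c = lbact b (ract X c);
  lbact_rbact b c X : rbact (lbact b X) c = lbact b (rbact X c)
}.

(* L <>_B ... <>_B L with n factors *)
Definition diamond (L : bimodule) (n : nat) : lmodType k :=
  tensor (@lbact L) (@lact L) n.

Definition dpure (L : bimodule) (n : nat) (w : n.-tuple L) : diamond L n :=
  pure _ _ w.

(* L (x)_{B^e} ... (x)_{B^e} L with n factors; inl b stands for b and inr b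
   for \bar b                                                                 *)
Definition tensorBe (L : bimodule) (n : nat) : lmodType k :=
  tensor (fun (c : B + B) (X : L) =>
            match c with inl b => ract X b | inr b => rbact X b end)
         (fun (c : B + B) (X : L) =>
            match c with inl b => lact b X | inr b => lbact b X end) n.

Definition bpure (L : bimodule) (n : nat) (w : n.-tuple L) : tensorBe L n :=
  pure _ _ w.

(* f(X,Y) = g (X (x) Y) for some g in Hom_{B^e-}(L (x)_{B^e} L, B); left
   B^e-linearity, with B^e acting on the first factor and (b \bar c).a = bac
   on B, is stated on pure tensors, which generate.                           *)
Definition hom2 (L : bimodule) (f : L -> L -> B) : Prop :=
  exists g : {linear tensorBe L 2 -> B},
    [/\ forall X Y, f X Y = g (bpure [tuple X; Y]),
        forall b X Y, f (lact b X) Y = b * f X Y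
      & forall b X Y, f (lbact b X) Y = f X Y * b].

Definition hom3 (L : bimodule) (f : L -> L -> L -> B) : Prop :=
  exists g : {linear tensorBe L 3 -> B},
    [/\ forall X Y Z, f X Y Z = g (bpure [tuple X; Y; Z]),
        forall b X Y Z, f (lact b X) Y Z = b * f X Y Z
      & forall b X Y Z, f (lbact b X) Y Z = f X Y Z * b].

(* the Takeuchi product L \times_B L inside L <>_B L *)
Definition takeuchi (L : bimodule) (f : diamond L 2) : Prop :=
  exists2 l : seq (2.-tuple L), f = \sum_(x <- l) dpure x &
    forall b, \sum_(x <- l) dpure [tuple rbact x`_0 b; x`_1] =
              \sum_(x <- l) dpure [tuple x`_0; ract x`_1 b].

(* D X is a way of writing X_(1) (x) X_(2) as a sum of pure tensors *)
Definition presents (L : bimodule) (cop : L -> diamond L 2)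
    (D : L -> seq (2.-tuple L)) : Prop :=
  forall X, cop X = \sum_(x <- D X) dpure x.

(* Both iterated coproducts are elements of L <> L <> L; they automatically
   satisfy the invariance conditions of the triple Takeuchi product.          *)
Record coalgebroid := Coalgebroid {
  coalgebroid_sort :> bimodule;
  cop : {linear coalgebroid_sort -> diamond coalgebroid_sort 2};
  counit : {linear coalgebroid_sort -> B};
  cop_takeuchi X : takeuchi (cop X);
  cop_lact b X l : cop X = \sum_(x <- l) dpure x ->
    cop (lact b X) = \sum_(x <- l) dpure [tuple lact b x`_0; x`_1];
  cop_lbact b X l : cop X = \sum_(x <- l) dpure x ->
    cop (lbact b X) = \sum_(x <- l) dpure [tuple x`_0; lbact b x`_1];
  counit_lact b X : counit (lact b X) = b * counit X;
  counit_lbact b X : counit (lbact b X) = counit X * b;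
  cop_coassoc D X : presents cop D ->
    \sum_(x <- D X) \sum_(y <- D x`_0) dpure [tuple y`_0; y`_1; x`_1] =
    \sum_(x <- D X) \sum_(y <- D x`_1) dpure [tuple x`_0; y`_0; y`_1];
  counitl X l : cop X = \sum_(x <- l) dpure x ->
    \sum_(x <- l) lact (counit x`_0) x`_1 = X;
  counitr X l : cop X = \sum_(x <- l) dpure x ->
    \sum_(x <- l) lbact (counit x`_1) x`_0 = X
}.

Section Coalgebroid.
Variable L : coalgebroid.

(* X_(1) (x) ... (x) X_(n+1), expanded with the presentation D *)
Fixpoint iter_cop (D : L -> seq (2.-tuple L)) (n : nat) (X : L) :
    seq (n.+1.-tuple L) :=
  match n with
  | 0 => [:: [tuple X]]
  | m.+1 => [seq cons_tuple x`_0 y | x : 2.-tuple L <- D X, y : m.+1.-tuple L <- iter_cop D m x`_1]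
  end.

(* l is a list of pure tensors with sum X_(1) (x) ... (x) X_(n+1) in
   L <> ... <> L.  Formulas in Sweedler notation are stated below for all such
   lists: for x in l, the entry x`_i is the component X_(i+1).                *)
Definition sweedler (n : nat) (X : L) (l : seq (n.+1.-tuple L)) : Prop :=
  exists2 D, presents (@cop L) D &
    \sum_(x <- l) dpure x = \sum_(x <- iter_cop D n X) dpure x.

Variable mul : L -> L -> L.

Definition conv_inverse2 (f g : L -> L -> B) : Prop :=
  forall X Y (x y : seq (2.-tuple L)), sweedler X x -> sweedler Y y ->
    \sum_(p <- x) \sum_(q <- y) f p`_0 q`_0 * g p`_1 q`_1 = counit L (mul X Y)
    /\
    \sum_(p <- x) \sum_(q <- y) g p`_0 q`_0 * f p`_1 q`_1 = counit L (mul X Y).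

Definition conv_inverse3 (f g : L -> L -> L -> B) : Prop :=
  forall X Y Z (x y z : seq (2.-tuple L)),
    sweedler X x -> sweedler Y y -> sweedler Z z ->
    [/\ counit L (mul (mul X Y) Z) = counit L (mul X (mul Y Z)),
        \sum_(p <- x) \sum_(q <- y) \sum_(r <- z)
          f p`_0 q`_0 r`_0 * g p`_1 q`_1 r`_1 = counit L (mul (mul X Y) Z)
      & \sum_(p <- x) \sum_(q <- y) \sum_(r <- z)
          g p`_0 q`_0 r`_0 * f p`_1 q`_1 r`_1 = counit L (mul (mul X Y) Z)].

Record normalised_3cocycle (one : L) (Phi : L -> L -> L -> B) : Prop := {
  cocycle_hom : hom3 Phi;
  cocycle_invertible : exists2 Psi, hom3 Psi & conv_inverse3 Phi Psi;
  cocycle_normalised X Y :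
    [/\ Phi one X Y = counit L (mul X Y), Phi X one Y = counit L (mul X Y)
      & Phi X Y one = counit L (mul X Y)];
  cocycle_right X Y Z b : Phi X Y (ract Z b) = Phi X Y (rbact Z b);
  cocycle_eq X Y Z W
      (x : seq (2.-tuple L)) (y2 : seq (2.-tuple L)) (y3 : seq (3.-tuple L))
      (z2 : seq (2.-tuple L)) (z3 : seq (3.-tuple L)) (w : seq (2.-tuple L)) :
    sweedler X x -> sweedler Y y2 -> sweedler Y y3 ->
    sweedler Z z2 -> sweedler Z z3 -> sweedler W w ->
    \sum_(p <- x) \sum_(q <- y2) \sum_(r <- z2) \sum_(o <- w)
      Phi p`_0 q`_0 (mul r`_0 o`_0) * Phi (mul p`_1 q`_1) r`_1 o`_1 =
    \sum_(p <- x) \sum_(q <- y3) \sum_(r <- z3) \sum_(o <- w)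
      Phi p`_0 (lact (Phi q`_0 r`_0 o`_0) (mul q`_1 r`_1)) o`_1 *
      Phi p`_1 q`_2 r`_2;
  cocycle_assoc X Y Z (x y z : seq (2.-tuple L)) :
    sweedler X x -> sweedler Y y -> sweedler Z z ->
    \sum_(p <- x) \sum_(q <- y) \sum_(r <- z)
      lact (Phi p`_0 q`_0 r`_0) (mul (mul p`_1 q`_1) r`_1) =
    \sum_(p <- x) \sum_(q <- y) \sum_(r <- z)
      lbact (Phi p`_1 q`_1 r`_1) (mul p`_0 (mul q`_0 r`_0))
}.

(* The algebra map \bar B -> L is given as t : B -> L, t b being the image of
   \bar b.                                                                    *)
Record coquasi_bialgebroid (one : L) (s t : B -> L)
    (Phi : L -> L -> L -> B) : Prop := {
  mul_linearr X : linear (mul X);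
  mul_linearl Y : linear (mul^~ Y);
  mul_1l : left_id one mul;
  mul_1r : right_id one mul;
  source_linear : linear s;
  source1 : s 1 = one;
  sourceM b c : s (b * c) = mul (s b) (s c);
  target_linear : linear t;
  target1 : t 1 = one;
  targetM b c : t (c * b) = mul (t b) (t c);
  source_target b c : mul (s b) (t c) = mul (t c) (s b);
  lactE b X : lact b X = mul (s b) X;
  lbactE b X : lbact b X = mul (t b) X;
  ractE b X : ract X b = mul X (s b);
  rbactE b X : rbact X b = mul X (t b);
  cop1 : cop L one = dpure [tuple one; one];
  copM X Y (x y : seq (2.-tuple L)) : sweedler X x -> sweedler Y y ->
    cop L (mul X Y) =
      \sum_(p <- x) \sum_(q <- y) dpure [tuple mul p`_0 q`_0; mul p`_1 q`_1];
  counit1 : counit L one = 1;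
  counit_ract X Y : counit L (ract X (counit L Y)) = counit L (mul X Y);
  counit_rbact X Y : counit L (rbact X (counit L Y)) = counit L (mul X Y);
  cocycle : normalised_3cocycle one Phi
}.

End Coalgebroid.

End Coquasi.

(* Main.v *)
(* On L, L (x) L, L (x) L (x) L, ... (tensor products over B^e) the left
   B^e-linear maps f to B with f(x b) = f(x \bar b) form monoids under
   convolution.  These monoids are linked by coface maps, which are monoid
   morphisms: multiply two adjacent arguments, or let f act on the first or last
   arguments only, the others entering through the counit.  The new product is
   the conjugate Sigma * (XY) * Sigma^-1, so composing a cochain with it amounts
   to composing with the old product and conjugating by a coface of Sigma; and
     Phi^Sigma = Sigma(Y,Z) * Sigma(X,YZ) * Phi * Sigma^-1(XY,Z) * Sigma^-1(X,Y).
   The cocycle identity for Phi^Sigma is then a cancellation in the monoid on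
   four arguments, using that Phi intertwines (XY)Z with X(YZ) and that cofaces
   of Sigma on disjoint arguments commute.
   The rules (bX)Y = b(XY), (Xb)Y = X(bY), X(Yb) = (XY)b and their \bar b
   versions are not axioms; they follow from eps((XY)Z) = eps(X(YZ)). *)

Require Import Defs.
From mathcomp Require Import all_boot all_order all_algebra.
From HB Require Import structures.
From mathcomp Require Import boolp freeg zify.

Set Implicit Arguments.
Unset Strict Implicit.
Unset Printing Implicit Defensive.

Import GRing.Theory.

Local Open Scope ring_scope.

(** Left actions move between neighbouring legs of a coproduct through the quotient, \bar b x (x) y
    = x (x) b y. Right actions do so only on elements of the Takeuchi product, that is, after
    summation over a whole coproduct. Hence a map on a product of coalgebroids is balanced in the
    second factor only once the coproduct of the first has been summed, and the sum over the second
    is kept outermost. The condition f(x b) = f(x \bar b) lets a right action get past a cochain: it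
    closes cochains under convolution and makes the coface acting on the first arguments well
    defined. For the inverses of Sigma and Phi it is deduced from invertibility. The second obstacle
    is the return to Sweedler sums. A convolution of n factors gives every argument n legs, whereas
    the formulas nest one value inside an argument of another cochain and use fewer legs for some
    arguments. Nesting in a left action by b is undone by the counit, since the sum of eps(x_1 b)
    G(x_2, u) is G(x, b u). The rightmost factor sees the last argument only through its counit,
    which removes a leg there. *)

Section FreegLift.
Variables (R : nzRingType) (K : choiceType) (M : lmodType R) (f : K -> M).

HB.instance Definition _ :=
  GRing.isZmodMorphism.Build {freeg K / R} M (fglift f) (lift_is_additive f).

Lemma fgliftZ c D : fglift f (c *: D) = c *: fglift f D.
Proof.
rewrite -[in RHS](freeg_sumE D) [c *: D]/(fgscale c D) /fgscale !raddf_sum.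
by apply: eq_bigr => x _ /=; rewrite !liftU scalerA.
Qed.

End FreegLift.

(** * Linear maps out of the balanced tensor product *)

Section TensorLift.
Variables (k : fieldType) (L : lmodType k) (C : Type) (ra la : C -> L -> L).
Variable n : nat.

Lemma tensor_pi_eqP (f g : {freeg (n.-tuple L) / k}) :
  tensor_pi ra la f = tensor_pi ra la g <-> tensor_span ra la (f - g).
Proof.
split=> [/eqP|h]; last apply/eqP; rewrite -Quotient.idealrBE; last exact/asboolP.
by move=> /asboolP.
Qed.

Lemma tensor_rel_eq (f g : {freeg (n.-tuple L) / k}) :
  tensor_rel ra la (f - g) -> tensor_pi ra la f = tensor_pi ra la g.
Proof.
move=> rfg; apply/tensor_pi_eqP.
by rewrite -[f - g]addr0 -[f - g]scale1r; apply: TensorSpanS => //; exact: TensorSpan0.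
Qed.

Lemma pure_linear (u v : seq L) (a : k) (x y : L) (p q r : n.-tuple L) :
  tval p = u ++ x :: v -> tval q = u ++ y :: v ->
  tval r = u ++ (a *: x + y) :: v ->
  pure ra la r = a *: pure ra la p + pure ra la q.
Proof.
move=> hp hq hr; have := TensorLinear ra la hp hq hr.
by move/tensor_rel_eq; rewrite tensor_piD tensor_piZ.
Qed.

Lemma pure_balanced (u v : seq L) (c : C) (x y : L) (p q : n.-tuple L) :
  tval p = u ++ ra c x :: y :: v -> tval q = u ++ x :: la c y :: v ->
  pure ra la p = pure ra la q.
Proof. by move=> hp hq; apply: tensor_rel_eq (TensorBalanced hp hq). Qed.

Variables (V : lmodType k) (F : n.-tuple L -> V).

Definition multilinear :=
  forall (u v : seq L) (a : k) (x y : L) (p q r : n.-tuple L),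
    tval p = u ++ x :: v -> tval q = u ++ y :: v ->
    tval r = u ++ (a *: x + y) :: v -> F r = a *: F p + F q.

Definition balanced :=
  forall (u v : seq L) (c : C) (x y : L) (p q : n.-tuple L),
    tval p = u ++ ra c x :: y :: v -> tval q = u ++ x :: la c y :: v -> F p = F q.

(** Universal property of the quotient. Identities in [diamond] are exploited by applying the maps
    obtained here. *)
Lemma tensor_lift : multilinear -> balanced ->
  exists g : {linear tensor ra la n -> V}, forall w, g (pure ra la w) = F w.
Proof.
move=> Flin Fbal.
have F0 f : tensor_span ra la f -> fglift F f = 0.
  elim=> [|a f' g rf _ IH]; first exact: raddf0.
  rewrite raddfD /= fgliftZ IH addr0; case: rf => [u v b x y p q r|u v c x y p q] hp hq.
    move=> hr; rewrite [fglift F (_ - _)]raddfB /= [fglift F (_ + _)]raddfD /= fgliftZ !liftU !scale1r.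
    by rewrite (Flin _ _ _ _ _ _ _ _ hp hq hr) subrr scaler0.
  by rewrite [fglift F (_ - _)]raddfB /= !liftU !scale1r (Fbal _ _ _ _ _ _ _ hp hq) subrr scaler0.
(* Any representative will do: by [F0] two of them have the same image under [fglift F]. *)
pose g (x : tensor ra la n) := fglift F (projT1 (cid (tensor_piP x))).
have gE f : g (tensor_pi ra la f) = fglift F f.
  rewrite /g; case: cid => h /= /tensor_pi_eqP /F0.
  by rewrite raddfB => /eqP; rewrite subr_eq0 => /eqP.
have glin : linear g.
  move=> a x y; have [x' ->] := tensor_piP x; have [y' ->] := tensor_piP y.
  have -> : a *: tensor_pi ra la x' + tensor_pi ra la y' = tensor_pi ra la (a *: x' + y').
    by rewrite tensor_piD tensor_piZ.
  rewrite !gE.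
  by rewrite raddfD /= fgliftZ.
pose gl : {linear tensor ra la n -> V} :=
  HB.pack g (GRing.isLinear.Build _ _ _ _ g glin).
by exists gl => w; rewrite [LHS]gE liftU scale1r.
Qed.

End TensorLift.

(** * Coalgebroids on raw elements *)

Section Kernels.
Variables (k : fieldType) (B : algType k) (T : Type).
Variable adm : forall V : lmodType k, (T -> V) -> Prop.
Variables (tl tlb : B -> T -> T).

(* The maps on T x T, resp. T x T x T, that factor through T <>_B T, resp.
   T <>_B T <>_B T. *)
Definition kernel2 (V : lmodType k) (K : T -> T -> V) : Prop :=
  [/\ forall y, adm (K^~ y), forall x, adm (K x)
    & forall b x y, K (tlb b x) y = K x (tl b y)].

Definition kernel3 (V : lmodType k) (K : T -> T -> T -> V) : Prop :=
  [/\ forall y z, adm (fun x => K x y z), forall x z, adm (fun y => K x y z),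
      forall x y, adm (K x y),
      forall b x y z, K (tlb b x) y z = K x (tl b y) z
    & forall b x y z, K x (tlb b y) z = K x y (tl b z)].

End Kernels.

(* The tensor products over B^e are never formed: a coalgebroid is given by raw
   elements, [adm] singles out the maps that factor through the intended quotient,
   [dec x] is one list of pure tensors with sum x_(1) (x) x_(2), and the axioms are
   tested on admissible maps only.  In this sense the cartesian product of S and T
   carries the structure of S (x)_{B^e} T (see [prod_rcoalg]). *)
Record rcoalg (k : fieldType) (B : algType k) := RCoalg {
  car :> Type;
  tl : B -> car -> car;
  tlb : B -> car -> car;
  tr : car -> B -> car;
  trb : car -> B -> car;
  adm : forall V : lmodType k, (car -> V) -> Prop;
  dec : car -> seq (car * car);
  eps : car -> B;
  tlM b c x : tl (b * c) x = tl b (tl c x);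
  tlbM b c x : tlb (c * b) x = tlb b (tlb c x);
  tl1 x : tl 1 x = x;
  tlb1 x : tlb 1 x = x;
  trM b c x : tr x (b * c) = tr (tr x b) c;
  trbM b c x : trb x (c * b) = trb (trb x b) c;
  tl_tlb b c x : tl b (tlb c x) = tlb c (tl b x);
  tr_trb b c x : tr (trb x c) b = trb (tr x b) c;
  tl_tr b c x : tr (tl b x) c = tl b (tr x c);
  tl_trb b c x : trb (tl b x) c = tl b (trb x c);
  tlb_tr b c x : tr (tlb b x) c = tlb b (tr x c);
  tlb_trb b c x : trb (tlb b x) c = tlb b (trb x c);
  adm0 (V : lmodType k) : adm (fun _ => 0 : V);
  adm_add (V : lmodType k) (f g : car -> V) :
    adm f -> adm g -> adm (fun x => f x + g x);
  adm_comp (V W : lmodType k) (h : V -> W) (f : car -> V) :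
    linear h -> adm f -> adm (fun x => h (f x));
  adm_tl (V : lmodType k) (f : car -> V) b : adm f -> adm (fun x => f (tl b x));
  adm_tlb (V : lmodType k) (f : car -> V) b : adm f -> adm (fun x => f (tlb b x));
  adm_tr (V : lmodType k) (f : car -> V) b : adm f -> adm (fun x => f (tr x b));
  adm_trb (V : lmodType k) (f : car -> V) b : adm f -> adm (fun x => f (trb x b));
  tl_linear (V : lmodType k) (f : car -> V) x : adm f -> linear (fun b => f (tl b x));
  tlb_linear (V : lmodType k) (f : car -> V) x : adm f -> linear (fun b => f (tlb b x));
  tr_linear (V : lmodType k) (f : car -> V) x : adm f -> linear (fun b => f (tr x b));
  trb_linear (V : lmodType k) (f : car -> V) x : adm f -> linear (fun b => f (trb x b));
  dec_tl (V : lmodType k) (K : car -> car -> V) b x : kernel2 adm tl tlb K ->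
    \sum_(p <- dec (tl b x)) K p.1 p.2 = \sum_(p <- dec x) K (tl b p.1) p.2;
  dec_tlb (V : lmodType k) (K : car -> car -> V) b x : kernel2 adm tl tlb K ->
    \sum_(p <- dec (tlb b x)) K p.1 p.2 = \sum_(p <- dec x) K p.1 (tlb b p.2);
  dec_tr (V : lmodType k) (K : car -> car -> V) b x : kernel2 adm tl tlb K ->
    \sum_(p <- dec (tr x b)) K p.1 p.2 = \sum_(p <- dec x) K (tr p.1 b) p.2;
  dec_trb (V : lmodType k) (K : car -> car -> V) b x : kernel2 adm tl tlb K ->
    \sum_(p <- dec (trb x b)) K p.1 p.2 = \sum_(p <- dec x) K p.1 (trb p.2 b);
  dec_takeuchi (V : lmodType k) (K : car -> car -> V) b x : kernel2 adm tl tlb K ->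
    \sum_(p <- dec x) K (trb p.1 b) p.2 = \sum_(p <- dec x) K p.1 (tr p.2 b);
  dec_adm (V : lmodType k) (K : car -> car -> V) : kernel2 adm tl tlb K ->
    adm (fun x => \sum_(p <- dec x) K p.1 p.2);
  dec_coassoc (V : lmodType k) (K : car -> car -> car -> V) x :
    kernel3 adm tl tlb K ->
    \sum_(p <- dec x) \sum_(q <- dec p.1) K q.1 q.2 p.2 =
    \sum_(p <- dec x) \sum_(q <- dec p.2) K p.1 q.1 q.2;
  eps_adm : adm (eps : car -> B);
  eps_tl b x : eps (tl b x) = b * eps x;
  eps_tlb b x : eps (tlb b x) = eps x * b;
  eps_tr b x : eps (tr x b) = eps (trb x b);
  dec_counitl (V : lmodType k) (f : car -> V) x : adm f ->
    \sum_(p <- dec x) f (tl (eps p.1) p.2) = f x;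
  dec_counitr (V : lmodType k) (f : car -> V) x : adm f ->
    \sum_(p <- dec x) f (tlb (eps p.2) p.1) = f x
}.

Arguments adm {k B r} [V] f.
Arguments dec_tl {k B r V K} b x.
Arguments dec_tlb {k B r V K} b x.
Arguments dec_tr {k B r V K} b x.
Arguments dec_trb {k B r V K} b x.
Arguments dec_takeuchi {k B r V K} b x.
Arguments dec_coassoc {k B r V K} x.
Arguments dec_counitl {k B r V f} x.
Arguments dec_counitr {k B r V f} x.

Local Notation ker2 := (kernel2 (@adm _ _ _) (@tl _ _ _) (@tlb _ _ _)).
Local Notation ker3 := (kernel3 (@adm _ _ _) (@tl _ _ _) (@tlb _ _ _)).

Section RCoalgTheory.
Variables (k : fieldType) (B : algType k).
Implicit Types (S T : rcoalg B).

Lemma adm_sum T (V : lmodType k) (I : Type) (r : seq I) (F : I -> T -> V) :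
  (forall i, adm (F i)) -> adm (fun x => \sum_(i <- r) F i x).
Proof.
move=> FP; elim: r => [|i r IH].
  by under eq_fun do rewrite big_nil; apply: adm0.
by under eq_fun do rewrite big_cons; apply: adm_add.
Qed.

Lemma linear_big (V W : lmodType k) (I : Type) (r : seq I) (h : V -> W) (F : I -> V) :
  linear h -> h (\sum_(i <- r) F i) = \sum_(i <- r) h (F i).
Proof.
move=> hl; pose hL : {linear V -> W} := HB.pack h (GRing.isLinear.Build _ _ _ _ h hl).
exact: (raddf_sum hL).
Qed.

Lemma kernel3_at T (V : lmodType k) (H : T -> T -> T -> V) x : ker3 H -> ker2 (H x).
Proof.
case=> K1 K2 K3 K4 K5; split=> [z|y|b y z].
- exact: K2.
- exact: K3.
- exact: K5.
Qed.

(** The action of b on the last slot lands on the first leg of its coproduct, where H is balanced.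
    This allows the Takeuchi rule to be used on the outer coproduct of an iterated one. *)
Lemma kernel3_part T (V : lmodType k) (H : T -> T -> T -> V) : ker3 H ->
  ker2 (fun s1 s' => \sum_(q <- dec s') H s1 q.1 q.2).
Proof.
move=> HP; case: (HP) => K1 K2 K3 K4 K5; split=> [s'|s1|b s1 s'].
- by apply: adm_sum => q; apply: K1.
- exact: dec_adm (kernel3_at s1 HP).
rewrite (dec_tl _ _ (kernel3_at s1 HP)).
by apply: eq_bigr => q _; rewrite K4.
Qed.

(** * The tensor product over B^e of two coalgebroids *)

Section Product.
Variables S T : rcoalg B.

Definition padm (V : lmodType k) (f : S * T -> V) : Prop :=
  [/\ forall t, adm (fun s => f (s, t)), forall s, adm (fun t => f (s, t)),
      forall s t b, f (tr s b, t) = f (s, tl b t)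
    & forall s t b, f (trb s b, t) = f (s, tlb b t)].

Definition pdec (x : S * T) : seq ((S * T) * (S * T)) :=
  [seq ((p.1, q.1), (p.2, q.2)) | p <- dec x.1, q <- dec x.2].

Let ptl b (x : S * T) := (tl b x.1, x.2).
Let ptlb b (x : S * T) := (tlb b x.1, x.2).
Let ptr (x : S * T) b := (x.1, tr x.2 b).
Let ptrb (x : S * T) b := (x.1, trb x.2 b).
(** For S = T = L the value eps(X eps(Y)) is eps(XY) by axiom (ii), the unit of convolution in two
    arguments. *)
Let peps (x : S * T) := eps (tr x.1 (eps x.2)).

Lemma sum_pdec (V : lmodType k) (K : S * T -> S * T -> V) x :
  \sum_(u <- pdec x) K u.1 u.2 =
  \sum_(p <- dec x.1) \sum_(q <- dec x.2) K (p.1, q.1) (p.2, q.2).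
Proof. by rewrite big_allpairs_dep. Qed.

(** With the entries of T fixed the summand is a kernel in S, but it becomes a kernel in T only
    after the sum over the coproduct of s ([kernel2_snd]); hence this order of summation. *)
Lemma sum_pdec' (V : lmodType k) (K : S * T -> S * T -> V) x :
  \sum_(u <- pdec x) K u.1 u.2 =
  \sum_(q <- dec x.2) \sum_(p <- dec x.1) K (p.1, q.1) (p.2, q.2).
Proof. by rewrite sum_pdec exchange_big. Qed.

Section Kernel2.
Variables (V : lmodType k) (K : S * T -> S * T -> V).
Hypothesis KP : kernel2 padm ptl ptlb K.

Lemma kernel2_fst y1 y2 : ker2 (fun s1 s2 => K (s1, y1) (s2, y2)).
Proof.
case: KP => K1 K2 K3; split=> [s2|s1|b s1 s2].
- by case: (K1 (s2, y2)).
- by case: (K2 (s1, y1)).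
- exact: (K3 b (s1, y1) (s2, y2)).
Qed.

(** An action of \bar b on [y1] moves to the first leg of s as a right action; Takeuchi invariance
    turns it into a right action of b on the second leg, hence into b acting on [y2]. *)
Lemma kernel2_snd s :
  ker2 (fun y1 y2 => \sum_(p <- dec s) K (p.1, y1) (p.2, y2)).
Proof.
case: KP => K1 K2 K3; split=> [y2|y1|b y1 y2].
- by apply: adm_sum => p; case: (K1 (p.2, y2)).
- by apply: adm_sum => p; case: (K2 (p.1, y1)).
transitivity (\sum_(p <- dec s) K (trb p.1 b, y1) (p.2, y2)).
  by apply: eq_bigr => p _; case: (K1 (p.2, y2)) => _ _ _ ->.
rewrite (dec_takeuchi _ _ (kernel2_fst _ _)).
by apply: eq_bigr => p _; case: (K2 (p.1, y1)) => _ _ ->.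
Qed.

Lemma pdec_adm : padm (fun x => \sum_(u <- pdec x) K u.1 u.2).
Proof.
split=> [t|s|s t b|s t b].
- under eq_fun do rewrite sum_pdec' /=; apply: adm_sum => q.
  exact: dec_adm (kernel2_fst _ _).
- under eq_fun do rewrite sum_pdec' /=; apply: dec_adm (kernel2_snd s).
- rewrite !sum_pdec' /= (dec_tl _ _ (kernel2_snd s)); apply: eq_bigr => q _.
  rewrite (dec_tr _ _ (kernel2_fst _ _)); apply: eq_bigr => p _.
  by case: KP => /(_ (p.2, q.2)) [_ _ -> _].
- rewrite !sum_pdec' /= (dec_tlb _ _ (kernel2_snd s)); apply: eq_bigr => q _.
  rewrite (dec_trb _ _ (kernel2_fst _ _)); apply: eq_bigr => p _.
  by case: KP => _ /(_ (p.1, q.1)) [_ _ _ ->].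
Qed.

End Kernel2.

Section Kernel3.
Variables (V : lmodType k) (K : S * T -> S * T -> S * T -> V).
Hypothesis KP : kernel3 padm ptl ptlb K.

Lemma kernel3_fst y1 y2 y3 :
  ker3 (fun s1 s2 s3 => K (s1, y1) (s2, y2) (s3, y3)).
Proof.
case: KP => K1 K2 K3 K4 K5; split=> [s2 s3|s1 s3|s1 s2|b s1 s2 s3|b s1 s2 s3].
- by case: (K1 (s2, y2) (s3, y3)).
- by case: (K2 (s1, y1) (s3, y3)).
- by case: (K3 (s1, y1) (s2, y2)).
- exact: (K4 b (s1, y1) (s2, y2)).
- exact: (K5 b (s1, y1) (s2, y2)).
Qed.

Lemma kernel3_snd s :
  ker3 (fun y1 y2 y3 => \sum_(p <- dec s) \sum_(q <- dec p.2)
          K (p.1, y1) (q.1, y2) (q.2, y3)).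
Proof.
case: KP => K1 K2 K3 K4 K5; split=> [y2 y3|y1 y3|y1 y2|b y1 y2 y3|b y1 y2 y3].
- by apply: adm_sum => p; apply: adm_sum => q; case: (K1 (q.1, y2) (q.2, y3)).
- by apply: adm_sum => p; apply: adm_sum => q; case: (K2 (p.1, y1) (q.2, y3)).
- by apply: adm_sum => p; apply: adm_sum => q; case: (K3 (p.1, y1) (q.1, y2)).
- transitivity (\sum_(p <- dec s) \sum_(q <- dec p.2)
                   K (trb p.1 b, y1) (q.1, y2) (q.2, y3)).
    apply: eq_bigr => p _; apply: eq_bigr => q _.
    by case: (K1 (q.1, y2) (q.2, y3)) => _ _ _ ->.
  (* The right action of b reaches the whole second leg of the outer coproduct; [dec_tr] then puts
     it on the first leg of the inner one. *)
  rewrite (dec_takeuchi _ _ (kernel3_part (kernel3_fst _ _ _))).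
  apply: eq_bigr => p _.
  rewrite (dec_tr _ _ (kernel3_at p.1 (kernel3_fst y1 y2 y3))).
  by apply: eq_bigr => q _; case: (K2 (p.1, y1) (q.2, y3)) => _ _ ->.
- apply: eq_bigr => p _.
  transitivity (\sum_(q <- dec p.2) K (p.1, y1) (trb q.1 b, y2) (q.2, y3)).
    apply: eq_bigr => q _.
    by case: (K2 (p.1, y1) (q.2, y3)) => _ _ _ ->.
  rewrite (dec_takeuchi _ _ (kernel3_at p.1 (kernel3_fst y1 y2 y3))).
  by apply: eq_bigr => q _; case: (K3 (p.1, y1) (q.1, y2)) => _ _ ->.
Qed.

Lemma pdec_coassoc x :
  \sum_(u <- pdec x) \sum_(v <- pdec u.1) K v.1 v.2 u.2 =
  \sum_(u <- pdec x) \sum_(v <- pdec u.2) K u.1 v.1 v.2.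
Proof.
case: x => s t.
rewrite (sum_pdec' (fun u1 u2 => \sum_(v <- pdec u1) K v.1 v.2 u2)) /=.
rewrite (sum_pdec' (fun u1 u2 => \sum_(v <- pdec u2) K u1 v.1 v.2)) /=.
transitivity (\sum_(p <- dec t) \sum_(q <- dec p.1) \sum_(p' <- dec s)
    \sum_(q' <- dec p'.2) K (p'.1, q.1) (q'.1, q.2) (q'.2, p.2)).
  apply: eq_bigr => p _.
  under eq_bigr => p' _.
    rewrite (sum_pdec' (fun v1 v2 => K v1 v2 (p'.2, p.2))) /=.
    over.
  rewrite exchange_big /=; apply: eq_bigr => q _.
  exact: (dec_coassoc _ (kernel3_fst q.1 q.2 p.2)).
rewrite (dec_coassoc _ (kernel3_snd s)).
apply: eq_bigr => p _.
under [RHS]eq_bigr => p' _.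
  rewrite (sum_pdec' (fun v1 v2 => K (p'.1, p.1) v1 v2)) /=.
  over.
by rewrite [RHS]exchange_big.
Qed.

End Kernel3.

Lemma padm_comp (V W : lmodType k) (h : V -> W) (f : S * T -> V) :
  linear h -> padm f -> padm (fun x => h (f x)).
Proof.
move=> hl [f1 f2 f3 f4]; split=> [t|s|s t b|s t b]; last 2 first.
- by rewrite f3.
- by rewrite f4.
- exact: (adm_comp hl (f1 t)).
- exact: (adm_comp hl (f2 s)).
Qed.

(** Common to the counit of the product, where f = eps, and to the coface [first_hom]. Balance over
    \bar b rests on eps(s b) = eps(s \bar b). *)
Lemma padm_first (f : T -> B) : adm f -> (forall b t, f (tl b t) = b * f t) ->
  (forall b t, f (tlb b t) = f t * b) -> padm (fun x => eps (tr x.1 (f x.2))).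
Proof.
move=> fa ftl ftlb; split=> [t|s|s t b|s t b] /=.
- exact: (adm_tr (f := @eps _ _ S) _ (eps_adm S)).
- by apply: (adm_comp (h := fun b => eps (tr s b))) fa; apply: tr_linear (eps_adm S).
- by rewrite ftl trM.
- by rewrite ftlb tr_trb -eps_tr trM.
Qed.

Lemma peps_adm : padm (peps : _ -> B).
Proof. by apply: padm_first; [exact: eps_adm|exact: eps_tl|exact: eps_tlb]. Qed.

Lemma pdec_counitl (V : lmodType k) (f : S * T -> V) x : padm f ->
  \sum_(u <- pdec x) f (ptl (peps u.1) u.2) = f x.
Proof.
case: x => s t fP; case: (fP) => f1 f2 f3 f4.
rewrite (sum_pdec' (fun u1 u2 => f (ptl (peps u1) u2))) /= /peps /ptl /=.
rewrite -(dec_counitl _ (f2 s)); apply: eq_bigr => q _.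
rewrite -f3 -(dec_counitl _ (f1 q.2)) (dec_tr (K := fun s1 s2 => f (tl (eps s1) s2, q.2))) //.
split=> [s2|s1|b s1 s2].
- apply: (adm_comp (h := fun b => f (tl b s2, q.2))) (eps_adm S).
  exact: (tl_linear _ (f1 q.2)).
- exact: adm_tl (f1 q.2).
- by rewrite eps_tlb tlM.
Qed.

Lemma pdec_counitr (V : lmodType k) (f : S * T -> V) x : padm f ->
  \sum_(u <- pdec x) f (ptlb (peps u.2) u.1) = f x.
Proof.
case: x => s t fP; case: (fP) => f1 f2 f3 f4.
rewrite (sum_pdec' (fun u1 u2 => f (ptlb (peps u2) u1))) /= /peps /ptlb /=.
rewrite -(dec_counitr _ (f2 s)); apply: eq_bigr => q _.
rewrite -f4 -(dec_counitr _ (f1 q.1)).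
under eq_bigr => p _ do rewrite eps_tr.
rewrite (dec_trb (K := fun s1 s2 => f (tlb (eps s2) s1, q.1))) //; split=> [s2|s1|b s1 s2].
- exact: adm_tlb (f1 q.1).
- apply: (adm_comp (h := fun b => f (tlb b s1, q.1))) (eps_adm S).
  exact: (tlb_linear _ (f1 q.1)).
- by rewrite eps_tl tlbM.
Qed.

(** Transparent, like the morphisms below: many identities between cofaces later hold by computation
    on tuples of arguments. *)
Definition prod_rcoalg : rcoalg B.
Proof.
apply: (@RCoalg _ _ (S * T)%type ptl ptlb ptr ptrb padm pdec peps); rewrite /ptl /ptlb /ptr /ptrb /=.
- by move=> b c x; rewrite tlM.
- by move=> b c x; rewrite tlbM.
- by case=> s t /=; rewrite tl1.
- by case=> s t /=; rewrite tlb1.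
- by move=> b c x; rewrite trM.
- by move=> b c x; rewrite trbM.
- by move=> b c x; rewrite tl_tlb.
- by move=> b c x; rewrite tr_trb.
- by [].
- by [].
- by [].
- by [].
- move=> V; split=> //; by [move=> t; apply: adm0|move=> s; apply: adm0].
- move=> V f g [f1 f2 f3 f4] [g1 g2 g3 g4]; split=> [t|s|s t b|s t b].
  + exact: adm_add.
  + exact: adm_add.
  + by rewrite f3 g3.
  + by rewrite f4 g4.
- exact: padm_comp.
- move=> V f b [f1 f2 f3 f4]; split=> [t|s|s t c|s t c] /=.
  + exact: (adm_tl b (f1 t)).
  + exact: (f2 (tl b s)).
  + by rewrite -tl_tr f3.
  + by rewrite -tl_trb f4.
- move=> V f b [f1 f2 f3 f4]; split=> [t|s|s t c|s t c] /=.
  + exact: (adm_tlb b (f1 t)).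
  + exact: (f2 (tlb b s)).
  + by rewrite -tlb_tr f3.
  + by rewrite -tlb_trb f4.
- move=> V f b [f1 f2 f3 f4]; split=> [t|s|s t c|s t c] /=.
  + exact: (f1 (tr t b)).
  + exact: (adm_tr b (f2 s)).
  + by rewrite tl_tr f3.
  + by rewrite tlb_tr f4.
- move=> V f b [f1 f2 f3 f4]; split=> [t|s|s t c|s t c] /=.
  + exact: (f1 (trb t b)).
  + exact: (adm_trb b (f2 s)).
  + by rewrite tl_trb f3.
  + by rewrite tlb_trb f4.
- by move=> V f [s t] [f1 f2 f3 f4]; apply: (tl_linear _ (f1 t)).
- by move=> V f [s t] [f1 f2 f3 f4]; apply: (tlb_linear _ (f1 t)).
- by move=> V f [s t] [f1 f2 f3 f4]; apply: (tr_linear _ (f2 s)).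
- by move=> V f [s t] [f1 f2 f3 f4]; apply: (trb_linear _ (f2 s)).
- move=> V K b [s t] KP; rewrite !(sum_pdec' K, sum_pdec' (fun x y => K (tl b x.1, x.2) y)) /=.
  by apply: eq_bigr => q _; apply: (dec_tl _ _ (kernel2_fst KP _ _)).
- move=> V K b [s t] KP; rewrite !(sum_pdec' K, sum_pdec' (fun x y => K x (tlb b y.1, y.2))) /=.
  by apply: eq_bigr => q _; apply: (dec_tlb _ _ (kernel2_fst KP _ _)).
- move=> V K b [s t] KP; rewrite !(sum_pdec' K, sum_pdec' (fun x y => K (x.1, tr x.2 b) y)) /=.
  exact: (dec_tr _ _ (kernel2_snd KP _)).
- move=> V K b [s t] KP; rewrite !(sum_pdec' K, sum_pdec' (fun x y => K x (y.1, trb y.2 b))) /=.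
  exact: (dec_trb _ _ (kernel2_snd KP _)).
- move=> V K b [s t] KP.
  rewrite (sum_pdec' (fun x y => K (x.1, trb x.2 b) y)) (sum_pdec' (fun x y => K x (y.1, tr y.2 b))) /=.
  exact: (dec_takeuchi _ _ (kernel2_snd KP _)).
- by move=> V K; apply: pdec_adm.
- by move=> V K x KP; apply: pdec_coassoc.
- exact: peps_adm.
- by move=> b [s t]; rewrite /peps /= tl_tr eps_tl.
- by move=> b [s t]; rewrite /peps /= tlb_tr eps_tlb.
- by move=> b [s t]; rewrite /peps /= (eps_tr b t).
- by move=> V f x; apply: pdec_counitl.
- by move=> V f x; apply: pdec_counitr.
Defined.

End Product.
End RCoalgTheory.

(** * Convolution *)

(* Left B^e-modules: [al b x] is b x and [ar b x] is \bar b x. *)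
Record bemod (k : fieldType) (B : algType k) := BeMod {
  bemod_sort :> lmodType k;
  al : B -> bemod_sort -> bemod_sort;
  ar : B -> bemod_sort -> bemod_sort;
  al_linear b : linear (al b);
  ar_linear b : linear (ar b);
  al_linearB x : linear (al^~ x);
  ar_linearB x : linear (ar^~ x);
  al1 x : al 1 x = x;
  ar1 x : ar 1 x = x;
  alM b c x : al (b * c) x = al b (al c x);
  arM b c x : ar (c * b) x = ar b (ar c x);
  al_ar b c x : al b (ar c x) = ar c (al b x)
}.

Definition regular_bemod (k : fieldType) (B : algType k) : bemod B.
Proof.
apply: (@BeMod _ _ B (fun b x => b * x) (fun b x => x * b)).
- by move=> b a x y; rewrite mulrDr scalerAr.
- by move=> b a x y; rewrite mulrDl scalerAl.
- by move=> x a b c; rewrite mulrDl scalerAl.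
- by move=> x a b c; rewrite mulrDr scalerAr.
- exact: mul1r.
- exact: mulr1.
- by move=> b c x; rewrite mulrA.
- by move=> b c x; rewrite mulrA.
- by move=> b c x; rewrite mulrA.
Defined.

Definition bimodule_bemod (k : fieldType) (B : algType k) (L : bimodule B) : bemod B :=
  @BeMod _ _ L _ _ (@lact_linear _ _ L) (@lbact_linear _ _ L)
    (@lact_linearB _ _ L) (@lbact_linearB _ _ L) (@lact1 _ _ L) (@lbact1 _ _ L)
    (@lactM _ _ L) (@lbactM _ _ L) (@lact_lbact _ _ L).

Section Conv.
Variables (k : fieldType) (B : algType k).
Implicit Types (S T U : rcoalg B) (M : bemod B).

Local Notation BB := (regular_bemod B).

Record behom T M := BeHom {
  hom_fun :> T -> M;
  hom_adm : adm hom_fun;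
  hom_tl b x : hom_fun (tl b x) = al b (hom_fun x);
  hom_tlb b x : hom_fun (tlb b x) = ar b (hom_fun x)
}.

Lemma hom_ext T M (f g : behom T M) : f =1 g -> f = g.
Proof.
case: f g => f f1 f2 f3 [g g1 g2 g3] /= /funext fg; subst g.
by congr BeHom; apply: Prop_irrelevance.
Qed.

Lemma hom_tlB T (f : behom T BB) b x : f (tl b x) = b * f x.
Proof. exact: hom_tl. Qed.

Lemma hom_tlbB T (f : behom T BB) b x : f (tlb b x) = f x * b.
Proof. exact: hom_tlb. Qed.

Lemma al_sum M (I : Type) (r : seq I) (F : I -> M) b :
  al b (\sum_(i <- r) F i) = \sum_(i <- r) al b (F i).
Proof. by rewrite (linear_big _ _ (al_linear b)). Qed.

Lemma ar_sum M (I : Type) (r : seq I) (F : I -> M) b :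
  ar b (\sum_(i <- r) F i) = \sum_(i <- r) ar b (F i).
Proof. by rewrite (linear_big _ _ (ar_linear b)). Qed.

Lemma al_suml M (I : Type) (r : seq I) (F : I -> B) (x : M) :
  al (\sum_(i <- r) F i) x = \sum_(i <- r) al (F i) x.
Proof. by rewrite (linear_big _ _ (al_linearB x)). Qed.

Lemma ar_suml M (I : Type) (r : seq I) (F : I -> B) (x : M) :
  ar (\sum_(i <- r) F i) x = \sum_(i <- r) ar (F i) x.
Proof. by rewrite (linear_big _ _ (ar_linearB x)). Qed.

Section Actions.
Variables (T : rcoalg B) (M : bemod B).

Lemma lconv_kernel (f : behom T BB) (F : behom T M) : ker2 (fun x y => al (f x) (F y)).
Proof.
split=> [y|x|b x y].
- exact: (adm_comp (al_linearB (F y)) (hom_adm f)).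
- exact: (adm_comp (al_linear (f x)) (hom_adm F)).
- by rewrite hom_tlbB alM hom_tl.
Qed.

Lemma rconv_kernel (F : behom T M) (f : behom T BB) : ker2 (fun x y => ar (f y) (F x)).
Proof.
split=> [y|x|b x y].
- exact: (adm_comp (ar_linear (f y)) (hom_adm F)).
- exact: (adm_comp (ar_linearB (F x)) (hom_adm f)).
- by rewrite hom_tlB arM hom_tlb.
Qed.

(** One operation with two uses: convolution of cochains for M = B, and the action of Sigma(X_1,
    Y_1) on a product in L for M = L. [rconv] is its mirror image, used for the inverse of Sigma. *)
Definition lconv (f : behom T BB) (F : behom T M) : behom T M.
Proof.
apply: (@BeHom T M (fun x => \sum_(p <- dec x) al (f p.1) (F p.2))).
- exact: dec_adm (lconv_kernel f F).
- move=> b x; rewrite (dec_tl _ _ (lconv_kernel f F)) al_sum.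
  by apply: eq_bigr => p _; rewrite hom_tlB alM.
- move=> b x; rewrite (dec_tlb _ _ (lconv_kernel f F)) ar_sum.
  by apply: eq_bigr => p _; rewrite hom_tlb al_ar.
Defined.

Definition rconv (F : behom T M) (f : behom T BB) : behom T M.
Proof.
apply: (@BeHom T M (fun x => \sum_(p <- dec x) ar (f p.2) (F p.1))).
- exact: dec_adm (rconv_kernel F f).
- move=> b x; rewrite (dec_tl _ _ (rconv_kernel F f)) al_sum.
  by apply: eq_bigr => p _; rewrite hom_tl al_ar.
- move=> b x; rewrite (dec_tlb _ _ (rconv_kernel F f)) ar_sum.
  by apply: eq_bigr => p _; rewrite hom_tlbB arM.
Defined.

End Actions.

Definition hom_eps T : behom T BB := @BeHom T BB (@eps _ _ T) (eps_adm T) (@eps_tl _ _ T) (@eps_tlb _ _ T).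

Section ActionTheory.
Variables (T : rcoalg B) (M : bemod B).
Implicit Types (f g : behom T BB) (F : behom T M).

Lemma lconvA f g F : lconv (lconv f g) F = lconv f (lconv g F).
Proof.
apply: hom_ext => x /=.
under eq_bigr do rewrite al_suml; under [RHS]eq_bigr do rewrite al_sum.
under eq_bigr do under eq_bigr do rewrite alM.
rewrite (dec_coassoc (K := fun x y z => al (f x) (al (g y) (F z)))) //.
split=> [y z|u z|u y|b u y z|b u y z].
- exact: (adm_comp (al_linearB _) (hom_adm f)).
- apply: (adm_comp (h := fun b => al (f u) (al b (F z)))) (hom_adm g) => a v w.
  by rewrite al_linearB al_linear.
- apply: (adm_comp (h := fun y' => al (f u) (al (g y) y'))) (hom_adm F) => a v w.
  by rewrite !al_linear.
- by rewrite hom_tlbB hom_tlB !alM.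
- by rewrite hom_tlbB hom_tl !alM.
Qed.

Lemma lrconv_kernel f F g : ker3 (fun x y z => al (f x) (ar (g z) (F y))).
Proof.
split=> [y z|u z|u y|b u y z|b u y z].
- exact: (adm_comp (al_linearB _) (hom_adm f)).
- apply: (adm_comp (h := fun y' => al (f u) (ar (g z) y'))) (hom_adm F) => a v w.
  by rewrite ar_linear al_linear.
- apply: (adm_comp (h := fun b => al (f u) (ar b (F y)))) (hom_adm g) => a v w.
  by rewrite ar_linearB al_linear.
- by rewrite hom_tlbB hom_tl alM -al_ar.
- by rewrite hom_tlB hom_tlb arM.
Qed.

(** Coassociativity, together with the commutation of b and \bar c on M. With [lconvA] and [rconvA]
    it makes the maps into M a bimodule over the convolution algebra. *)
Lemma lrconvA f F g : rconv (lconv f F) g = lconv f (rconv F g).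
Proof.
apply: hom_ext => x /=.
under eq_bigr do rewrite ar_sum; under [RHS]eq_bigr do rewrite al_sum.
under eq_bigr do under eq_bigr do rewrite -al_ar.
by rewrite (dec_coassoc _ (lrconv_kernel f F g)).
Qed.

Lemma rconvA F f g : rconv (rconv F f) g = rconv F (lconv f g).
Proof.
apply: hom_ext => x /=.
under eq_bigr do rewrite ar_sum; under [RHS]eq_bigr do rewrite ar_suml.
under [RHS]eq_bigr do under eq_bigr do rewrite arM.
rewrite (dec_coassoc (K := fun x y z => ar (g z) (ar (f y) (F x)))) //.
split=> [y z|u z|u y|b u y z|b u y z].
- apply: (adm_comp (h := fun y' => ar (g z) (ar (f y) y'))) (hom_adm F) => a v w.
  by rewrite !ar_linear.
- apply: (adm_comp (h := fun b => ar (g z) (ar b (F u)))) (hom_adm f) => a v w.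
  by rewrite ar_linearB ar_linear.
- exact: (adm_comp (ar_linearB _) (hom_adm g)).
- by rewrite hom_tlB hom_tlb arM.
- by rewrite hom_tlB hom_tlbB !arM.
Qed.

Lemma lconv1 F : lconv (hom_eps T) F = F.
Proof.
apply: hom_ext => x /=; rewrite -[RHS](dec_counitl x (hom_adm F)).
by apply: eq_bigr => p _; rewrite hom_tl.
Qed.

Lemma rconv1 F : rconv F (hom_eps T) = F.
Proof.
apply: hom_ext => x /=; rewrite -[RHS](dec_counitr x (hom_adm F)).
by apply: eq_bigr => p _; rewrite hom_tlb.
Qed.

End ActionTheory.

(** For M = B the sums defining [lconv] and [rconv] coincide, so the right counit law gives a right
    unit. *)
Lemma lconv1r T (f : behom T BB) : lconv f (hom_eps T) = f.
Proof. by rewrite -[RHS]rconv1; apply: hom_ext. Qed.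

Record cochain T := Cochain {
  cochain_hom :> behom T BB;
  cochain_tr x b : cochain_hom (tr x b) = cochain_hom (trb x b)
}.

Lemma cochain_ext T (f g : cochain T) : f =1 g -> f = g.
Proof.
case: f g => f f1 [g g1] /= fg; have {}fg := hom_ext (M := BB) fg; subst g.
by congr Cochain; apply: Prop_irrelevance.
Qed.

Lemma cochain_hom_inj T : injective (@cochain_hom T).
Proof. by move=> f g fg; apply: cochain_ext => x; rewrite fg. Qed.

Definition cone T : cochain T := @Cochain T (hom_eps T) (fun x b => eps_tr b x).

(** The right action of b starts on the leg of f, becomes \bar b there by [cochain_tr], crosses to
    the leg of g by Takeuchi invariance, and becomes \bar b again by [cochain_tr] for g. *)
Lemma cmul_proof T (f g : cochain T) x b :
  lconv f g (tr x b) = lconv f g (trb x b).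
Proof.
rewrite /= (dec_tr _ _ (lconv_kernel f g)) (dec_trb _ _ (lconv_kernel f g)).
under eq_bigr do rewrite cochain_tr; under [RHS]eq_bigr do rewrite -cochain_tr.
exact: (dec_takeuchi _ _ (lconv_kernel f g)).
Qed.

Definition cmul T (f g : cochain T) : cochain T := Cochain (cmul_proof f g).

Lemma cmulE T (f g : cochain T) x : cmul f g x = \sum_(p <- dec x) f p.1 * g p.2.
Proof. by []. Qed.

Lemma cmulA T (f g h : cochain T) : cmul f (cmul g h) = cmul (cmul f g) h.
Proof. by apply: cochain_hom_inj; rewrite /= lconvA. Qed.

Lemma cmul1l T (f : cochain T) : cmul (cone T) f = f.
Proof. by apply: cochain_hom_inj; rewrite /= lconv1. Qed.

Lemma cmul1r T (f : cochain T) : cmul f (cone T) = f.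
Proof. by apply: cochain_hom_inj; rewrite /= lconv1r. Qed.

(* x |-> g(x b) and x |-> g(x \bar b) have the same convolution product with f,
   hence agree. *)
Lemma inverse_cochain_tr T (f : cochain T) (g : behom T BB) :
  lconv f g = hom_eps T -> lconv g f = hom_eps T ->
  forall x b, g (tr x b) = g (trb x b).
Proof.
move=> fg gf x b.
have gtrP (tr' : T -> B -> T) :
    (forall c y, tr' (tl c y) b = tl c (tr' y b)) ->
    (forall c y, tr' (tlb c y) b = tlb c (tr' y b)) ->
    adm (fun y => g (tr' y b)) -> exists h : behom T BB, h =1 fun y => g (tr' y b).
  move=> h1 h2 ga; unshelve eexists.
    by apply: (@BeHom T BB (fun y => g (tr' y b)) ga) => c y;
      rewrite ?h1 ?h2 ?hom_tlB ?hom_tlbB.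
  by [].
have [h1 h1E] := gtrP _ (fun c y => tl_tr c b y) (fun c y => tlb_tr c b y) (adm_tr b (hom_adm g)).
have [h2 h2E] := gtrP _ (fun c y => tl_trb c b y) (fun c y => tlb_trb c b y) (adm_trb b (hom_adm g)).
rewrite -[LHS]h1E -[RHS]h2E; congr (hom_fun _ x).
suff e : lconv h1 f = lconv h2 f.
  by rewrite -[h1]lconv1r -[h2]lconv1r -fg -!lconvA e.
apply: hom_ext => y /=.
transitivity (lconv g f (tr y b)).
  rewrite /= (dec_tr _ _ (lconv_kernel g f)).
  by apply: eq_bigr => p _; rewrite h1E.
rewrite gf /= eps_tr -[RHS]/(\sum_(p <- dec y) h2 p.1 * f p.2).
under [RHS]eq_bigr do rewrite h2E.
rewrite (dec_takeuchi _ _ (lconv_kernel g f)) /=.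
under [RHS]eq_bigr do rewrite cochain_tr.
rewrite -(dec_trb _ _ (lconv_kernel g f)).
by rewrite -[RHS]/(lconv g f (trb y b)) gf.
Qed.

End Conv.

Local Notation "S ** T" := (prod_rcoalg S T) (at level 40, left associativity).

(** * Morphisms of coalgebroids and pullback of cochains *)

Section Mor.
Variables (k : fieldType) (B : algType k).
Implicit Types (S T U : rcoalg B) (M : bemod B).
Local Notation BB := (regular_bemod B).

Lemma sum_dec_prod S T (V : lmodType k) (K : S ** T -> S ** T -> V) (s : S) (t : T) :
  \sum_(u <- dec ((s, t) : S ** T)) K u.1 u.2 =
  \sum_(q <- dec t) \sum_(p <- dec s) K (p.1, q.1) (p.2, q.2).
Proof. exact: (sum_pdec' K). Qed.

(* The equations are only required up to admissible maps: [mor_unitl] below sends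
   b X to (1, b X), which equals b (1, X) in the tensor product only. *)
Record mor S T := Mor {
  mor_fun :> S -> T;
  mor_adm (V : lmodType k) (f : T -> V) : adm f -> adm (fun x => f (mor_fun x));
  mor_tl (V : lmodType k) (f : T -> V) b x : adm f ->
    f (mor_fun (tl b x)) = f (tl b (mor_fun x));
  mor_tlb (V : lmodType k) (f : T -> V) b x : adm f ->
    f (mor_fun (tlb b x)) = f (tlb b (mor_fun x));
  mor_tr (V : lmodType k) (f : T -> V) b x : adm f ->
    f (mor_fun (tr x b)) = f (tr (mor_fun x) b);
  mor_trb (V : lmodType k) (f : T -> V) b x : adm f ->
    f (mor_fun (trb x b)) = f (trb (mor_fun x) b);
  mor_dec (V : lmodType k) (K : T -> T -> V) x : ker2 K ->
    \sum_(p <- dec (mor_fun x)) K p.1 p.2 =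
    \sum_(p <- dec x) K (mor_fun p.1) (mor_fun p.2);
  mor_eps x : eps (mor_fun x) = eps x
}.

Section Pullback.
Variables (S T : rcoalg B) (phi : mor S T).

Definition hpull M (f : behom T M) : behom S M.
Proof.
apply: (@BeHom _ _ S M (fun x => f (phi x))).
- exact: mor_adm (hom_adm f).
- by move=> b x; rewrite (mor_tl _ _ _ (hom_adm f)) hom_tl.
- by move=> b x; rewrite (mor_tlb _ _ _ (hom_adm f)) hom_tlb.
Defined.

Lemma hpull_lconv M (f : behom T BB) (F : behom T M) :
  hpull (lconv f F) = lconv (hpull f) (hpull F).
Proof. by apply: hom_ext => x; apply: (mor_dec _ _ (lconv_kernel f F)). Qed.

Lemma hpull_rconv M (F : behom T M) (f : behom T BB) :
  hpull (rconv F f) = rconv (hpull F) (hpull f).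
Proof. by apply: hom_ext => x; apply: (mor_dec _ _ (rconv_kernel F f)). Qed.

Lemma cpull_proof (f : cochain T) x b : hpull f (tr x b) = hpull f (trb x b).
Proof.
by rewrite /= (mor_tr _ _ _ (hom_adm f)) (mor_trb _ _ _ (hom_adm f)) cochain_tr.
Qed.

Definition cpull (f : cochain T) : cochain S := Cochain (cpull_proof f).

Lemma cpullM (f g : cochain T) : cpull (cmul f g) = cmul (cpull f) (cpull g).
Proof. by apply: cochain_hom_inj; apply: hpull_lconv. Qed.

Lemma cpull1 : cpull (cone T) = cone S.
Proof. by apply: cochain_ext => x; apply: mor_eps. Qed.

End Pullback.

Definition mor_id T : mor T T.
Proof. by apply: (@Mor T T (fun x => x)). Defined.

Section MorProd.
Variables (S S' T T' : rcoalg B) (phi : mor S S') (psi : mor T T').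

Definition mor_prod : mor (S ** T) (S' ** T').
Proof.
apply: (@Mor (S ** T) (S' ** T') (fun x => (phi x.1, psi x.2))).
- move=> V f [f1 f2 f3 f4]; split=> [t|s|s t b|s t b] /=.
  + exact: (mor_adm phi (f1 _)).
  + exact: (mor_adm psi (f2 _)).
  + rewrite (mor_tr _ _ _ (f1 _)) f3; apply/esym; exact: (mor_tl _ _ _ (f2 _)).
  + rewrite (mor_trb _ _ _ (f1 _)) f4; apply/esym; exact: (mor_tlb _ _ _ (f2 _)).
- by move=> V f b [s t] [f1 f2 f3 f4]; apply: (mor_tl _ _ _ (f1 _)).
- by move=> V f b [s t] [f1 f2 f3 f4]; apply: (mor_tlb _ _ _ (f1 _)).
- by move=> V f b [s t] [f1 f2 f3 f4]; apply: (mor_tr _ _ _ (f2 _)).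
- by move=> V f b [s t] [f1 f2 f3 f4]; apply: (mor_trb _ _ _ (f2 _)).
- move=> V K [s t] KP; rewrite sum_dec_prod.
  rewrite (sum_dec_prod (fun x y => K (phi x.1, psi x.2) (phi y.1, psi y.2))) /=.
  rewrite (mor_dec _ _ (kernel2_snd KP (phi s))); apply: eq_bigr => q _.
  exact: (mor_dec _ _ (kernel2_fst KP _ _)).
- move=> [s t] /=; rewrite /= -[LHS](mor_tr phi (eps (psi t)) s (eps_adm S')).
  by rewrite !mor_eps.
Defined.

End MorProd.

Definition mor_assoc S T U : mor (S ** (T ** U)) ((S ** T) ** U).
Proof.
apply: (@Mor (S ** (T ** U)) ((S ** T) ** U) (fun x => ((x.1, x.2.1), x.2.2))).
- move=> V f [f1 f2 f3 f4]; split=> [[t u]|s|s [t u] b|s [t u] b] /=.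
  + by case: (f1 u).
  + split=> [u|t|t u b|t u b].
    * by case: (f1 u).
    * exact: (f2 (s, t)).
    * exact: (f3 (s, t)).
    * exact: (f4 (s, t)).
  + by case: (f1 u).
  + by case: (f1 u).
- by [].
- by [].
- by [].
- by [].
- move=> V K [s [t u]] KP; rewrite sum_dec_prod.
  rewrite (sum_dec_prod (fun x y : S ** (T ** U) => K ((x.1, x.2.1), x.2.2) ((y.1, y.2.1), y.2.2))) /=.
  rewrite (sum_pdec' (fun y1 y2 : T * U => \sum_(p <- dec s) K ((p.1, y1.1), y1.2) ((p.2, y2.1), y2.2))) /=.
  apply: eq_bigr => q _.
  exact: (sum_pdec' (fun x y : S * T => K (x, q.1) (y, q.2))).
- by move=> [s [t u]].
Defined.

End Mor.

(** * Coface maps and twists *)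

Section FirstLast.
Variables (k : fieldType) (B : algType k).
Implicit Types (S T U : rcoalg B) (M : bemod B).
Local Notation BB := (regular_bemod B).

Section OneSided.
Variables (T : rcoalg B) (V : lmodType k).
Implicit Types (f : cochain T) (H : T -> V).

(* H(f(x_(1)) x_(2)) and H(\bar{f(x_(2))} x_(1)) *)
Definition lcv f H x := \sum_(p <- dec x) H (tl (f p.1) p.2).
Definition rcv H f x := \sum_(p <- dec x) H (tlb (f p.2) p.1).

Lemma lcv_kernel f H : adm H -> ker2 (fun x y => H (tl (f x) y)).
Proof.
move=> HP; split=> [y|x|b x y].
- exact: (adm_comp (tl_linear y HP) (hom_adm f)).
- exact: adm_tl.
- by rewrite hom_tlbB tlM.
Qed.

Lemma rcv_kernel f H : adm H -> ker2 (fun x y => H (tlb (f y) x)).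
Proof.
move=> HP; split=> [y|x|b x y].
- exact: adm_tlb.
- exact: (adm_comp (tlb_linear x HP) (hom_adm f)).
- by rewrite hom_tlB tlbM.
Qed.

Lemma rcv_adm f H : adm H -> adm (rcv H f).
Proof. by move=> HP; apply: dec_adm (rcv_kernel f HP). Qed.

Lemma rcv_tl f H b x : adm H -> rcv H f (tl b x) = rcv (fun y => H (tl b y)) f x.
Proof.
move=> HP; rewrite /rcv (dec_tl _ _ (rcv_kernel f HP)).
by apply: eq_bigr => p _; rewrite tl_tlb.
Qed.

End OneSided.

Lemma lcv_lconv T M (f : cochain T) (F : behom T M) : lcv f F =1 lconv f F.
Proof. by move=> x; apply: eq_bigr => p _; rewrite hom_tl. Qed.

Lemma rcv_rconv T M (f : cochain T) (F : behom T M) : rcv F f =1 rconv F f.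
Proof. by move=> x; apply: eq_bigr => p _; rewrite hom_tlb. Qed.

Lemma cmul_lcv T (f g : cochain T) : cmul f g =1 lcv f g.
Proof. by move=> x; rewrite lcv_lconv. Qed.

Lemma cmul_rcv T (f g : cochain T) : cmul f g =1 rcv f g.
Proof. by move=> x; rewrite (rcv_rconv (M := BB)). Qed.

Lemma eq_lcv T (V : lmodType k) (f g : cochain T) (H H' : T -> V) x :
  f =1 g -> H =1 H' -> lcv f H x = lcv g H' x.
Proof. by move=> fg HH'; apply: eq_bigr => p _; rewrite fg HH'. Qed.

Lemma lcv_pull S T (phi : mor S T) (V : lmodType k) (f : cochain T) (H : T -> V) x :
  adm H -> lcv f H (phi x) = lcv (cpull phi f) (H \o phi) x.
Proof.
move=> HP; rewrite /lcv (mor_dec _ _ (lcv_kernel f HP)).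
by apply: eq_bigr => p _; rewrite /= (mor_tl _ _ _ HP).
Qed.

Lemma rcv_pull S T (phi : mor S T) (V : lmodType k) (f : cochain T) (H : T -> V) x :
  adm H -> rcv H f (phi x) = rcv (H \o phi) (cpull phi f) x.
Proof.
move=> HP; rewrite /rcv (mor_dec _ _ (rcv_kernel f HP)).
by apply: eq_bigr => p _; rewrite /= (mor_tlb _ _ _ HP).
Qed.

Section First.
Variables (S T : rcoalg B).

Definition first_hom (f : cochain T) : behom (S ** T) BB.
Proof.
apply: (@BeHom _ _ (S ** T) BB (fun x => eps (tr x.1 (f x.2)))).
- by apply: padm_first (hom_adm f) _ _ => b t; rewrite ?hom_tlB ?hom_tlbB.
- by move=> b x; rewrite /= tl_tr eps_tl.
- by move=> b x; rewrite /= tlb_tr eps_tlb.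
Defined.

Lemma first_tr (f : cochain T) x b : first_hom f (tr x b) = first_hom f (trb x b).
Proof. by rewrite /= cochain_tr. Qed.

Definition cfirst f := Cochain (first_tr f).

Variables (V : lmodType k) (H : S ** T -> V) (HP : adm H).

(** The counit law in S contracts the coproduct of s, so only t is split, and the value of f crosses
    the tensor sign as a right action on s. *)
Lemma lcv_first f s t : lcv (cfirst f) H (s, t) = \sum_(q <- dec t) H (tr s (f q.1), q.2).
Proof.
case: (HP) => H1 H2 H3 H4.
rewrite /lcv (sum_dec_prod (fun x y => H (tl (cfirst f x) y))) /=.
apply: eq_bigr => q _; rewrite -(dec_counitl _ (H1 q.2)).
rewrite (dec_tr (K := fun x y => H (tl (eps x) y, q.2))) //.
split=> [y|x|b x y].
- exact: (adm_comp (tl_linear y (H1 q.2)) (eps_adm S)).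
- exact: adm_tl (H1 q.2).
- by rewrite eps_tlb tlM.
Qed.

Lemma rcv_first f s t : rcv H (cfirst f) (s, t) = \sum_(q <- dec t) H (trb s (f q.2), q.1).
Proof.
case: (HP) => H1 H2 H3 H4.
rewrite /rcv (sum_dec_prod (fun x y => H (tlb (cfirst f y) x))) /=.
apply: eq_bigr => q _; rewrite -(dec_counitr _ (H1 q.1)).
under eq_bigr do rewrite eps_tr.
rewrite (dec_trb (K := fun x y => H (tlb (eps y) x, q.1))) //.
split=> [y|x|b x y].
- exact: adm_tlb (H1 q.1).
- exact: (adm_comp (tlb_linear x (H1 q.1)) (eps_adm S)).
- by rewrite eps_tl tlbM.
Qed.

End First.

Section Last.
Variables (S T : rcoalg B).

Definition last_hom (f : cochain S) : behom (S ** T) BB.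
Proof.
apply: (@BeHom _ _ (S ** T) BB (fun x => f (tr x.1 (eps x.2)))).
- split=> [t|s|s t b|s t b] /=.
  + exact: (adm_tr _ (hom_adm f)).
  + exact: (adm_comp (tr_linear s (hom_adm f)) (eps_adm T)).
  + by rewrite eps_tl trM.
  (* Balance over \bar b is where f(s b) = f(s \bar b) enters. *)
  + by rewrite eps_tlb tr_trb -cochain_tr trM.
- by move=> b x; rewrite /= tl_tr hom_tlB.
- by move=> b x; rewrite /= tlb_tr hom_tlbB.
Defined.

Lemma last_tr (f : cochain S) x b : last_hom f (tr x b) = last_hom f (trb x b).
Proof. by rewrite /= eps_tr. Qed.

Definition clast f := Cochain (last_tr f).

Variables (V : lmodType k) (H : S ** T -> V) (HP : adm H).

(** In f(p_1 eps(q_1)) the right action of eps(q_1) is replaced by its bar, crosses to p_2 by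
    Takeuchi invariance and passes to q_2 by balance, where the counit law removes the coproduct of
    t. *)
Lemma lcv_last f s t : lcv (clast f) H (s, t) = lcv f (fun x => H (x, t)) s.
Proof.
case: (HP) => H1 H2 H3 H4.
rewrite /lcv (sum_dec_prod (fun x y => H (tl (clast f x) y))) /=.
transitivity (\sum_(q <- dec t) \sum_(p <- dec s) H (tl (f p.1) p.2, tl (eps q.1) q.2)).
  apply: eq_bigr => q _; under eq_bigr do rewrite cochain_tr.
  rewrite (dec_takeuchi _ _ (lcv_kernel f (H1 q.2))).
  by apply: eq_bigr => p _; rewrite -H3 tl_tr.
rewrite exchange_big; apply: eq_bigr => p _.
exact: (dec_counitl _ (H2 _)).
Qed.

Lemma rcv_last f s t : rcv H (clast f) (s, t) = rcv (fun x => H (x, t)) f s.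
Proof.
case: (HP) => H1 H2 H3 H4.
rewrite /rcv (sum_dec_prod (fun x y => H (tlb (clast f y) x))) /=.
transitivity (\sum_(q <- dec t) \sum_(p <- dec s) H (tlb (f p.2) p.1, tlb (eps q.2) q.1)).
  apply: eq_bigr => q _.
  rewrite -(dec_takeuchi _ _ (rcv_kernel f (H1 q.1))).
  by apply: eq_bigr => p _; rewrite -H4 tlb_trb.
rewrite exchange_big; apply: eq_bigr => p _.
exact: (dec_counitr _ (H2 _)).
Qed.

End Last.

Section FirstLastTheory.
Variables (S T : rcoalg B).

Lemma cfirst1 : cfirst S (cone T) = cone (S ** T).
Proof. exact: cochain_ext. Qed.

Lemma clast1 : clast T (cone S) = cone (S ** T).
Proof. exact: cochain_ext. Qed.

Lemma cfirstM (f g : cochain T) : cfirst S (cmul f g) = cmul (cfirst S f) (cfirst S g).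
Proof.
apply: cochain_ext => -[s t]; rewrite cmul_lcv lcv_first /=; last exact: (hom_adm (cfirst S g)).
rewrite (linear_big _ _ (tr_linear (r := S) s (eps_adm S))).
by apply: eq_bigr => q _; rewrite trM.
Qed.

Lemma clastM (f g : cochain S) : clast T (cmul f g) = cmul (clast T f) (clast T g).
Proof.
apply: cochain_ext => -[s t]; rewrite cmul_lcv lcv_last; last exact: (hom_adm (clast T g)).
rewrite [LHS](_ : _ = lconv f g (tr s (eps t))) // /= (dec_tr _ _ (lconv_kernel f g)) /=.
under eq_bigr do rewrite cochain_tr.
rewrite (dec_takeuchi _ _ (lconv_kernel f g)).
by apply: eq_bigr => p _; rewrite /= tl_tr hom_tlB.
Qed.

(** Both products are (s, t) |-> f(s g(t)). *)
Lemma cfirst_clastC (f : cochain S) (g : cochain T) :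
  cmul (clast T f) (cfirst S g) = cmul (cfirst S g) (clast T f).
Proof.
apply: cochain_ext => -[s t]; transitivity (f (tr s (g t))).
  rewrite cmul_lcv lcv_last; last exact: (hom_adm (cfirst S g)).
  rewrite -[in RHS](cmul1r f) [RHS]/= (dec_tr _ _ (lconv_kernel f (cone S))) /=.
  under [RHS]eq_bigr do rewrite cochain_tr.
  rewrite (dec_takeuchi _ _ (lconv_kernel f (cone S))) /=.
  by apply: eq_bigr => p _; rewrite /= tl_tr eps_tl.
rewrite cmul_lcv lcv_first /=; last exact: (hom_adm (clast T f)).
rewrite -[in LHS](cmul1r g) cmulE (linear_big _ _ (tr_linear (r := S) s (hom_adm f))).
by apply: eq_bigr => q _; rewrite trM.
Qed.

End FirstLastTheory.

(* chi'(x) = f(x_(1)) \bar{g(x_(3))} chi(x_(2)) *)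
Definition twist_of S T (chi' chi : mor S T) (f g : cochain S) :=
  forall (V : lmodType k) (G : T -> V), adm G ->
    (fun x => G (chi' x)) =1 lcv f (rcv (fun x => G (chi x)) g).

Section TwistTheory.
Variables (S T U : rcoalg B) (chi' chi : mor S T) (f g : cochain S).
Hypothesis chiP : twist_of chi' chi f g.

Lemma twist_cpull (h : cochain T) :
  cpull chi' h = cmul (cmul f (cpull chi h)) g.
Proof.
apply: cochain_ext => x; rewrite -cmulA cmul_lcv.
rewrite -[LHS]/(h (chi' x)) (chiP (hom_adm h)).
by apply: eq_lcv => // y; rewrite cmul_rcv.
Qed.

Lemma twist_hpull M (h : behom T M) :
  hpull chi' h = lconv f (rconv (hpull chi h) g).
Proof.
apply: hom_ext => x; rewrite -lcv_lconv.
rewrite -[LHS]/(h (chi' x)) (chiP (hom_adm h)).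
by apply: eq_lcv => // y; rewrite -rcv_rconv.
Qed.

Lemma twist_prod_id :
  twist_of (mor_prod chi' (mor_id U)) (mor_prod chi (mor_id U)) (clast U f) (clast U g).
Proof.
move=> V G GP [s u] /=; have [G1 _ _ _] := GP.
have GcP := mor_adm (mor_prod chi (mor_id U)) GP.
rewrite lcv_last; last exact: rcv_adm.
rewrite (chiP (G1 u)); apply: eq_lcv => // y.
by rewrite rcv_last.
Qed.

Lemma twist_id_prod :
  twist_of (mor_prod (mor_id U) chi') (mor_prod (mor_id U) chi) (cfirst U f) (cfirst U g).
Proof.
move=> V G GP [u s] /=; have [_ G2 _ _] := GP.
have GcP := mor_adm (mor_prod (mor_id U) chi) GP.
rewrite lcv_first; last exact: rcv_adm.
rewrite (chiP (G2 u)); apply: eq_bigr => p _.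
rewrite rcv_first // rcv_tl; last exact: mor_adm (G2 u).
case: GcP => _ _ G3 G4; rewrite /= in G3 G4.
(* The actions by the values of f and g pass across the tensor sign to u, where they commute. *)
by apply: eq_bigr => q _; rewrite tl_tlb -G4 -G3 tr_trb.
Qed.

End TwistTheory.

Lemma mor_kernel2 S T (phi : mor S T) (V : lmodType k) (K : T -> T -> V) :
  ker2 K -> ker2 (fun x y => K (phi x) (phi y)).
Proof.
move=> [K1 K2 K3]; split=> [y|x|b x y].
- exact: (mor_adm phi (K1 _)).
- exact: (mor_adm phi (K2 _)).
- by rewrite (mor_tlb _ _ _ (K1 _)) K3 (mor_tl _ _ _ (K2 _)).
Qed.

Definition mor_comp S T U (psi : mor T U) (phi : mor S T) : mor S U.
Proof.
apply: (@Mor _ _ S U (psi \o phi)) => /=.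
- by move=> V G GP; apply: (mor_adm phi (mor_adm psi GP)).
- by move=> V G b x GP; rewrite (mor_tl _ _ _ (mor_adm psi GP)) (mor_tl _ _ _ GP).
- by move=> V G b x GP; rewrite (mor_tlb _ _ _ (mor_adm psi GP)) (mor_tlb _ _ _ GP).
- by move=> V G b x GP; rewrite (mor_tr _ _ _ (mor_adm psi GP)) (mor_tr _ _ _ GP).
- by move=> V G b x GP; rewrite (mor_trb _ _ _ (mor_adm psi GP)) (mor_trb _ _ _ GP).
- move=> V K x KP; rewrite (mor_dec _ _ KP).
  exact: (mor_dec phi x (mor_kernel2 psi KP)).
- by move=> x; rewrite !mor_eps.
Defined.

Lemma twist_comp S T U (chi' chi : mor T U) (f g : cochain T) (phi : mor S T) :
  twist_of chi' chi f g ->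
  twist_of (mor_comp chi' phi) (mor_comp chi phi) (cpull phi f) (cpull phi g).
Proof.
move=> chiP V G GP x; rewrite /= (chiP _ _ GP) lcv_pull.
  by apply: eq_lcv => // y; rewrite /= rcv_pull //; apply: mor_adm GP.
by apply: rcv_adm; apply: mor_adm GP.
Qed.

End FirstLast.

(** * The coalgebroid L *)

Section DiamondLift.
Variables (k : fieldType) (B : algType k) (L : bimodule B) (V : lmodType k).

(** L alone has no tensor sign to balance, so only linearity is asked. *)
Definition ladm (W : lmodType k) (f : L -> W) := linear f.

Lemma diamond2_lift (K : L -> L -> V) :
  kernel2 ladm (@lact _ _ L) (@lbact _ _ L) K ->
  exists g : {linear diamond L 2 -> V}, forall w, g (dpure w) = K w`_0 w`_1.
Proof.
move=> [K1 K2 K3]; apply: (tensor_lift (F := fun w : 2.-tuple L => K w`_0 w`_1)).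
  move=> u v a x y p q r hp hq hr; move: (size_tuple p); rewrite hp hq hr.
  (* The length of [u] is the index of the slot concerned; a longer prefix contradicts the size of
     [p]. *)
  case: u {hp hq hr} => [|u0 [|u1 u]] /=; last by case: u.
  - by rewrite (K1 v`_0).
  - by rewrite (K2 u0).
move=> u v c x y p q hp hq; move: (size_tuple p); rewrite hp hq.
case: u {hp hq} => [|u0 [|u1 u]] /=; last by case: u.
- by rewrite K3.
- by [].
Qed.

Lemma diamond3_lift (K : L -> L -> L -> V) :
  kernel3 ladm (@lact _ _ L) (@lbact _ _ L) K ->
  exists g : {linear diamond L 3 -> V}, forall w, g (dpure w) = K w`_0 w`_1 w`_2.
Proof.
move=> [K1 K2 K3 K4 K5].
apply: (tensor_lift (F := fun w : 3.-tuple L => K w`_0 w`_1 w`_2)).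
  move=> u v a x y p q r hp hq hr; move: (size_tuple p); rewrite hp hq hr.
  case: u {hp hq hr} => [|u0 [|u1 [|u2 u]]] /=; last by case: u.
  - by rewrite (K1 v`_0 v`_1).
  - by rewrite (K2 u0 v`_0).
  - by rewrite (K3 u0 u1).
move=> u v c x y p q hp hq; move: (size_tuple p); rewrite hp hq.
case: u {hp hq} => [|u0 [|u1 [|u2 u]]] /=; last by case: u.
- by rewrite K4.
- by rewrite K5.
- by [].
Qed.

End DiamondLift.

Section Carrier.
Variables (k : fieldType) (B : algType k) (L : coalgebroid B).

Local Notation lker2 := (kernel2 (@ladm _ _ L) (@lact _ _ L) (@lbact _ _ L)).
Local Notation lker3 := (kernel3 (@ladm _ _ L) (@lact _ _ L) (@lbact _ _ L)).

(** Extracted from the Takeuchi property, so that the invariance holds for this very list. *)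
Definition cop_list (X : L) : seq (2.-tuple L) :=
  s2val (cid2 (cop_takeuchi X)).

Lemma cop_listP : presents (@cop _ _ L) cop_list.
Proof. by move=> X; rewrite /cop_list; case: cid2. Qed.

Lemma cop_list_takeuchi X b :
  \sum_(x <- cop_list X) dpure [tuple rbact x`_0 b; x`_1] =
  \sum_(x <- cop_list X) dpure [tuple x`_0; ract x`_1 b].
Proof. by rewrite /cop_list; case: cid2. Qed.

Definition ldec (X : L) : seq (L * L) := [seq (x`_0, x`_1) | x : 2.-tuple L <- cop_list X].

Lemma sum_ldec (V : lmodType k) (K : L -> L -> V) X :
  \sum_(p <- ldec X) K p.1 p.2 = \sum_(x <- cop_list X) K x`_0 x`_1.
Proof. by rewrite big_map. Qed.

(** A balanced map factors through L <> L and cannot distinguish two presentations of X_1 (x) X_2;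
    thus the chosen [ldec] can stand for an arbitrary Sweedler list. *)
Lemma sum_ldec_cop (V : lmodType k) (K : L -> L -> V) (X : L) (l : seq (2.-tuple L)) :
  lker2 K -> cop L X = \sum_(x <- l) dpure x ->
  \sum_(x <- l) K x`_0 x`_1 = \sum_(p <- ldec X) K p.1 p.2.
Proof.
move=> /diamond2_lift [g gE] hl; rewrite sum_ldec.
have := congr1 g hl; rewrite cop_listP !raddf_sum /= => h.
by under eq_bigr do rewrite -gE; under [RHS]eq_bigr do rewrite -gE.
Qed.

Lemma sum_ldec_map (V : lmodType k) (K : L -> L -> V) (X Y : L) (f g : L -> L) :
  lker2 K -> cop L Y = \sum_(x <- cop_list X) dpure [tuple f x`_0; g x`_1] ->
  \sum_(p <- ldec Y) K p.1 p.2 = \sum_(p <- ldec X) K (f p.1) (g p.2).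
Proof.
move=> KP hY; pose l := [seq [tuple f x`_0; g x`_1] | x : 2.-tuple L <- cop_list X].
rewrite -(sum_ldec_cop (l := l) KP); first by rewrite big_map big_map.
by rewrite hY big_map.
Qed.

Hypothesis cop_ract : forall b (X : L) l, cop L X = \sum_(x <- l) dpure x ->
  cop L (ract X b) = \sum_(x <- l) dpure [tuple ract x`_0 b; x`_1].
Hypothesis cop_rbact : forall b (X : L) l, cop L X = \sum_(x <- l) dpure x ->
  cop L (rbact X b) = \sum_(x <- l) dpure [tuple x`_0; rbact x`_1 b].
Hypothesis counit_right : forall b (X : L), counit L (ract X b) = counit L (rbact X b).

Lemma ldec_takeuchi (V : lmodType k) (K : L -> L -> V) b X : lker2 K ->
  \sum_(p <- ldec X) K (rbact p.1 b) p.2 = \sum_(p <- ldec X) K p.1 (ract p.2 b).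
Proof.
move=> /diamond2_lift [g gE]; have := congr1 g (cop_list_takeuchi X b).
rewrite !raddf_sum !big_map /= => h.
by under eq_bigr do rewrite -(gE [tuple _; _]);
  under [RHS]eq_bigr do rewrite -(gE [tuple _; _]).
Qed.

Lemma ldec_linear (V : lmodType k) (K : L -> L -> V) : lker2 K ->
  linear (fun X => \sum_(p <- ldec X) K p.1 p.2).
Proof.
move=> /diamond2_lift [g gE] a X Y /=.
have dE Z : \sum_(p <- ldec Z) K p.1 p.2 = g (cop L Z).
  by rewrite sum_ldec cop_listP raddf_sum; apply: eq_bigr => x _; rewrite /= gE.
by rewrite !dE !linearP.
Qed.

Lemma ldec_coassoc (V : lmodType k) (K : L -> L -> L -> V) X : lker3 K ->
  \sum_(p <- ldec X) \sum_(q <- ldec p.1) K q.1 q.2 p.2 =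
  \sum_(p <- ldec X) \sum_(q <- ldec p.2) K p.1 q.1 q.2.
Proof.
move=> /diamond3_lift [g gE]; have := congr1 g (cop_coassoc X cop_listP).
rewrite !raddf_sum !big_map /=; under eq_bigr do rewrite raddf_sum.
under [in RHS]eq_bigr do rewrite raddf_sum.
move=> h; under eq_bigr do rewrite big_map; under [RHS]eq_bigr do rewrite big_map.
under eq_bigr do under eq_bigr do rewrite -(gE [tuple _; _; _]).
by under [RHS]eq_bigr do under eq_bigr do rewrite -(gE [tuple _; _; _]).
Qed.

(** The record [coalgebroid] fixes how Delta and eps behave under left actions. The rules for right
    actions are the section hypotheses and are supplied later by the product ([coquasi_cop_ract],
    [coquasi_cop_rbact], [coquasi_counit_right]). *)
Definition carrier : rcoalg B.
Proof.
apply: (@RCoalg _ _ L (@lact _ _ L) (@lbact _ _ L) (@ract _ _ L) (@rbact _ _ L)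
  (@ladm _ _ L) ldec (counit L)).
- exact: lactM.
- exact: lbactM.
- exact: lact1.
- exact: lbact1.
- exact: ractM.
- exact: rbactM.
- exact: lact_lbact.
- exact: ract_rbact.
- exact: lact_ract.
- exact: lact_rbact.
- exact: lbact_ract.
- exact: lbact_rbact.
- by move=> V a x y; rewrite scaler0 addr0.
- by move=> V f g fP gP a x y; rewrite fP gP scalerDr addrACA.
- by move=> V W h f hP fP a x y; rewrite fP hP.
- by move=> V f b fP a x y; rewrite lact_linear fP.
- by move=> V f b fP a x y; rewrite lbact_linear fP.
- by move=> V f b fP a x y; rewrite ract_linear fP.
- by move=> V f b fP a x y; rewrite rbact_linear fP.
- by move=> V f X fP a x y; rewrite lact_linearB fP.
- by move=> V f X fP a x y; rewrite lbact_linearB fP.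
- by move=> V f X fP a x y; rewrite ract_linearB fP.
- by move=> V f X fP a x y; rewrite rbact_linearB fP.
- by move=> V K b X KP; apply: (sum_ldec_map (f := lact b) (g := id)) (cop_lact b (cop_listP X)).
- by move=> V K b X KP; apply: (sum_ldec_map (f := id) (g := lbact b)) (cop_lbact b (cop_listP X)).
- by move=> V K b X KP; apply: (sum_ldec_map (f := (@ract _ _ L)^~ b) (g := id)) (cop_ract b (cop_listP X)).
- by move=> V K b X KP; apply: (sum_ldec_map (f := id) (g := (@rbact _ _ L)^~ b)) (cop_rbact b (cop_listP X)).
- by move=> V K b X; apply: ldec_takeuchi.
- by move=> V K; apply: ldec_linear.
- by move=> V K X; apply: ldec_coassoc.
- by move=> a x y; rewrite linearP.
- exact: counit_lact.
- exact: counit_lbact.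
- exact: counit_right.
- move=> V f X fP; rewrite (sum_ldec (fun x y => f (lact (counit L x) y))).
  by rewrite -(linear_big _ _ fP) (counitl (cop_listP X)).
- move=> V f X fP; rewrite (sum_ldec (fun x y => f (lbact (counit L y) x))).
  by rewrite -(linear_big _ _ fP) (counitr (cop_listP X)).
Defined.

End Carrier.

(** * The twisted product as a morphism of coalgebroids *)

Section TwistMor.
Variables (k : fieldType) (B : algType k) (L : coalgebroid B).
Hypothesis cop_ract : forall b (X : L) l, cop L X = \sum_(x <- l) dpure x ->
  cop L (ract X b) = \sum_(x <- l) dpure [tuple ract x`_0 b; x`_1].
Hypothesis cop_rbact : forall b (X : L) l, cop L X = \sum_(x <- l) dpure x ->
  cop L (rbact X b) = \sum_(x <- l) dpure [tuple x`_0; rbact x`_1 b].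
Hypothesis counit_right : forall b (X : L), counit L (ract X b) = counit L (rbact X b).

Local Notation RL := (carrier cop_ract cop_rbact counit_right).
Local Notation BL := (bimodule_bemod L).

Definition hom_id : behom RL BL.
Proof. by apply: (@BeHom _ _ RL BL (fun x => x)). Defined.

Variable S : rcoalg B.
Implicit Types (f g : cochain S) (F : behom S BL).

Definition right_compat F :=
  (forall x b, F (tr x b) = ract (F x) b) /\ (forall x b, F (trb x b) = rbact (F x) b).

(** The right action of b starts on the leg of f and crosses to the leg of F as in [cmul_proof];
    that of \bar b is on the leg of F from the start. *)
Lemma lconv_right f F : right_compat F -> right_compat (lconv f F).
Proof.
move=> [F1 F2]; split=> x b /=.
  rewrite (dec_tr _ _ (lconv_kernel f F)) /=.
  under eq_bigr do rewrite cochain_tr.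
  rewrite (dec_takeuchi _ _ (lconv_kernel f F)).
  rewrite (linear_big _ _ (@ract_linear _ _ L b)).
  by apply: eq_bigr => p _; rewrite F1 /= lact_ract.
rewrite (dec_trb _ _ (lconv_kernel f F)) (linear_big _ _ (@rbact_linear _ _ L b)).
by apply: eq_bigr => p _; rewrite F2 /= lact_rbact.
Qed.

Lemma rconv_right F f : right_compat F -> right_compat (rconv F f).
Proof.
move=> [F1 F2]; split=> x b /=.
  rewrite (dec_tr _ _ (rconv_kernel F f)) (linear_big _ _ (@ract_linear _ _ L b)).
  by apply: eq_bigr => p _; rewrite F1 /= lbact_ract.
rewrite (dec_trb _ _ (rconv_kernel F f)) /=.
under eq_bigr do rewrite -cochain_tr.
rewrite -(dec_takeuchi _ _ (rconv_kernel F f)).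
rewrite (linear_big _ _ (@rbact_linear _ _ L b)).
by apply: eq_bigr => p _; rewrite F2 /= lbact_rbact.
Qed.

(* Delta(F(x)) = F1(x_(1)) (x) F2(x_(2)) *)
Definition comult_split F F1 F2 :=
  forall (V : lmodType k) (K : RL -> RL -> V) x, ker2 K ->
    \sum_(p <- dec (F x : RL)) K p.1 p.2 = \sum_(p <- dec x) K (F1 p.1) (F2 p.2).

(** A left action by b lands on the first leg of Delta, and coassociativity regroups f with that
    leg. *)
Lemma split_lconv f F F1 F2 :
  comult_split F F1 F2 -> comult_split (lconv f F) (lconv f F1) F2.
Proof.
move=> FP V K x KP; have [K1 K2 K3] := KP.
rewrite /= (linear_big _ _ (dec_adm KP)).
transitivity (\sum_(p <- dec x) \sum_(q <- dec p.2) K (lact (f p.1) (F1 q.1)) (F2 q.2)).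
  apply: eq_bigr => p _; rewrite (dec_tl (r := RL) (f p.1) (F p.2) KP).
  rewrite (FP _ (fun y z => K (lact (f p.1) y) z)) //; split=> [z|y|b y z].
  - exact: (@adm_tl _ _ RL _ _ _ (K1 z)).
  - exact: K2.
  - by rewrite lact_lbact; apply: K3.
rewrite -(dec_coassoc (K := fun u y z => K (lact (f u) (F1 y)) (F2 z))); last first.
  split=> [y z|u z|u y|b u y z|b u y z].
  - apply: (adm_comp (h := fun b => K (lact b (F1 y)) (F2 z))) (hom_adm f).
    exact: (@tl_linear _ _ RL _ _ (F1 y) (K1 (F2 z))).
  - apply: (adm_comp (h := fun w => K (lact (f u) w) (F2 z))) (hom_adm F1).
    exact: (@adm_tl _ _ RL _ _ _ (K1 _)).
  - exact: (adm_comp (K2 _) (hom_adm F2)).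
  - by rewrite hom_tlbB hom_tl lactM.
  - by rewrite hom_tlb hom_tl /= lact_lbact; apply: K3.
apply: eq_bigr => p _ /=.
by rewrite (linear_big _ _ (K1 (F2 p.2))).
Qed.

Lemma split_rconv F F1 F2 g :
  comult_split F F1 F2 -> comult_split (rconv F g) F1 (rconv F2 g).
Proof.
move=> FP V K x KP; have [K1 K2 K3] := KP.
rewrite /= (linear_big _ _ (dec_adm KP)).
transitivity (\sum_(p <- dec x) \sum_(q <- dec p.1) K (F1 q.1) (lbact (g p.2) (F2 q.2))).
  apply: eq_bigr => p _; rewrite (dec_tlb (r := RL) (g p.2) (F p.1) KP).
  rewrite (FP _ (fun y z => K y (lbact (g p.2) z))) //; split=> [z|y|b y z].
  - exact: K1.
  - exact: (@adm_tlb _ _ RL _ _ _ (K2 y)).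
  - by rewrite /= -lact_lbact; apply: K3.
rewrite (dec_coassoc (K := fun u y z => K (F1 u) (lbact (g z) (F2 y)))); last first.
  split=> [y z|u z|u y|b u y z|b u y z].
  - exact: (adm_comp (K1 _) (hom_adm F1)).
  - apply: (adm_comp (h := fun w => K (F1 u) (lbact (g z) w))) (hom_adm F2).
    exact: (@adm_tlb _ _ RL _ _ _ (K2 _)).
  - apply: (adm_comp (h := fun b => K (F1 u) (lbact b (F2 y)))) (hom_adm g).
    exact: (@tlb_linear _ _ RL _ _ (F2 y) (K2 _)).
  - by rewrite hom_tlb hom_tl /= -lact_lbact; apply: K3.
  - by rewrite hom_tlB hom_tlb lbactM.
apply: eq_bigr => p _ /=.
by rewrite (linear_big _ _ (K2 (F1 p.1))).
Qed.

(** This is \bar b x (x) y = x (x) b y in L <> L, with b the value of g on the middle leg. *)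
Lemma split_middle (V : lmodType k) (K : RL -> RL -> V) F1 F2 g x : ker2 K ->
  \sum_(p <- dec x) K (rconv F1 g p.1) (F2 p.2) =
  \sum_(p <- dec x) K (F1 p.1) (lconv g F2 p.2).
Proof.
move=> [K1 K2 K3] /=.
under eq_bigr do rewrite (linear_big _ _ (K1 _)).
under [RHS]eq_bigr do rewrite (linear_big _ _ (K2 _)).
rewrite (dec_coassoc (K := fun u y z => K (lbact (g y) (F1 u)) (F2 z))).
  by apply: eq_bigr => p _; apply: eq_bigr => q _; apply: K3.
split=> [y z|u z|u y|b u y z|b u y z].
- apply: (adm_comp (h := fun w => K (lbact (g y) w) (F2 z))) (hom_adm F1).
  exact: (@adm_tlb _ _ RL _ _ _ (K1 _)).
- apply: (adm_comp (h := fun b => K (lbact b (F1 u)) (F2 z))) (hom_adm g).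
  exact: (@tlb_linear _ _ RL _ _ (F1 u) (K1 _)).
- exact: (adm_comp (K2 _) (hom_adm F2)).
- by rewrite hom_tlb hom_tlB /= lbactM.
- by rewrite hom_tlbB hom_tl /= lbactM; apply: K3.
Qed.

Lemma counit_lconv f F x : counit L (lconv f F x) = \sum_(p <- dec x) f p.1 * counit L (F p.2).
Proof. by rewrite /= raddf_sum; apply: eq_bigr => p _; rewrite /= counit_lact. Qed.

Lemma counit_rconv f F x : counit L (rconv F f x) = \sum_(p <- dec x) counit L (F p.1) * f p.2.
Proof. by rewrite /= raddf_sum; apply: eq_bigr => p _; rewrite /= counit_lbact. Qed.

Variables (phi : mor S RL) (f g : cochain S).
Hypotheses (fg : cmul f g = cone S) (gf : cmul g f = cone S).

Let Phi := hpull phi hom_id.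

Definition twist_hom : behom S BL := lconv f (rconv Phi g).

Lemma phi_right : right_compat Phi.
Proof.
have idP : adm (fun x : RL => x) by [].
by split=> x b; [exact: (mor_tr phi b x idP)|exact: (mor_trb phi b x idP)].
Qed.

Lemma phi_split : comult_split Phi Phi Phi.
Proof. by move=> V K x KP; apply: (mor_dec phi x KP). Qed.

(** [phi_split] yields the legs f Phi and Phi g. In the claim, the first leg f Phi g hands its g to
    the second by [split_middle], where g f = 1 cancels. *)
Lemma twist_split : comult_split twist_hom twist_hom twist_hom.
Proof.
move=> V K x KP; rewrite (split_lconv f (split_rconv g phi_split)) //.
rewrite {1}/twist_hom -lrconvA split_middle //; apply: eq_bigr => p _.
have gf' : lconv g f = hom_eps S := congr1 (@cochain_hom _ _ S) gf.
by rewrite /twist_hom -lconvA gf' lconv1.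
Qed.

Lemma twist_right : right_compat twist_hom.
Proof. by apply: lconv_right; apply: rconv_right; apply: phi_right. Qed.

Definition mor_twist : mor S RL.
Proof.
apply: (@Mor _ _ S RL twist_hom).
- by move=> V h hP; apply: (adm_comp hP (hom_adm twist_hom)).
- by move=> V h b x hP; rewrite hom_tl.
- by move=> V h b x hP; rewrite hom_tlb.
- by move=> V h b x hP; rewrite (proj1 twist_right).
- by move=> V h b x hP; rewrite (proj2 twist_right).
- by move=> V K x KP; apply: twist_split.
(* The counit of the twisted map is the convolution of f, eps and g, which is the unit by [fg]. *)
- move=> x; rewrite [LHS]counit_lconv -[RHS]/(cone S x) -fg cmulE.
  apply: eq_bigr => p _; rewrite counit_rconv; congr (_ * _).
  rewrite -[in RHS](cmul1l g) cmulE; apply: eq_bigr => q _.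
  by congr (_ * _); apply: (mor_eps phi q.1).
Defined.

Lemma mor_twistP : twist_of mor_twist phi f g.
Proof.
move=> V G GP x /=.
have -> : \sum_(p <- dec x) lact (f p.1) (\sum_(q <- dec p.2) lbact (g q.2) (phi q.1)) =
          lcv f (rconv Phi g) x by rewrite lcv_lconv.
rewrite (linear_big _ _ GP); apply: eq_bigr => p _.
have -> : rconv Phi g (tl (f p.1) p.2) = rcv Phi g (tl (f p.1) p.2) by rewrite rcv_rconv.
by rewrite (linear_big _ _ GP).
Qed.

End TwistMor.

(** * Sweedler lists *)

Section Sweedler.
Variables (k : fieldType) (B : algType k) (L : coalgebroid B).

Lemma sum_iter_copS (D : L -> seq (2.-tuple L)) n (X : L) (V : nmodType)
    (F : n.+2.-tuple L -> V) :
  \sum_(x <- iter_cop D n.+1 X) F x =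
  \sum_(x <- D X) \sum_(y <- iter_cop D n x`_1) F (cons_tuple x`_0 y).
Proof. by rewrite /= big_allpairs_dep. Qed.

Lemma sum_iter_cop0 (D : L -> seq (2.-tuple L)) (X : L) (V : nmodType)
    (F : 1.-tuple L -> V) : \sum_(x <- iter_cop D 0 X) F x = F [tuple X].
Proof. by rewrite /= big_seq1. Qed.

Lemma pair_tuple_eta (x : 2.-tuple L) : cons_tuple x`_0 [tuple x`_1] = x.
Proof.
by case/tupleP: x => a x; case/tupleP: x => b x; rewrite (tuple0 x); apply: val_inj.
Qed.

Lemma sum_iter_cop1 (D : L -> seq (2.-tuple L)) (X : L) (V : nmodType)
    (F : 2.-tuple L -> V) : \sum_(x <- iter_cop D 1 X) F x = \sum_(x <- D X) F x.
Proof.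
rewrite sum_iter_copS; apply: eq_bigr => x _.
by rewrite sum_iter_cop0 pair_tuple_eta.
Qed.

Lemma sweedler2P (X : L) (l : seq (2.-tuple L)) :
  sweedler X l <-> cop L X = \sum_(x <- l) dpure x.
Proof.
split=> [[D DP hl]|hl]; first by rewrite hl sum_iter_cop1.
exists (@cop_list _ _ L); first exact: cop_listP.
by rewrite sum_iter_cop1 -hl -cop_listP.
Qed.

Lemma sweedler_cop_list (X : L) : sweedler X (cop_list X).
Proof. exact/sweedler2P/cop_listP. Qed.

End Sweedler.

(** * Consequences of the axioms of a coquasi-bialgebroid *)

Section Structure.
Variables (k : fieldType) (B : algType k) (L : coalgebroid B).
Variables (mul : L -> L -> L) (one : L) (s t : B -> L) (Phi : L -> L -> L -> B).
Hypothesis Q : coquasi_bialgebroid mul one s t Phi.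

Lemma source_lact b : s b = lact b one.
Proof. by rewrite (lactE Q) (mul_1r Q). Qed.

Lemma target_lbact b : t b = lbact b one.
Proof. by rewrite (lbactE Q) (mul_1r Q). Qed.

Lemma lact_one b : lact b one = ract one b.
Proof. by rewrite -source_lact (ractE Q) (mul_1l Q). Qed.

Lemma lbact_one b : lbact b one = rbact one b.
Proof. by rewrite -target_lbact (rbactE Q) (mul_1l Q). Qed.

Lemma cop_one : cop L one = \sum_(x <- [:: [tuple one; one]]) dpure x.
Proof. by rewrite big_seq1 (cop1 Q). Qed.

Lemma cop_mul (X Y : L) x y : cop L X = \sum_(p <- x) dpure p -> cop L Y = \sum_(p <- y) dpure p ->
  cop L (mul X Y) = \sum_(p <- x) \sum_(q <- y) dpure [tuple mul p`_0 q`_0; mul p`_1 q`_1].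
Proof. by move=> hx hy; apply: (copM Q); apply/sweedler2P. Qed.

(** X b is the product X s(b), and Delta(s(b)) = b 1 (x) 1 by left linearity at the unit, so
    multiplicativity of Delta applies. *)
Lemma coquasi_cop_ract b (X : L) l : cop L X = \sum_(x <- l) dpure x ->
  cop L (ract X b) = \sum_(x <- l) dpure [tuple ract x`_0 b; x`_1].
Proof.
move=> hl; have hb := cop_lact b cop_one; rewrite big_seq1 /= in hb.
have hb' : cop L (lact b one) = \sum_(x <- [:: [tuple lact b one; one]]) dpure x.
  by rewrite big_seq1.
rewrite (ractE Q) source_lact (cop_mul hl hb'); apply: eq_bigr => p _.
by rewrite big_seq1 /= -source_lact -(ractE Q) (mul_1r Q).
Qed.

Lemma coquasi_cop_rbact b (X : L) l : cop L X = \sum_(x <- l) dpure x ->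
  cop L (rbact X b) = \sum_(x <- l) dpure [tuple x`_0; rbact x`_1 b].
Proof.
move=> hl; have hb := cop_lbact b cop_one; rewrite big_seq1 /= in hb.
have hb' : cop L (lbact b one) = \sum_(x <- [:: [tuple one; lbact b one]]) dpure x.
  by rewrite big_seq1.
rewrite (rbactE Q) target_lbact (cop_mul hl hb'); apply: eq_bigr => p _.
by rewrite big_seq1 /= -target_lbact -(rbactE Q) (mul_1r Q).
Qed.

Lemma coquasi_counit_right b (X : L) : counit L (ract X b) = counit L (rbact X b).
Proof.
(* Since b = eps(s(b)), axiom (ii) with Y = s(b) reaches an arbitrary b. *)
have e : counit L (s b) = b by rewrite source_lact counit_lact (counit1 Q) mulr1.
by rewrite -{1}e (counit_ract Q) -(counit_rbact Q) e.
Qed.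

(** Part of the invertibility of Phi: the convolution unit in three arguments is eps of either
    bracketing. *)
Lemma counit_mulA (X Y Z : L) :
  counit L (mul (mul X Y) Z) = counit L (mul X (mul Y Z)).
Proof.
have [Psi _ inv] := cocycle_invertible (cocycle Q).
by case: (inv X Y Z _ _ _ (sweedler_cop_list X) (sweedler_cop_list Y) (sweedler_cop_list Z)).
Qed.

Lemma mul_counitl (X Y : L) x y :
  cop L X = \sum_(p <- x) dpure p -> cop L Y = \sum_(p <- y) dpure p ->
  mul X Y = \sum_(p <- x) \sum_(q <- y) lact (counit L (mul p`_0 q`_0)) (mul p`_1 q`_1).
Proof.
move=> hx hy; have h := cop_mul hx hy.
pose l := [seq [tuple mul p`_0 q`_0; mul p`_1 q`_1] | p : 2.-tuple L <- x, q : 2.-tuple L <- y].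
rewrite -[LHS](counitl (l := l)); first by rewrite big_allpairs_dep.
by rewrite h big_allpairs_dep.
Qed.

Lemma mul_counitr (X Y : L) x y :
  cop L X = \sum_(p <- x) dpure p -> cop L Y = \sum_(p <- y) dpure p ->
  mul X Y = \sum_(p <- x) \sum_(q <- y) lbact (counit L (mul p`_1 q`_1)) (mul p`_0 q`_0).
Proof.
move=> hx hy; have h := cop_mul hx hy.
pose l := [seq [tuple mul p`_0 q`_0; mul p`_1 q`_1] | p : 2.-tuple L <- x, q : 2.-tuple L <- y].
rewrite -[LHS](counitr (l := l)); first by rewrite big_allpairs_dep.
by rewrite h big_allpairs_dep.
Qed.

Definition apply_tuple2 (f g : L -> L) (x : 2.-tuple L) : 2.-tuple L := [tuple f x`_0; g x`_1].

Lemma cop_map (Y : L) (l : seq (2.-tuple L)) f g : cop L Y = \sum_(x <- l) dpure [tuple f x`_0; g x`_1] ->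
  cop L Y = \sum_(x <- map (apply_tuple2 f g) l) dpure x.
Proof. by rewrite big_map. Qed.

(* By [mul_counitl] and [mul_counitr] a product is determined by the values of the
   counit on products, where [counit_mulA] gives associativity. *)
Lemma mul_lact b (X Y : L) : mul (lact b X) Y = lact b (mul X Y).
Proof.
rewrite (mul_counitl (cop_listP X) (cop_listP Y)) (linear_big _ _ (@lact_linear _ _ L b)).
rewrite (mul_counitl (cop_map (f := lact b) (g := id) (cop_lact b (cop_listP X))) (cop_listP Y)).
rewrite big_map; apply: eq_bigr => p _; rewrite (linear_big _ _ (@lact_linear _ _ L b)).
apply: eq_bigr => q _ /=.
by rewrite -lactM (lactE Q b p`_0) counit_mulA -(lactE Q) counit_lact.
Qed.

Lemma mul_lbact b (X Y : L) : mul (lbact b X) Y = lbact b (mul X Y).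
Proof.
rewrite (mul_counitr (cop_listP X) (cop_listP Y)) (linear_big _ _ (@lbact_linear _ _ L b)).
rewrite (mul_counitr (cop_map (f := id) (g := lbact b) (cop_lbact b (cop_listP X))) (cop_listP Y)).
rewrite big_map; apply: eq_bigr => p _; rewrite (linear_big _ _ (@lbact_linear _ _ L b)).
apply: eq_bigr => q _ /=.
by rewrite -lbactM (lbactE Q b p`_1) counit_mulA -(lbactE Q) counit_lbact.
Qed.

Lemma mul_ract_lact b (X Y : L) : mul (ract X b) Y = mul X (lact b Y).
Proof.
rewrite (mul_counitl (cop_map (f := (@ract _ _ L)^~ b) (g := id)
  (coquasi_cop_ract b (cop_listP X))) (cop_listP Y)).
rewrite (mul_counitl (cop_listP X)
  (cop_map (f := lact b) (g := id) (cop_lact b (cop_listP Y)))).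
rewrite big_map; apply: eq_bigr => p _; rewrite big_map; apply: eq_bigr => q _ /=.
by rewrite (ractE Q) counit_mulA -(lactE Q).
Qed.

Lemma mul_rbact_lbact b (X Y : L) : mul (rbact X b) Y = mul X (lbact b Y).
Proof.
rewrite (mul_counitr (cop_map (f := id) (g := (@rbact _ _ L)^~ b)
  (coquasi_cop_rbact b (cop_listP X))) (cop_listP Y)).
rewrite (mul_counitr (cop_listP X)
  (cop_map (f := id) (g := lbact b) (cop_lbact b (cop_listP Y)))).
rewrite big_map; apply: eq_bigr => p _; rewrite big_map; apply: eq_bigr => q _ /=.
by rewrite (rbactE Q) counit_mulA -(lbactE Q).
Qed.

Lemma mul_ract b (X Y : L) : mul X (ract Y b) = ract (mul X Y) b.
Proof.
rewrite (mul_counitl (cop_listP X) (cop_map (f := (@ract _ _ L)^~ b) (g := id)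
  (coquasi_cop_ract b (cop_listP Y)))).
pose l := [seq [tuple mul p`_0 q`_0; mul p`_1 q`_1] |
  p : 2.-tuple L <- cop_list X, q : 2.-tuple L <- cop_list Y].
have hl : cop L (mul X Y) = \sum_(p <- l) dpure p.
  by rewrite (cop_mul (cop_listP X) (cop_listP Y)) big_allpairs_dep.
rewrite -[RHS](counitl (cop_map (f := (@ract _ _ L)^~ b) (g := id)
  (coquasi_cop_ract b hl))).
rewrite big_map big_allpairs_dep; apply: eq_bigr => p _.
rewrite big_map; apply: eq_bigr => q _ /=.
by rewrite !(ractE Q) counit_mulA.
Qed.

Lemma mul_rbact b (X Y : L) : mul X (rbact Y b) = rbact (mul X Y) b.
Proof.
rewrite (mul_counitr (cop_listP X) (cop_map (f := id) (g := (@rbact _ _ L)^~ b)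
  (coquasi_cop_rbact b (cop_listP Y)))).
pose l := [seq [tuple mul p`_0 q`_0; mul p`_1 q`_1] |
  p : 2.-tuple L <- cop_list X, q : 2.-tuple L <- cop_list Y].
have hl : cop L (mul X Y) = \sum_(p <- l) dpure p.
  by rewrite (cop_mul (cop_listP X) (cop_listP Y)) big_allpairs_dep.
rewrite -[RHS](counitr (cop_map (f := id) (g := (@rbact _ _ L)^~ b)
  (coquasi_cop_rbact b hl))).
rewrite big_map big_allpairs_dep; apply: eq_bigr => p _.
rewrite big_map; apply: eq_bigr => q _ /=.
by rewrite !(rbactE Q) counit_mulA.
Qed.

Local Notation RL := (carrier coquasi_cop_ract coquasi_cop_rbact coquasi_counit_right).
Local Notation BB := (regular_bemod B).

Definition mor_mul : mor (RL ** RL) RL.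
Proof.
apply: (@Mor _ _ (RL ** RL) RL (fun x => mul x.1 x.2)).
- move=> V f fP; split=> [Y|X|X Y b|X Y b] /=.
  + by move=> a x y; rewrite (mul_linearl Q) fP.
  + by move=> a x y; rewrite (mul_linearr Q) fP.
  + by rewrite mul_ract_lact.
  + by rewrite mul_rbact_lbact.
- by move=> V f b [X Y] fP; rewrite /= mul_lact.
- by move=> V f b [X Y] fP; rewrite /= mul_lbact.
- by move=> V f b [X Y] fP; rewrite /= mul_ract.
- by move=> V f b [X Y] fP; rewrite /= mul_rbact.
- move=> V K [X Y] KP.
  pose l := [seq [tuple mul p`_0 q`_0; mul p`_1 q`_1] |
    p : 2.-tuple L <- cop_list X, q : 2.-tuple L <- cop_list Y].
  have hl : cop L (mul X Y) = \sum_(p <- l) dpure p.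
    by rewrite (cop_mul (cop_listP X) (cop_listP Y)) big_allpairs_dep.
  rewrite /= -(sum_ldec_cop KP hl) big_allpairs_dep.
  rewrite (sum_pdec (S := RL) (T := RL) (fun x y => K (mul x.1 x.2) (mul y.1 y.2))) /=.
  by rewrite big_map; apply: eq_bigr => p _; rewrite big_map.
- by move=> [X Y]; rewrite /= (counit_ract Q).
Defined.

Section Units.
Variable T : rcoalg B.

Definition mor_unitl : mor T (RL ** T).
Proof.
apply: (@Mor _ _ T (RL ** T) (fun x => (one, x))).
- by move=> V f [f1 f2 f3 f4]; apply: f2.
- by move=> V f b x [f1 f2 f3 f4]; rewrite -[LHS]f3 -[tr _ b]/(ract one b) -lact_one.
- by move=> V f b x [f1 f2 f3 f4]; rewrite -[LHS]f4 -[trb _ b]/(rbact one b) -lbact_one.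
- by [].
- by [].
- move=> V K x KP; rewrite sum_dec_prod; apply: eq_bigr => q _.
  by rewrite -(sum_ldec_cop (kernel2_fst KP _ _) cop_one) big_seq1.
- by move=> x; rewrite -[LHS]/(counit L (ract one (eps x))) -lact_one counit_lact (counit1 Q) mulr1.
Defined.

End Units.

Definition mor_unitr : mor RL (RL ** RL).
Proof.
apply: (@Mor _ _ RL (RL ** RL) (fun x => (x, one))).
- by move=> V f [f1 f2 f3 f4]; apply: f1.
- by [].
- by [].
- by move=> V f b x [f1 f2 f3 f4]; rewrite -[RHS]/(f (x, ract one b)) -lact_one [LHS]f3.
- by move=> V f b x [f1 f2 f3 f4]; rewrite -[RHS]/(f (x, rbact one b)) -lbact_one [LHS]f4.
- move=> V K x KP; rewrite sum_dec_prod.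
  by rewrite -(sum_ldec_cop (kernel2_snd KP x) cop_one) big_seq1.
- by move=> x; rewrite -[LHS]/(counit L (ract x (counit L one))) (counit1 Q) ract1.
Defined.

Lemma hom2_behom (f : L -> L -> B) : hom2 f ->
  {F : behom (RL ** RL) BB | forall X Y, f X Y = F (X, Y)}.
Proof.
move=> fP; pose F (x : RL ** RL) : BB := f x.1 x.2.
suff FP : exists F : behom (RL ** RL) BB, forall X Y, f X Y = F (X, Y) by exact: cid.
case: fP => g [gE g1 g2].
unshelve eexists; first apply: (@BeHom _ _ (RL ** RL) BB (fun x => f x.1 x.2)) => //=.
- split=> [Y a x y|X a x y|X Y b|X Y b] /=; rewrite !gE.
  + by rewrite -linearP; congr (g _); apply: (@pure_linear _ _ _ _ _ _ [::] [:: Y]).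
  + by rewrite -linearP; congr (g _); apply: (@pure_linear _ _ _ _ _ _ [:: X] [::]).
  + by congr (g _); apply: (@pure_balanced _ _ _ _ _ _ [::] [::] (inl b)).
  + by congr (g _); apply: (@pure_balanced _ _ _ _ _ _ [::] [::] (inr b)).
by [].
Qed.

Lemma hom3_behom (f : L -> L -> L -> B) : hom3 f ->
  {F : behom (RL ** (RL ** RL)) BB | forall X Y Z, f X Y Z = F (X, (Y, Z))}.
Proof.
move=> fP; apply: cid; case: fP => g [gE g1 g2].
unshelve eexists; first apply: (@BeHom _ _ (RL ** (RL ** RL)) BB (fun x => f x.1 x.2.1 x.2.2)) => //=.
- split=> [[Y Z] a x y|X|X [Y Z] b|X [Y Z] b] /=; rewrite ?gE.
  + by rewrite -linearP; congr (g _); apply: (@pure_linear _ _ _ _ _ _ [::] [:: Y; Z]).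
  + split=> [Z a x y|Y a x y|Y Z b|Y Z b] /=; rewrite !gE.
    * by rewrite -linearP; congr (g _); apply: (@pure_linear _ _ _ _ _ _ [:: X] [:: Z]).
    * by rewrite -linearP; congr (g _); apply: (@pure_linear _ _ _ _ _ _ [:: X; Y] [::]).
    * by congr (g _); apply: (@pure_balanced _ _ _ _ _ _ [:: X] [::] (inl b)).
    * by congr (g _); apply: (@pure_balanced _ _ _ _ _ _ [:: X] [::] (inr b)).
  + by congr (g _); apply: (@pure_balanced _ _ _ _ _ _ [::] [:: Z] (inl b)).
  + by congr (g _); apply: (@pure_balanced _ _ _ _ _ _ [::] [:: Z] (inr b)).
by [].
Qed.

(** Descent to the quotient, through which the twisted cocycle and its inverse satisfy [hom3]. *)
Lemma behom_hom3 (F : behom (RL ** (RL ** RL)) BB) : hom3 (fun X Y Z => F (X, (Y, Z))).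
Proof.
have [F1 F2 F3 F4] := hom_adm F.
have [g gE] : exists g : {linear tensorBe L 3 -> B},
    forall w, g (bpure w) = F (w`_0, (w`_1, w`_2)).
  apply: (tensor_lift (F := fun w : 3.-tuple L => F (w`_0, (w`_1, w`_2)))).
    move=> u v a x y p q r hp hq hr; move: (size_tuple p); rewrite hp hq hr.
    case: u {hp hq hr} => [|u0 [|u1 [|u2 u]]] /=; last by case: u.
    - by rewrite (F1 (v`_0, v`_1)).
    - by have [G1 _ _ _] := F2 u0; rewrite (G1 v`_0).
    - by have [_ G2 _ _] := F2 u0; rewrite (G2 u1).
  move=> u v c x y p q hp hq; move: (size_tuple p); rewrite hp hq.
  case: u {hp hq} => [|u0 [|u1 [|u2 u]]] /=; last by case: u.
  - by case: c => c _; [exact: (F3 x (y, v`_0) c)|exact: (F4 x (y, v`_0) c)].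
  - have [_ _ G3 G4] := F2 u0.
    by case: c => c _; [exact: (G3 x y c)|exact: (G4 x y c)].
  - by [].
exists g; split=> [X Y Z|b X Y Z|b X Y Z].
- by rewrite gE.
- exact: (hom_tlB F b (X, (Y, Z))).
- exact: (hom_tlbB F b (X, (Y, Z))).
Qed.

End Structure.

(** * The twisted cocycle *)

Section Pentagon.
Variables (k : fieldType) (B : algType k) (R : rcoalg B).
Implicit Types (S T U : rcoalg B) (M : bemod B).
Local Notation BB := (regular_bemod B).
Local Notation "f \* g" := (cmul f g) (at level 40, left associativity).

Local Notation R2 := (R ** R).
Local Notation R3 := (R ** (R ** R)).
Local Notation R4 := (R ** (R ** (R ** R))).

Definition mul12 (m : mor R2 R) T : mor (R ** (R ** T)) (R ** T) :=
  mor_comp (mor_prod m (mor_id T)) (mor_assoc R R T).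

Definition id_mul (m : mor R2 R) S : mor (S ** R2) (S ** R) := mor_prod (mor_id S) m.

Definition id_mul12 (m : mor R2 R) S T : mor (S ** (R ** (R ** T))) (S ** (R ** T)) :=
  mor_prod (mor_id S) (mul12 m T).

(* (X, Y, Z) |-> f(X, Y eps(Z)) *)
Definition cfront T (f : cochain R2) : cochain (R ** (R ** T)) :=
  cpull (mor_assoc R R T) (clast T f).

Definition assoc3 : mor R4 (R3 ** R) :=
  mor_comp (mor_assoc R R2 R) (mor_prod (mor_id R) (mor_assoc R R R)).

Definition cfront3 (f : cochain R3) : cochain R4 := cpull assoc3 (clast R f).

Lemma cfrontE T (f : cochain R2) x y z : cfront T f (x, (y, z)) = f (x, tr y (eps z)).
Proof. by []. Qed.

Lemma cfrontM T (f g : cochain R2) : cfront T (f \* g) = cfront T f \* cfront T g.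
Proof. by rewrite /cfront clastM cpullM. Qed.

Lemma cfront1 T : cfront T (cone R2) = cone _.
Proof. by rewrite /cfront clast1 cpull1. Qed.

Lemma cfront3M f g : cfront3 (f \* g) = cfront3 f \* cfront3 g.
Proof. by rewrite /cfront3 clastM cpullM. Qed.

Lemma cfront3_1 : cfront3 (cone R3) = cone _.
Proof. by rewrite /cfront3 clast1 cpull1. Qed.

(** Axiom (3), with the inner value Phi(Y_1, Z_1, W_1) taken out of its argument as the coface
    [cfirst]. That this agrees with the nested sum is [sum_pentagon]. *)
Definition pentagon (m : mor R2 R) (f : cochain R3) :=
  cpull (mor_prod (mor_id R) (id_mul m R)) f \* cpull (mul12 m R2) f =
  cfirst R f \* cpull (id_mul12 m R R) f \* cfront3 f.

Definition mulL (m : mor R2 R) : mor R3 R := mor_comp m (mul12 m R).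
Definition mulR (m : mor R2 R) : mor R3 R := mor_comp m (id_mul m R).

(** Axiom (4), tested on admissible maps. *)
Definition reassociates (m : mor R2 R) (f : cochain R3) :=
  forall (V : lmodType k) (G : R -> V), adm G ->
    lcv f (G \o mulL m) =1 rcv (G \o mulR m) f.

(** The values of Phi act on u from the right; balance turns this into a left action on the
    bracketed product, where axiom (4) applies to h(u, -). *)
Lemma reassociates_first U m f (h : cochain (U ** R)) : reassociates m f ->
  cfirst U f \* cpull (mor_prod (mor_id U) (mulL m)) h =
  cpull (mor_prod (mor_id U) (mulR m)) h \* cfirst U f.
Proof.
move=> mf; apply: cochain_ext => -[u t]; have [_ h2 h3 h4] := hom_adm h.
rewrite cmul_lcv cmul_rcv lcv_first; last exact: (hom_adm (cpull _ h)).
rewrite rcv_first; last exact: (hom_adm (cpull _ h)).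
transitivity (lcv f (h \o pair u \o mulL m) t).
  apply: eq_bigr => q _; rewrite [LHS]h3 /=.
  exact: esym (mor_tl (mulL m) _ _ (h2 u)).
rewrite (mf _ _ (h2 u)); apply: eq_bigr => q _; rewrite [RHS]h4.
exact: (mor_tlb (mulR m) _ _ (h2 u)).
Qed.

Lemma reassociates_last U m f (h : cochain (R ** U)) : reassociates m f ->
  clast U f \* cpull (mor_prod (mulL m) (mor_id U)) h =
  cpull (mor_prod (mulR m) (mor_id U)) h \* clast U f.
Proof.
move=> mf; apply: cochain_ext => -[t u]; have [h1 _ _ _] := hom_adm h.
rewrite cmul_lcv cmul_rcv lcv_last; last exact: (hom_adm (cpull _ h)).
rewrite rcv_last; last exact: (hom_adm (cpull _ h)).
exact: (mf _ _ (h1 u)).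
Qed.

Variables (m m' : mor R2 R) (f g : cochain R2).
Hypotheses (fg : f \* g = cone R2) (gf : g \* f = cone R2).
Hypothesis mP : twist_of m' m f g.

Definition twist3 (Phi : cochain R3) : cochain R3 :=
  cfirst R f \* cpull (id_mul m R) f \* Phi \* cpull (mul12 m R) g \* cfront R g.

Definition twist3V (Psi : cochain R3) : cochain R3 :=
  cfront R f \* cpull (mul12 m R) f \* Psi \* cpull (id_mul m R) g \* cfirst R g.

Lemma cmul_cancel T (x y z : cochain T) : x \* y = cone T -> z \* x \* y = z.
Proof. by move=> xy; rewrite -cmulA xy cmul1r. Qed.

Lemma twist3_inverse Phi Psi : Phi \* Psi = cone R3 -> Psi \* Phi = cone R3 ->
  twist3 Phi \* twist3V Psi = cone R3 /\ twist3V Psi \* twist3 Phi = cone R3.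
Proof.
move=> PP PP'; rewrite /twist3 /twist3V !cmulA; split.
  rewrite [X in X \* _ \* _ \* _ \* _]cmul_cancel; last by rewrite -cfrontM gf cfront1.
  rewrite [X in X \* _ \* _ \* _]cmul_cancel; last by rewrite -cpullM gf cpull1.
  rewrite [X in X \* _ \* _]cmul_cancel // [X in X \* _]cmul_cancel; last by rewrite -cpullM fg cpull1.
  by rewrite -cfirstM fg cfirst1.
rewrite [X in X \* _ \* _ \* _ \* _]cmul_cancel; last by rewrite -cfirstM gf cfirst1.
rewrite [X in X \* _ \* _ \* _]cmul_cancel; last by rewrite -cpullM gf cpull1.
rewrite [X in X \* _ \* _]cmul_cancel // [X in X \* _]cmul_cancel; last by rewrite -cpullM fg cpull1.
by rewrite -cfrontM fg cfront1.
Qed.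

Section Coherence.
Variable h : cochain R2.

(** The first two arguments enter only through their counit, which m preserves. *)
Lemma cfirst_mul12 T (e : cochain T) :
  cpull (mul12 m T) (cfirst R e) = cfirst R (cfirst R e).
Proof.
apply: cochain_ext => -[x [y z]]; rewrite -[LHS]/(eps (tr (m (x, y)) (e z))).
by rewrite -(mor_tr m _ _ (eps_adm R)) mor_eps.
Qed.

Lemma cfront_id_mul :
  cpull (mor_prod (mor_id R) (id_mul m R)) (cfront R h) = cfront R2 h.
Proof.
apply: cochain_ext => -[x [y z]]; rewrite -[LHS]/(h (x, tr y (eps (m z)))).
by rewrite mor_eps.
Qed.

Lemma cfront_mul12 : cpull (id_mul12 m R R) (cfront R h) = cfront3 (cpull (id_mul m R) h).
Proof.
apply: cochain_ext => -[x [y [z w]]].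
have [_ h2 _ _] := hom_adm h.
rewrite -[LHS]/(h (x, tr (m (y, z)) (eps w))).
exact: esym (mor_tr m (eps w) (y, z) (h2 x)).
Qed.

Lemma cfront3_cfront : cfront3 (cfront R h) = cfront R2 h.
Proof. exact: cochain_ext. Qed.

Lemma cfront3_cfirst : cfront3 (cfirst R h) = cfirst R (cfront R h).
Proof. exact: cochain_ext. Qed.

(** With the four arguments regrouped in two pairs this is [cfirst_clastC]. *)
Lemma cfront_cfirst : cfront R2 h \* cfirst R (cfirst R f) = cfirst R (cfirst R f) \* cfront R2 h.
Proof.
have -> : cfirst R (cfirst R f) = cpull (mor_assoc R R R2) (cfirst R2 f).
  exact: cochain_ext.
by rewrite -!cpullM cfirst_clastC.
Qed.

Lemma cpull_id_mul_cfirst :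
  cpull (mor_prod (mor_id R) (id_mul m R)) (cfirst R h) = cfirst R (cpull (id_mul m R) h).
Proof. exact: cochain_ext. Qed.

Lemma cpull_id_mul12_cfirst :
  cpull (id_mul12 m R R) (cfirst R h) = cfirst R (cpull (mul12 m R) h).
Proof. exact: cochain_ext. Qed.

Lemma cpull_mul12_cfront :
  cpull (mul12 m R2) (cfront R h) = cfront3 (cpull (mul12 m R) h).
Proof. exact: cochain_ext. Qed.

Lemma cpull_mul_mul : cpull (mor_prod (mor_id R) (id_mul m R)) (cpull (mul12 m R) h) =
  cpull (mul12 m R2) (cpull (id_mul m R) h).
Proof. exact: cochain_ext. Qed.

End Coherence.

Lemma twist_id_id_mul (h : cochain R3) :
  cpull (mor_prod (mor_id R) (id_mul m' R)) h =
  cfirst R (cfirst R f) \* cpull (mor_prod (mor_id R) (id_mul m R)) h \* cfirst R (cfirst R g).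
Proof. exact: (twist_cpull (twist_id_prod (twist_id_prod mP))). Qed.

Lemma twist_mul12 T (h : cochain (R ** T)) :
  cpull (mul12 m' T) h = cfront T f \* cpull (mul12 m T) h \* cfront T g.
Proof. exact: (twist_cpull (twist_comp (mor_assoc R R T) (twist_prod_id (U := T) mP)) h). Qed.

Lemma twist_id_mul12 (h : cochain R3) :
  cpull (id_mul12 m' R R) h =
  cfirst R (cfront R f) \* cpull (id_mul12 m R R) h \* cfirst R (cfront R g).
Proof. exact: (twist_cpull (twist_id_prod (twist_comp (mor_assoc R R R) (twist_prod_id (U := R) mP))) h). Qed.

Theorem pentagon_twist Phi : reassociates m Phi -> pentagon m Phi ->
  pentagon m' (twist3 Phi).
Proof.
move=> mPhi pent; rewrite /pentagon twist_id_id_mul twist_mul12 twist_id_mul12.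
rewrite /twist3 !cpullM !cfirstM !cfront3M.
rewrite !cpull_id_mul_cfirst !cfront_id_mul !cfirst_mul12 !cpull_mul12_cfront.
rewrite !cpull_mul_mul !cpull_id_mul12_cfirst !cfront_mul12.
rewrite !cfront3_cfirst !cfront3_cfront.
(* Moving Phi(Y,Z,W) to the right of Sigma(X, -) turns (YZ)W into Y(ZW) inside Sigma. *)
have assoc1 : cfirst R Phi \* cpull (id_mul12 m R R) (cpull (id_mul m R) f) =
    cpull (mor_prod (mor_id R) (id_mul m R)) (cpull (id_mul m R) f) \* cfirst R Phi.
  have := reassociates_first f mPhi.
  rewrite (_ : cpull _ f = cpull (id_mul12 m R R) (cpull (id_mul m R) f)); last exact: cochain_ext.
  by move->; congr (_ \* _); apply: cochain_ext.
(* Likewise Phi(X,Y,Z) passes the inverse of Sigma at (-, W), with (XY)Z and X(YZ) exchanged. *)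
have assoc2 : cfront3 Phi \* cpull (mul12 m R2) (cpull (mul12 m R) g) =
    cpull (id_mul12 m R R) (cpull (mul12 m R) g) \* cfront3 Phi.
  have := congr1 (cpull assoc3) (reassociates_last g mPhi); rewrite !cpullM -/(cfront3 Phi) => e.
  transitivity (cfront3 Phi \* cpull assoc3 (cpull (mor_prod (mulL m) (mor_id R)) g)).
    by congr (_ \* _); apply: cochain_ext.
  by rewrite e; congr (_ \* _); apply: cochain_ext.
have com := cfront_cfirst f; move: pent; rewrite /pentagon.
have s1 : cfirst R (cfirst R g) \* cfirst R (cfirst R f) = cone R4.
  by rewrite -!cfirstM gf !cfirst1.
have s2 : cfront R2 g \* cfront R2 f = cone R4 by rewrite -cfrontM gf cfront1.
have s3 : cpull (mul12 m R2) (cpull (id_mul m R) g) \*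
          cpull (mul12 m R2) (cpull (id_mul m R) f) = cone R4.
  by rewrite -!cpullM gf !cpull1.
have s4 : cfirst R (cfront R g) \* cfirst R (cfront R f) = cone R4.
  by rewrite -cfirstM -cfrontM gf cfront1 cfirst1.
have s5 : cfirst R (cpull (mul12 m R) g) \* cfirst R (cpull (mul12 m R) f) = cone R4.
  by rewrite -cfirstM -cpullM gf cpull1 cfirst1.
have s6 : cfront3 (cpull (id_mul m R) g) \* cfront3 (cpull (id_mul m R) f) = cone R4.
  by rewrite -cfront3M -cpullM gf cpull1 cfront3_1.
move: assoc1 assoc2 com s1 s2 s3 s4 s5 s6; rewrite !cmulA.
(* The cofaces become letters: what remains is a word problem in the monoid of cochains on four
   arguments. *)
move: (cfirst R (cfirst R f)) (cfirst R (cfirst R g)) (cfront R2 f) (cfront R2 g).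
move=> z z' x x'.
move: (cfirst R Phi) (cfront3 Phi) (cpull (mul12 m R2) Phi) (cpull (id_mul12 m R R) Phi)
  (cpull (mor_prod (mor_id R) (id_mul m R)) Phi) => P0 P4 P1 P2 P3.
move: (cpull (id_mul12 m R R) (cpull (id_mul m R) f))
  (cpull (mor_prod (mor_id R) (id_mul m R)) (cpull (id_mul m R) f))
  (cpull (mul12 m R2) (cpull (mul12 m R) g))
  (cpull (id_mul12 m R R) (cpull (mul12 m R) g))
  (cpull (mul12 m R2) (cpull (id_mul m R) g))
  (cpull (mul12 m R2) (cpull (id_mul m R) f)) => b b0 e e1 c' c.
move=> assoc1 assoc2 xz zz xx cc dd uu vv pent.
(* On the right side the inverse pairs for Sigma(Y,Z), Sigma(YZ,W) and Sigma(X,YZ) cancel where the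
   three twisted factors meet. *)
rewrite !(cmul_cancel _ dd) (cmul_cancel _ uu) (cmul_cancel _ vv).
rewrite -[_ \* P0 \* b]cmulA assoc1 !cmulA -[_ \* e1 \* P4]cmulA -assoc2 !cmulA.
(* On the left side the middle of the word is c' x' z' x z c. Swapping x = Sigma(X,Y) with z =
   Sigma(Z,W) lets the three pairs cancel, and the old cocycle identity finishes. *)
rewrite -[_ \* x \* z]cmulA xz !cmulA (cmul_cancel _ zz) (cmul_cancel _ xx) (cmul_cancel _ cc).
by rewrite -[_ \* P3 \* P1]cmulA pent !cmulA.
Qed.

Lemma lconv_cmul T M (x y : cochain T) (F : behom T M) :
  lconv (x \* y) F = lconv x (lconv y F).
Proof. exact: lconvA. Qed.

Lemma rconv_cmul T M (x y : cochain T) (F : behom T M) :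
  rconv F (x \* y) = rconv (rconv F x) y.
Proof. by rewrite rconvA. Qed.

Lemma lconv_cancel T M (x y : cochain T) (F : behom T M) :
  x \* y = cone T -> lconv x (lconv y F) = F.
Proof. by move=> xy; rewrite -lconv_cmul xy; apply: lconv1. Qed.

Lemma rconv_cancel T M (x y : cochain T) (F : behom T M) :
  x \* y = cone T -> rconv (rconv F x) y = F.
Proof. by move=> xy; rewrite -rconv_cmul xy; apply: rconv1. Qed.

Lemma twist_hpull_mul12 M T (h : behom (R ** T) M) :
  hpull (mul12 m' T) h =
  lconv (cfront T f) (rconv (hpull (mul12 m T) h) (cfront T g)).
Proof. exact: (twist_hpull (twist_comp (mor_assoc R R T) (twist_prod_id (U := T) mP)) h). Qed.

Lemma twist_hpull_id_mul M S (h : behom (S ** R) M) :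
  hpull (id_mul m' S) h =
  lconv (cfirst S f) (rconv (hpull (id_mul m S) h) (cfirst S g)).
Proof. exact: (twist_hpull (twist_id_prod (U := S) mP) h). Qed.

Lemma hpull_mulL M n (h : behom R M) : hpull (mulL n) h = hpull (mul12 n R) (hpull n h).
Proof. exact: hom_ext. Qed.

Lemma hpull_mulR M n (h : behom R M) : hpull (mulR n) h = hpull (id_mul n R) (hpull n h).
Proof. exact: hom_ext. Qed.

Lemma twist_mulL M (h : behom R M) :
  hpull (mulL m') h = lconv (cfront R f) (lconv (cpull (mul12 m R) f)
    (rconv (rconv (hpull (mulL m) h) (cpull (mul12 m R) g)) (cfront R g))).
Proof.
rewrite !hpull_mulL twist_hpull_mul12 (twist_hpull mP).
by rewrite hpull_lconv hpull_rconv lrconvA.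
Qed.

Lemma twist_mulR M (h : behom R M) :
  hpull (mulR m') h = lconv (cfirst R f) (lconv (cpull (id_mul m R) f)
    (rconv (rconv (hpull (mulR m) h) (cpull (id_mul m R) g)) (cfirst R g))).
Proof.
rewrite !hpull_mulR twist_hpull_id_mul (twist_hpull mP).
by rewrite hpull_lconv hpull_rconv lrconvA.
Qed.

(* The case M = L, h = id is the quasi-associativity of the twisted product. *)
Lemma reassociates_twist M (h : behom R M) (Phi : cochain R3) :
  lconv Phi (hpull (mulL m) h) = rconv (hpull (mulR m) h) Phi ->
  lconv (twist3 Phi) (hpull (mulL m') h) = rconv (hpull (mulR m') h) (twist3 Phi).
Proof.
have fr : cfront R g \* cfront R f = cone R3 by rewrite -cfrontM gf cfront1.
have m12 : cpull (mul12 m R) g \* cpull (mul12 m R) f = cone R3 by rewrite -cpullM gf cpull1.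
have fi : cfirst R g \* cfirst R f = cone R3 by rewrite -cfirstM gf cfirst1.
have m23 : cpull (id_mul m R) g \* cpull (id_mul m R) f = cone R3 by rewrite -cpullM gf cpull1.
move=> mPhi; rewrite twist_mulL twist_mulR /twist3 !lconv_cmul.
rewrite (lconv_cancel _ fr) (lconv_cancel _ m12) -!lrconvA mPhi !rconv_cmul !lrconvA.
by rewrite (rconv_cancel _ fi) (rconv_cancel _ m23).
Qed.

End Pentagon.

(** * Iterated coproducts *)

Section Iterated.
Variables (k : fieldType) (B : algType k).
Implicit Types (S T U : rcoalg B).

Lemma eq_big_all (I : Type) (V : nmodType) (P : pred I) (l : seq I) (F G : I -> V) :
  all P l -> (forall i, P i -> F i = G i) -> \sum_(i <- l) F i = \sum_(i <- l) G i.
Proof.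
move=> + h; elim: l => [|i l IH] /=; first by rewrite !big_nil.
by move=> /andP[Pi /IH e]; rewrite !big_cons h // e.
Qed.

Section OneCoalg.
Variable T : rcoalg B.

(* [kern n K]: K factors through the (n+1)-fold balanced product; [itd n K t] is
   K(t_(1), ..., t_(n+1)); [rep n t l]: the list l of pure tensors has sum
   t_(1) (x) ... (x) t_(n+1). *)
Definition kern n (V : lmodType k) (K : seq T -> V) : Prop :=
  (forall u v, size u + size v = n -> adm (fun x => K (u ++ x :: v)))%N /\
  (forall u v b x y, (size u + size v).+1 = n ->
     K (u ++ tlb b x :: y :: v) = K (u ++ x :: tl b y :: v))%N.

Fixpoint itd n (V : lmodType k) (K : seq T -> V) (t : T) : V :=
  if n is n'.+1 then \sum_(p <- dec t) itd n' (fun w => K (p.1 :: w)) p.2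
  else K [:: t].

Definition rep n (t : T) (l : seq (seq T)) : Prop :=
  all (fun w => size w == n.+1) l /\
  forall (V : lmodType k) (K : seq T -> V), kern n K ->
    \sum_(w <- l) K w = itd n K t.

Section Itd.
Variable V : lmodType k.
Implicit Types K F G : seq T -> V.

Lemma kern_cons n K x : kern n.+1 K -> kern n (fun w => K (x :: w)).
Proof.
move=> [K1 K2]; split=> [u v huv|u v b a c huv].
  by apply: (K1 (x :: u) v); rewrite /= addSn huv.
by apply: (K2 (x :: u) v); rewrite /= addSn huv.
Qed.

Lemma kern0 K : kern 0 K -> adm (fun x => K [:: x]).
Proof. by move=> [K1 _]; apply: (K1 [::] [::]). Qed.

Lemma itd_ext n K K' t : (forall w, size w = n.+1 -> K w = K' w) -> itd n K t = itd n K' t.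
Proof.
elim: n K K' t => [|n IH] K K' t h /=; first exact: h.
by apply: eq_bigr => p _; apply: IH => w hw; apply: h; rewrite /= hw.
Qed.

Lemma itd_adm_param S n (F : S -> seq T -> V) t :
  (forall w, size w = n.+1 -> adm (F^~ w)) -> adm (fun s => itd n (F s) t).
Proof.
elim: n F t => [|n IH] F t h /=; first exact: h.
apply: adm_sum => p; apply: (IH (fun s w => F s (p.1 :: w))) => w hw.
by apply: h; rewrite /= hw.
Qed.

Lemma itd_sum n (I : Type) (r : seq I) (F : I -> seq T -> V) t :
  itd n (fun w => \sum_(i <- r) F i w) t = \sum_(i <- r) itd n (F i) t.
Proof.
elim: n F t => [|n IH] F t //=.
by rewrite exchange_big; apply: eq_bigr => p _; rewrite IH.
Qed.

Lemma itd_linear (W : lmodType k) (h : V -> W) n K t :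
  linear h -> itd n (fun w => h (K w)) t = h (itd n K t).
Proof.
move=> hl; elim: n K t => [|n IH] K t //=.
by rewrite (linear_big _ _ hl); apply: eq_bigr => p _; rewrite IH.
Qed.

Lemma itd_kernel n K : kern n.+1 K ->
  (forall G, kern n G -> adm (itd n G)) ->
  (forall G G' b t, kern n G ->
     (forall c w, size w = n -> G' (c :: w) = G (tl b c :: w)) ->
     itd n G (tl b t) = itd n G' t) ->
  ker2 (fun x y => itd n (fun w => K (x :: w)) y).
Proof.
move=> KP nadm ntl; split=> [y|x|b x y].
- apply: (itd_adm_param (F := fun x w => K (x :: w))) => w hw.
  by case: KP => K1 _; apply: (K1 [::] w).
- by apply: nadm; apply: kern_cons.
rewrite (ntl _ (fun w => K (tlb b x :: w)) b y (kern_cons x KP)) // => c w hw.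
by case: KP => _ K2; apply: (K2 [::] w); rewrite /= hw.
Qed.

Lemma itd_adm_tl n :
  (forall G, kern n G -> adm (itd n G)) /\
  (forall G G' b t, kern n G ->
     (forall c w, size w = n -> G' (c :: w) = G (tl b c :: w)) ->
     itd n G (tl b t) = itd n G' t).
Proof.
elim: n => [|n [IHa IHt]].
  split=> [G GP|G G' b t GP h] /=; first exact: kern0.
  by rewrite h.
split=> [G GP|G G' b t GP h] /=.
  exact: dec_adm (itd_kernel GP IHa IHt).
rewrite (dec_tl _ _ (itd_kernel GP IHa IHt)); apply: eq_bigr => p _ /=.
by apply: itd_ext => w hw; rewrite h.
Qed.

Lemma itd_adm n K : kern n K -> adm (itd n K).
Proof. by case: (itd_adm_tl n) => h _; apply: h. Qed.

Lemma itd_tl n G G' b t : kern n G ->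
  (forall c w, size w = n -> G' (c :: w) = G (tl b c :: w)) ->
  itd n G (tl b t) = itd n G' t.
Proof. by case: (itd_adm_tl n) => _ h; apply: h. Qed.

Lemma itd_ker2 n K : kern n.+1 K -> ker2 (fun x y => itd n (fun w => K (x :: w)) y).
Proof. by move=> KP; case: (itd_adm_tl n) => h1 h2; apply: itd_kernel. Qed.

Lemma itd_tr n G G' b t : kern n G ->
  (forall c w, size w = n -> G' (c :: w) = G (tr c b :: w)) ->
  itd n G (tr t b) = itd n G' t.
Proof.
case: n => [|n] GP h /=; first by rewrite h.
rewrite (dec_tr _ _ (itd_ker2 GP)); apply: eq_bigr => p _ /=.
by apply: itd_ext => w hw; rewrite h.
Qed.

Lemma itd_tlb n G G' b t : kern n G ->
  (forall c w, size w = n -> G' (rcons w c) = G (rcons w (tlb b c))) ->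
  itd n G (tlb b t) = itd n G' t.
Proof.
elim: n G G' t => [|n IH] G G' t GP h /=; first by rewrite (h t [::]).
rewrite (dec_tlb _ _ (itd_ker2 GP)); apply: eq_bigr => p _ /=.
apply: IH; first exact: kern_cons.
by move=> c w hw; rewrite -rcons_cons h //= hw.
Qed.

(** Invariance between the neighbouring legs i and i + 1, counted from 0. [F1] and [F2] are
    prescribed only on sequences of length n + 1, the only ones that [itd] evaluates. *)
Lemma itd_takeuchi n i F F1 F2 b t : kern n F -> (i < n)%N ->
  (forall u x y v, size u = i -> (size u + size v).+1 = n ->
     F1 (u ++ x :: y :: v) = F (u ++ trb x b :: y :: v))%N ->
  (forall u x y v, size u = i -> (size u + size v).+1 = n ->
     F2 (u ++ x :: y :: v) = F (u ++ x :: tr y b :: v))%N ->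
  itd n F1 t = itd n F2 t.
Proof.
elim: i n F F1 F2 t => [|i IH] [|n] F F1 F2 t FP // hin h1 h2 /=.
  transitivity (\sum_(p <- dec t) itd n (fun w => F (trb p.1 b :: w)) p.2).
    apply: eq_bigr => p _; apply: itd_ext => -[//|y v] [hv].
    by rewrite (h1 [::]) //= add0n hv.
  rewrite (dec_takeuchi _ _ (itd_ker2 FP)); apply: eq_bigr => p _ /=.
  apply: itd_tr; first exact: kern_cons.
  by move=> c w hw; rewrite (h2 [::]) //= add0n hw.
apply: eq_bigr => p _; apply: (IH n (fun w => F (p.1 :: w))) => //.
- exact: kern_cons.
- by move=> u x y v hu huv; apply: (h1 (p.1 :: u)); rewrite /= ?hu // addSn -huv hu.
- by move=> u x y v hu huv; apply: (h2 (p.1 :: u)); rewrite /= ?hu // addSn -huv hu.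
Qed.

(** The default 0 is harmless, as [kern] in degree 1 constrains only sequences of length 2. *)
Lemma kern1 (K : T -> T -> V) : ker2 K ->
  kern 1 (fun w => if w is [:: x; y] then K x y else 0).
Proof.
move=> [K1 K2 K3]; split=> [[|u1 [|u2 u]] [|v1 [|v2 v]] //= _|[|u1 u] [|v1 v] //= b x y _].
Qed.

Lemma kern2 (K : T -> T -> T -> V) : ker3 K ->
  kern 2 (fun w => if w is [:: x; y; z] then K x y z else 0).
Proof.
move=> [K1 K2 K3 K4 K5].
split=> [[|u1 [|u2 [|u3 u]]] [|v1 [|v2 [|v3 v]]] //= _|[|u1 [|u2 u]] [|v1 [|v2 v]] //= b x y _].
Qed.

Lemma itd_ker3 n K : kern n.+2 K ->
  ker3 (fun x y z => itd n (fun w => K (x :: y :: w)) z).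
Proof.
move=> KP; have Kx x := itd_ker2 (kern_cons x KP).
split=> [y z|x z|x y|b x y z|b x y z].
- apply: (itd_adm_param (F := fun x w => K (x :: y :: w))) => w hw.
  by case: KP => K1 _; apply: (K1 [::] (y :: w)); rewrite /= hw.
- by case: (Kx x).
- by case: (Kx x).
- apply: itd_ext => w hw; case: KP => _ K2.
  by apply: (K2 [::] w); rewrite /= hw.
- by case: (Kx x).
Qed.

Lemma itd_left_ker3 n K : kern n.+2 K ->
  ker3 (fun x y z => itd n (fun w => K (x :: rcons w z)) y).
Proof.
move=> KP; have [K1 K2] := KP.
have KP' x z : kern n (fun w => K (x :: rcons w z)).
  split=> [u v huv|u v b a c huv].
    under eq_fun do rewrite rcons_cat.
    by apply: (K1 (x :: u) (rcons v z)); rewrite /= size_rcons addSn addnS huv.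
  rewrite !rcons_cat; apply: (K2 (x :: u) (rcons v z)).
  by rewrite /= size_rcons addSn addnS huv.
split=> [y z|x z|x y|b x y z|b x y z].
- apply: (itd_adm_param (F := fun x w => K (x :: rcons w z))) => w hw.
  by apply: (K1 [::]); rewrite /= size_rcons hw.
- by apply: itd_adm; apply: KP'.
- apply: (itd_adm_param (F := fun z w => K (x :: rcons w z))) => w hw.
  under eq_fun do rewrite -cats1.
  by apply: (K1 (x :: w) [::]); rewrite /= hw addn0.
- rewrite (itd_tl (G' := fun w => K (tlb b x :: rcons w z))) // => c w hw.
  by apply: (K2 [::]); rewrite /= size_rcons hw.
- rewrite (itd_tlb (G' := fun w => K (x :: rcons w (tl b z)))) // => c w hw.
  rewrite -!cats1 -!catA; apply: esym (K2 (x :: w) [::] _ _ _ _).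
  by rewrite /= hw addn0.
Qed.

(** [itd] keeps splitting the second leg. By coassociativity the last leg can be split off first
    instead, as the rightmost cochain of a product requires. *)
Lemma itd_left n K t : kern n.+1 K ->
  itd n.+1 K t = \sum_(p <- dec t) itd n (fun w => K (rcons w p.2)) p.1.
Proof.
elim: n K t => [|n IH] K t KP //.
transitivity (\sum_(p <- dec t) \sum_(q <- dec p.2)
    itd n (fun w => K (p.1 :: rcons w q.2)) q.1).
  by apply: eq_bigr => p _; apply: IH (kern_cons _ KP).
by rewrite -(dec_coassoc _ (itd_left_ker3 KP)).
Qed.

End Itd.

(* Lengthening the list of the first argument by splitting its first entry lines it
   up with those of the other arguments, in the formulas where they differ. *)
Definition split_head (l : seq (seq T)) : seq (seq T) :=
  flatten [seq (if w is x :: v then [seq p.1 :: p.2 :: v | p <- dec x] else [::]) | w <- l].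

Lemma rep_split n t l : rep n t l -> rep n.+1 t (split_head l).
Proof.
move=> [sl hl]; split.
  elim: l sl {hl} => //= w l IH /andP[hw /IH hl]; rewrite /split_head /= all_cat hl andbT.
  case: w hw => //= x v hv; elim: (dec x) => //= p r ->.
  by rewrite andbT.
move=> V K KP.
(* [K'] splits the head before applying K; it is balanced in degree n, so the given list can be
   evaluated on it. *)
pose K' (w : seq T) := if w is x :: v then \sum_(p <- dec x) K (p.1 :: p.2 :: v) else 0.
have [K1 K2] := KP.
have Kker v : size v = n -> ker2 (fun x y => K (x :: y :: v)).
  move=> hv; split=> [y|x|b x y].
  - by apply: (K1 [::]); rewrite /= hv.
  - by apply: (K1 [:: x]); rewrite /= hv.
  - by apply: (K2 [::]); rewrite /= hv.
rewrite big_flatten big_map.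
transitivity (\sum_(w <- l) K' w).
  by apply: eq_bigr => -[|x v] _; rewrite ?big_nil // big_map.
rewrite hl; last first.
  split=> [[|a u] v huv|[|a u] v b x y huv] /=.
  - exact: dec_adm (Kker v huv).
  - apply: adm_sum => p.
    by apply: (K1 [:: p.1, p.2 & u]); rewrite /= addSn huv.
  - rewrite (dec_tlb _ _ (Kker (y :: v) _)) //; apply: eq_bigr => p _ /=.
    by apply: (K2 [:: p.1]); rewrite -huv.
  - apply: eq_bigr => p _; apply: (K2 [:: p.1, p.2 & u]).
    by rewrite -huv.
case: n {sl hl} KP K1 K2 Kker => [|n] KP K1 K2 Kker //.
rewrite -[itd n.+2 K t]/(\sum_(p <- dec t) \sum_(q <- dec p.2) itd n (fun w => K (p.1 :: q.1 :: w)) q.2).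
rewrite -(dec_coassoc _ (itd_ker3 KP)).
apply: eq_bigr => p _.
exact: (itd_sum n (dec p.1) (fun q w => K [:: q.1, q.2 & w]) p.2).
Qed.

End OneCoalg.

Section Product.
Variables (S T : rcoalg B) (V : lmodType k).
Implicit Types (K : seq (S ** T) -> V).

Lemma seq_split_at (A : Type) (w : seq A) i n : size w = n -> (i < n)%N ->
  exists u x v, [/\ w = u ++ x :: v, size u = i & (size u + size v).+1 = n].
Proof.
move=> hw hi; case E : (drop i w) => [|x v].
  by have := congr1 size E; rewrite size_drop hw => /eqP; rewrite subn_eq0 leqNgt hi.
exists (take i w), x, v; rewrite -E cat_take_drop; split=> //.
  by rewrite size_takel // hw ltnW.
by have := congr1 size (cat_take_drop i w); rewrite E hw size_cat /= addnS.
Qed.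

Lemma kern_fst n K (w' : seq T) : kern n K -> size w' = n.+1 ->
  kern n (fun w : seq S => K (zip w w')).
Proof.
move=> [K1 K2] hw'; split=> [u v huv|u v b x y huv].
  have [u' [y [v' [-> hu' huv']]]] := seq_split_at (i := size u) hw' ltac:(lia).
  under eq_fun do rewrite zip_cat //=.
  have hz : (size (zip u u') + size (zip v v') = n)%N.
    by rewrite !size_zip hu' minnn; move: huv'; rewrite hu' -huv => -[/addnI ->]; rewrite minnn.
  by case: (K1 _ _ hz).
have [u' [a [v' [-> hu' huv']]]] := seq_split_at (i := size u) hw' ltac:(lia).
case: v' huv' => [|c v'] huv'; first by move: huv'; rewrite hu' -huv /=; lia.
rewrite !zip_cat //=; apply: (K2 _ _ b (x, a) (y, c)).
by rewrite !size_zip; move: huv'; rewrite hu' -huv /=; lia.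
Qed.

(** As in [kernel2_snd], balance in T holds only after the sum over s; here the Takeuchi invariance
    is used between the two matching legs of s. *)
Lemma kern_snd n K s : kern n K ->
  kern n (fun w' : seq T => itd n (fun w => K (zip w w')) s).
Proof.
move=> KP; have [K1 K2] := KP; split=> [u v huv|u v b x y huv].
  apply: (itd_adm_param (F := fun y w => K (zip w (u ++ y :: v)))) => w hw.
  have [u' [y [v' [-> hu' huv']]]] := seq_split_at (i := size u) hw ltac:(lia).
  under eq_fun do rewrite zip_cat ?hu' //=.
  have hz : (size (zip u' u) + size (zip v' v) = n)%N by rewrite !size_zip; lia.
  by case: (K1 _ _ hz).
apply: (itd_takeuchi (i := size u) (b := b) (F := fun w => K (zip w (u ++ x :: y :: v)))).
- by apply: kern_fst => //; rewrite size_cat /=; lia.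
- lia.
- move=> u' a c v' hu' huv'; rewrite !zip_cat //=.
  have hz : (size (zip u' u) + size ((c, y) :: zip v' v) = n)%N by rewrite /= !size_zip; lia.
  by case: (K1 _ _ hz) => _ _ _ /(_ a x b) h; apply: esym.
- move=> u' a c v' hu' huv'; rewrite !zip_cat //= -!cat_rcons.
  have hz : (size (rcons (zip u' u) (a, x)) + size (zip v' v) = n)%N.
    by rewrite size_rcons !size_zip; lia.
  by case: (K1 _ _ hz) => _ _ /(_ c y b) + _; rewrite !cat_rcons => ->.
Qed.

Lemma itd_prod n K s t :
  itd n (fun w' => itd n (fun w => K (zip w w')) s) t = itd n K ((s, t) : S ** T).
Proof.
elim: n K s t => [|n IH] K s t //=.
rewrite [RHS](sum_dec_prod (fun x y => itd n (fun w => K (x :: w)) y)).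
apply: eq_bigr => q _; rewrite itd_sum; apply: eq_bigr => p _.
exact: (IH (fun w => K ((p.1, q.1) :: w))).
Qed.

End Product.

Lemma rep_prod S T n (s : S) (t : T) l l' : rep n s l -> rep n t l' ->
  rep n ((s, t) : S ** T) [seq zip w w' | w <- l, w' <- l'].
Proof.
move=> [sl hl] [sl' hl']; split.
  elim: l sl {hl} => //= w l IH /andP[hw /IH h]; rewrite all_cat h andbT.
  elim: l' sl' {hl' IH h} => //= w' l' IH /andP[hw' /IH ->].
  by rewrite size_zip (eqP hw) (eqP hw') minnn eqxx.
move=> V K KP; rewrite big_allpairs_dep exchange_big -itd_prod -hl' /=; last exact: kern_snd.
apply: (eq_big_all sl') => w' /eqP hw'.
by rewrite hl //; apply: kern_fst.
Qed.

Local Notation BB := (regular_bemod B).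

(** Values are multiplied in the order of the legs, so that [itd] of [pk] is an iterated convolution
    ([itd_pk]); 1 is the empty product. *)
Fixpoint pk T (fs : seq (behom T BB)) (w : seq T) : B :=
  if fs is f :: fs' then (if w is x :: w' then f x * pk fs' w' else 1) else 1.

Lemma pk_rcons T (fs : seq (behom T BB)) h w v : size w = size fs ->
  pk (rcons fs h) (rcons w v) = pk fs w * h v.
Proof.
elim: fs w => [|f fs IH] [|x w] //=; first by rewrite mulr1 mul1r.
by move=> [/IH ->]; rewrite mulrA.
Qed.

Lemma kern_pk T n (fs : seq (behom T BB)) : size fs = n.+1 -> kern n (pk fs : _ -> B).
Proof.
move=> sfs; split=> [u v huv|u v b x y huv].
  elim: u fs n sfs huv => [|a u IH] [|f fs] n //= [sfs] huv.
    apply: (adm_comp (h := fun c : B => c * pk fs v)) (hom_adm f).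
    by move=> c p q; rewrite mulrDl scalerAl.
  apply: (adm_comp (h := fun c : B => f a * c)).
    by move=> c p q; rewrite mulrDr scalerAr.
  by case: n sfs huv => [|n] sfs; [lia|move=> huv; apply: (IH fs n) => //; lia].
elim: u fs n sfs huv => [|a u IH] [|f fs] n //= [sfs] huv.
  case: fs sfs => [|g fs] /= sfs; first by lia.
  by rewrite hom_tlbB hom_tlB !mulrA.
by congr (_ * _); case: n sfs huv => [|n] sfs; [lia|move=> huv; apply: (IH fs n) => //; lia].
Qed.

Fixpoint lprod T (f : behom T BB) (fs : seq (behom T BB)) : behom T BB :=
  if fs is g :: fs' then lconv f (lprod g fs') else f.

Lemma itd_pk T (f : behom T BB) (fs : seq (behom T BB)) t :
  itd (size fs) (pk (f :: fs) : _ -> B) t = lprod f fs t.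
Proof.
elim: fs f t => [|g fs IH] f t; first by rewrite /= mulr1.
apply: eq_bigr => p _; rewrite -IH.
apply: (itd_linear (h := fun c : B => f p.1 * c)).
by move=> c x y; rewrite mulrDr scalerAr.
Qed.

Section Restrict.
Variables (S U : rcoalg B).

(** With the last argument frozen, the legs of s can be summed for each fixed term of the list of
    u. *)
Definition restr (G : behom (S ** U) BB) (u : U) : behom S BB.
Proof.
apply: (@BeHom _ _ S BB (fun s => G (s, u))).
- by case: (hom_adm G).
- by move=> b s; apply: (hom_tl G b (s, u)).
- by move=> b s; apply: (hom_tlb G b (s, u)).
Defined.

Definition restrs (fs : seq (behom (S ** U) BB)) (w' : seq U) : seq (behom S BB) :=
  [seq restr p.1 p.2 | p <- zip fs w'].

Lemma pk_restrs fs w w' : size w' = size fs -> size w = size fs ->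
  pk (restrs fs w') w = pk fs (zip w w').
Proof.
elim: fs w w' => [|f fs IH] [|x w] [|y w'] //= [h1] [h2].
by rewrite -/(restrs fs w') IH.
Qed.

(* In the Sweedler formulas for the cocycles the last argument occurs with one factor
   less than the others, because the rightmost cochain ignores it. *)
Lemma sum_rep_last (f : behom (S ** U) BB) (fs : seq (behom (S ** U) BB)) (h : cochain S)
    (s : S) (u : U) l l' :
  rep (size fs).+1 s l -> rep (size fs) u l' ->
  \sum_(w' <- l') \sum_(w <- l) pk (rcons (restrs (f :: fs) w') h) w =
  rconv (lprod f fs) (clast U h) (s, u).
Proof.
move=> [sl hl] [sl' hl'].
rewrite -rcv_rconv rcv_last; last exact: hom_adm.
transitivity (\sum_(w' <- l') \sum_(p <- dec s)
    itd (size fs) (fun w => pk (f :: fs) (zip w w')) p.1 * h p.2).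
  apply: (eq_big_all sl') => w' /eqP hw'.
  rewrite hl; last by apply: kern_pk; rewrite size_rcons size_map size_zip hw' /= minnn.
  (* The last leg of s, which feeds [h], is separated from the others, which are paired with the
     legs of u. *)
  rewrite itd_left; last by apply: kern_pk; rewrite size_rcons size_map size_zip hw' /= minnn.
  apply: eq_bigr => p _.
  rewrite -(itd_linear (h := fun c : B => c * h p.2)); last first.
    by move=> c x y; rewrite mulrDl scalerAl.
  apply: itd_ext => w hw; rewrite pk_rcons ?pk_restrs //.
  by rewrite size_map size_zip hw' hw /= minnn.
rewrite exchange_big; apply: eq_bigr => p _ /=.
rewrite -mulr_suml (hl' _ (fun w' => itd (size fs) (fun w => pk (f :: fs) (zip w w')) p.1)).
  rewrite itd_prod itd_pk -[RHS]/(lprod f fs (tlb (h p.2) ((p.1, u) : S ** U))).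
  by rewrite hom_tlbB.
exact: kern_snd (kern_pk _).
Qed.

End Restrict.

End Iterated.

(** * From convolution products to explicit Sweedler sums *)

Section Unassoc.
Variables (k : fieldType) (B : algType k).

(** Isolates the last argument as a right factor, so that the rightmost cochain becomes a [clast]
    and [sum_rep_last] applies. *)
Definition mor_unassoc (S T U : rcoalg B) : mor ((S ** T) ** U) (S ** (T ** U)).
Proof.
apply: (@Mor _ _ ((S ** T) ** U) (S ** (T ** U)) (fun x => (x.1.1, (x.1.2, x.2)))).
- move=> V f [f1 f2 f3 f4]; split=> [u|[s t]|[s t] u b|[s t] u b] /=.
  + split=> [t|s|s t b|s t b].
    * exact: (f1 (t, u)).
    * by case: (f2 s).
    * exact: (f3 s (t, u)).
    * exact: (f4 s (t, u)).
  + by case: (f2 s).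
  + by case: (f2 s).
  + by case: (f2 s).
- by [].
- by [].
- by [].
- by [].
- move=> V K [[s t] u] KP; rewrite sum_dec_prod.
  rewrite (sum_dec_prod (fun x y : (S ** T) ** U => K (x.1.1, (x.1.2, x.2)) (y.1.1, (y.1.2, y.2)))) /=.
  rewrite (sum_pdec' (fun y1 y2 : T * U => \sum_(p <- dec s) K (p.1, y1) (p.2, y2))) /=.
  apply: eq_bigr => q _.
  by rewrite (sum_pdec' (fun x y : S * T => K (x.1, (x.2, q.1)) (y.1, (y.2, q.2)))).
- by move=> [[s t] u].
Defined.

(** The factor eps(p_1 b) of a [cfirst] is absorbed by its neighbour: the counit law gives G(s b,
    u), and balance moves b to u. Thus a separate factor becomes a nested value. *)
Lemma sum_dec_tr (S U : rcoalg B) (G : behom (S ** U) (regular_bemod B)) b s u :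
  \sum_(p <- dec s) eps (tr p.1 b) * G (p.2, u) = G (s, tl b u).
Proof.
have [_ _ G3 _] := hom_adm G; rewrite -G3.
rewrite -[RHS]/(restr G u (tr s b)) -[in RHS](lconv1 (restr G u)) /=.
by rewrite (dec_tr _ _ (lconv_kernel (hom_eps S) (restr G u))).
Qed.

End Unassoc.

Section SumFormulas.
Variables (k : fieldType) (B : algType k) (R : rcoalg B).
Local Notation BB := (regular_bemod B).
Local Notation R2 := (R ** R).
Local Notation R3 := (R ** (R ** R)).
Local Notation R4 := (R ** (R ** (R ** R))).
Local Notation "f \* g" := (cmul f g) (at level 40, left associativity).

Lemma sum_split_head (I : Type) (l : seq I) (h : I -> R) (v : I -> seq R)
    (V : lmodType k) (K : seq R -> V) :
  \sum_(w <- split_head [seq h i :: v i | i <- l]) K w =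
  \sum_(i <- l) \sum_(u <- dec (h i)) K [:: u.1, u.2 & v i].
Proof.
rewrite big_flatten big_map big_map; apply: eq_bigr => i _.
by rewrite big_map.
Qed.

Definition unassoc3 : mor (R3 ** R) R4 :=
  mor_comp (mor_prod (mor_id R) (mor_unassoc R R R)) (mor_unassoc R R2 R).

Lemma unassoc3_pentagon (m : mor R2 R) (F : cochain R3) :
  cpull unassoc3 (cfirst R F \* cpull (id_mul12 m R R) F \* cfront3 F) =
  cpull unassoc3 (cfirst R F) \* cpull unassoc3 (cpull (id_mul12 m R R) F) \* clast R F.
Proof.
rewrite cpullM cpullM; congr (_ \* _).
by apply: cochain_ext => -[[x' [y' z']] w'].
Qed.

Lemma unassoc_twist3 (m : mor R2 R) (f g : cochain R2) (F : cochain R3) :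
  cpull (mor_unassoc R R R) (twist3 m f g F) =
  cpull (mor_unassoc R R R) (cfirst R f) \* cpull (mor_unassoc R R R) (cpull (id_mul m R) f) \*
  cpull (mor_unassoc R R R) F \* cpull (mor_unassoc R R R) (cpull (mul12 m R) g) \* clast R g.
Proof.
rewrite /twist3 4!cpullM; congr (_ \* _).
by apply: cochain_ext => -[[x' y'] z'].
Qed.

Variables (I J K' M : Type) (X Y Z W : R).

(** Three cochains call for three legs of X, where the formula has two: [rep_split] splits the head
    of X, and [sum_dec_tr] contracts it again while nesting the value of F at (Y, Z, W). Two legs of
    W suffice because the last factor ignores W. *)
Lemma sum_pentagon (m : mor R2 R) (F : cochain R3)
    (x : seq I) (y : seq J) (z : seq K') (w : seq M)
    (p0 p1 : I -> R) (q0 q1 q2 : J -> R) (r0 r1 r2 : K' -> R) (o0 o1 : M -> R) :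
  rep 1 X [seq [:: p0 i; p1 i] | i <- x] ->
  rep 2 Y [seq [:: q0 i; q1 i; q2 i] | i <- y] ->
  rep 2 Z [seq [:: r0 i; r1 i; r2 i] | i <- z] ->
  rep 1 W [seq [:: o0 i; o1 i] | i <- w] ->
  \sum_(p <- x) \sum_(q <- y) \sum_(r <- z) \sum_(o <- w)
    F (p0 p, (tl (F (q0 q, (r0 r, o0 o))) (m (q1 q, r1 r)), o1 o)) *
    F (p1 p, (q2 q, r2 r)) =
  (cfirst R F \* cpull (id_mul12 m R R) F \* cfront3 F) (X, (Y, (Z, W))).
Proof.
move=> hx hy hz hw.
pose f1 := cpull unassoc3 (cfirst R F).
pose f2 := cpull unassoc3 (cpull (id_mul12 m R R) F).
rewrite -[RHS]/(cpull unassoc3 (cfirst R F \* cpull (id_mul12 m R R) F \* cfront3 F)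
    ((X, (Y, Z)), W)) unassoc3_pentagon -/f1 -/f2 cmul_rcv (rcv_rconv (M := BB)).
rewrite -[cochain_hom (f1 \* f2)]/(lprod f1 [:: (f2 : behom _ BB)]).
rewrite -(sum_rep_last f1 (fs := [:: (f2 : behom _ BB)]) F
  (rep_prod (rep_split hx) (rep_prod hy hz)) hw).
rewrite big_map /=.
(* The sums are reordered until the coproduct of the head of X is innermost. *)
under [RHS]eq_bigr do rewrite big_allpairs_dep sum_split_head.
rewrite [RHS]exchange_big; apply: eq_bigr => p _ /=.
under [RHS]eq_bigr do under eq_bigr do rewrite big_allpairs_dep big_map.
under [RHS]eq_bigr do rewrite exchange_big /=.
rewrite [RHS]exchange_big; apply: eq_bigr => q _ /=.
under [RHS]eq_bigr do under eq_bigr do rewrite big_map.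
under [RHS]eq_bigr do rewrite exchange_big /=.
rewrite [RHS]exchange_big; apply: eq_bigr => r _ /=.
apply: eq_bigr => o _.
under [RHS]eq_bigr do rewrite mulr1 mulrA.
rewrite -mulr_suml; congr (_ * _).
exact: esym (sum_dec_tr F (F (q0 q, (r0 r, o0 o))) (p0 p) ((m (q1 q, r1 r), o1 o) : R2)).
Qed.

(** Five cochains call for five legs of X and Y and four of Z, as the last factor ignores Z. The
    fifth leg of X comes from splitting its head and is contracted when f at (Y, Z) is nested. *)
Lemma sum_twist3 (m : mor R2 R) (f g : cochain R2) (F : cochain R3)
    (x : seq I) (y : seq J) (z : seq K')
    (p0 p1 p2 p3 : I -> R) (q0 q1 q2 q3 q4 : J -> R) (r0 r1 r2 r3 : K' -> R) :
  rep 3 X [seq [:: p0 i; p1 i; p2 i; p3 i] | i <- x] ->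
  rep 4 Y [seq [:: q0 i; q1 i; q2 i; q3 i; q4 i] | i <- y] ->
  rep 3 Z [seq [:: r0 i; r1 i; r2 i; r3 i] | i <- z] ->
  \sum_(p <- x) \sum_(q <- y) \sum_(r <- z)
    f (p0 p, tl (f (q0 q, r0 r)) (m (q1 q, r1 r))) * F (p1 p, (q2 q, r2 r)) *
    g (tlb (g (p3 p, q4 q)) (m (p2 p, q3 q)), r3 r) =
  twist3 m f g F (X, (Y, Z)).
Proof.
move=> hx hy hz.
pose un := mor_unassoc R R R.
pose f1 := cpull un (cfirst R f); pose f2 := cpull un (cpull (id_mul m R) f).
pose f3 := cpull un F; pose f4 := cpull un (cpull (mul12 m R) g).
rewrite -[RHS]/(cpull un (twist3 m f g F) ((X, Y), Z)) unassoc_twist3.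
rewrite -/un -/f1 -/f2 -/f3 -/f4 cmul_rcv (rcv_rconv (M := BB)).
have -> : f1 \* f2 \* f3 \* f4 = lprod f1 [:: (f2 : behom _ BB); (f3 : behom _ BB); (f4 : behom _ BB)] :> behom _ BB.
  by rewrite /= -!lconvA.
rewrite -(sum_rep_last f1 (fs := [:: (f2 : behom _ BB); (f3 : behom _ BB); (f4 : behom _ BB)]) g
  (rep_prod (rep_split hx) hy) hz).
rewrite big_map /=.
under [RHS]eq_bigr do rewrite big_allpairs_dep sum_split_head.
rewrite [RHS]exchange_big; apply: eq_bigr => p _ /=.
under [RHS]eq_bigr do under eq_bigr do rewrite big_map.
under [RHS]eq_bigr do rewrite exchange_big /=.
rewrite [RHS]exchange_big; apply: eq_bigr => q _ /=.
apply: eq_bigr => r _.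
(* Linearity over \bar b takes the inner value of g out on the right, as the last factor of the
   product. *)
rewrite -[g (tlb _ _, _)]/(g (tlb (g (p3 p, q4 q)) ((m (p2 p, q3 q), r3 r) : R2))) hom_tlbB.
under [RHS]eq_bigr do rewrite mulr1 mulrA.
rewrite -mulr_suml -mulrA; congr (_ * _).
exact: esym (sum_dec_tr f (f (q0 q, r0 r)) (p0 p) (m (q1 q, r1 r))).
Qed.

End SumFormulas.

(** * Sweedler lists of L evaluated on balanced maps *)

Section Lists.
Variables (k : fieldType) (B : algType k) (L : coalgebroid B).
Variables (mul : L -> L -> L) (one : L) (s t : B -> L) (Phi : L -> L -> L -> B).
Hypothesis Q : coquasi_bialgebroid mul one s t Phi.

Local Notation RL := (carrier (coquasi_cop_ract Q) (coquasi_cop_rbact Q) (coquasi_counit_right Q)).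
Local Notation R2 := (RL ** RL).
Local Notation R3 := (RL ** (RL ** RL)).
Local Notation R4 := (RL ** (RL ** (RL ** RL))).

Lemma sum_iter_cop n (V : lmodType k) (K : seq RL -> V) D (X : L) :
  presents (@cop _ _ L) D -> kern n K ->
  \sum_(y <- iter_cop D n X) K (tval y) = itd n K X.
Proof.
move=> DP; elim: n K X => [|n IH] K X KP; first by rewrite sum_iter_cop0.
rewrite sum_iter_copS.
transitivity (\sum_(x <- D X) itd n (fun w : seq RL => K (x`_0 :: w)) (x`_1 : RL)).
  by apply: eq_bigr => x _; rewrite -IH //; apply: kern_cons.
exact: (sum_ldec_cop (itd_ker2 KP) (DP X)).
Qed.

(** [mkseq] computes to an explicit sequence of components, the shape in which [sum_pentagon] and
    [sum_twist3] take their lists. *)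
Definition listing n (l : seq (n.+1.-tuple L)) : seq (seq RL) :=
  [seq mkseq (nth 0 (tval p)) n.+1 | p <- l].

(** A balanced K factors through [diamond], where the given list and the iterated coproduct have the
    same sum. *)
Lemma sweedler_rep n (X : L) (l : seq (n.+1.-tuple L)) :
  sweedler X l -> rep n (X : RL) (listing l).
Proof.
move=> [D DP hl]; split.
  by rewrite all_map; elim: l {hl} => //= p l ->; rewrite size_map size_iota eqxx.
move=> V K KP; have [K1 K2] := KP.
have [g gE] : exists g : {linear diamond L n.+1 -> V}, forall w, g (dpure w) = K (tval w).
  apply: tensor_lift => [u v a x y p q r hp hq hr|u v c x y p q hp hq].
    rewrite hp hq hr; apply: (K1 u v).
    by have := size_tuple p; rewrite hp size_cat /= addnS => -[].
  rewrite hp hq; apply: (K2 u v).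
  by have := size_tuple p; rewrite hp size_cat /= !addnS => -[].
rewrite -(sum_iter_cop X DP KP) big_map; have := congr1 g hl; rewrite !raddf_sum => e.
transitivity (\sum_(p <- l) g (dpure p)).
  apply: eq_bigr => p _; rewrite gE; congr K.
  by rewrite -[in RHS](mkseq_nth 0 (tval p)) size_tuple.
by rewrite e; apply: eq_bigr => p _; apply: gE.
Qed.

Section Twofold.
Variables (X Y Z W : L) (x y z w : seq (2.-tuple L)).
Hypotheses (hx : sweedler X x) (hy : sweedler Y y) (hz : sweedler Z z) (hw : sweedler W w).
Variable V : lmodType k.

Lemma sum_sweedler2 (K : R2 -> R2 -> V) : ker2 K ->
  \sum_(p <- x) \sum_(q <- y) K (p`_0, q`_0) (p`_1, q`_1) =
  \sum_(u <- dec ((X, Y) : R2)) K u.1 u.2.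
Proof.
move=> KP; have [_ h] := rep_prod (sweedler_rep hx) (sweedler_rep hy).
apply: etrans (h _ _ (kern1 KP)).
rewrite big_allpairs_dep big_map; apply: eq_bigr => p _.
by rewrite big_map.
Qed.

Lemma sum_sweedler3 (K : R3 -> R3 -> V) : ker2 K ->
  \sum_(p <- x) \sum_(q <- y) \sum_(r <- z)
    K (p`_0, (q`_0, r`_0)) (p`_1, (q`_1, r`_1)) =
  \sum_(u <- dec ((X, (Y, Z)) : R3)) K u.1 u.2.
Proof.
move=> KP; have [_ h] :=
  rep_prod (sweedler_rep hx) (rep_prod (sweedler_rep hy) (sweedler_rep hz)).
apply: etrans (h _ _ (kern1 KP)).
rewrite big_allpairs_dep big_map; apply: eq_bigr => p _.
rewrite big_allpairs_dep big_map; apply: eq_bigr => q _.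
by rewrite big_map.
Qed.

Lemma sum_sweedler4 (K : R4 -> R4 -> V) : ker2 K ->
  \sum_(p <- x) \sum_(q <- y) \sum_(r <- z) \sum_(o <- w)
    K (p`_0, (q`_0, (r`_0, o`_0))) (p`_1, (q`_1, (r`_1, o`_1))) =
  \sum_(u <- dec ((X, (Y, (Z, W))) : R4)) K u.1 u.2.
Proof.
move=> KP; have [_ h] :=
  rep_prod (sweedler_rep hx) (rep_prod (sweedler_rep hy)
    (rep_prod (sweedler_rep hz) (sweedler_rep hw))).
apply: etrans (h _ _ (kern1 KP)).
rewrite big_allpairs_dep big_map; apply: eq_bigr => p _.
rewrite big_allpairs_dep big_map; apply: eq_bigr => q _.
rewrite big_allpairs_dep big_map; apply: eq_bigr => r _.
by rewrite big_map.
Qed.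

End Twofold.

End Lists.

(** * The axioms in Sweedler form as identities of cochains *)

Section Assembly.
Variables (k : fieldType) (B : algType k) (L : coalgebroid B).
Variables (mul : L -> L -> L) (one : L) (s t : B -> L) (Phi : L -> L -> L -> B).
Hypothesis Q : coquasi_bialgebroid mul one s t Phi.

Local Notation RL := (carrier (coquasi_cop_ract Q) (coquasi_cop_rbact Q) (coquasi_counit_right Q)).
Local Notation R2 := (RL ** RL).
Local Notation R3 := (RL ** (RL ** RL)).
Local Notation "f \* g" := (cmul f g) (at level 40, left associativity).
Local Notation idL := (hom_id (coquasi_cop_ract Q) (coquasi_cop_rbact Q) (coquasi_counit_right Q)).

Lemma adm_id : adm (fun x : RL => x).
Proof. by []. Qed.

Section Properties.
Variables (m : mor R2 RL).

Local Notation mulm := (fun X Y : L => m (X, Y) : L).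

Lemma conv_inverse3_cochain (F G : cochain R3) : F \* G = cone R3 -> G \* F = cone R3 ->
  conv_inverse3 mulm (fun X Y Z => F (X, (Y, Z))) (fun X Y Z => G (X, (Y, Z))).
Proof.
move=> FG GF X Y Z x y z hx hy hz.
have eL := mor_eps (mulL m) (X, (Y, Z)); have eR := mor_eps (mulR m) (X, (Y, Z)).
split; first exact: etrans eL (esym eR).
  apply: etrans (sum_sweedler3 hx hy hz (lconv_kernel F G)) _.
  by apply: etrans (esym eL); rewrite -[RHS]/(cone R3 (X, (Y, Z))) -FG.
apply: etrans (sum_sweedler3 hx hy hz (lconv_kernel G F)) _.
by apply: etrans (esym eL); rewrite -[RHS]/(cone R3 (X, (Y, Z))) -GF.
Qed.

Lemma sum_cochain_pentagonl (F : cochain R3) (X Y Z W : L) (x y z w : seq (2.-tuple L)) :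
  sweedler X x -> sweedler Y y -> sweedler Z z -> sweedler W w ->
  \sum_(p <- x) \sum_(q <- y) \sum_(r <- z) \sum_(o <- w)
    F (p`_0, (q`_0, m (r`_0, o`_0))) * F (m (p`_1, q`_1), (r`_1, o`_1)) =
  (cpull (mor_prod (mor_id RL) (id_mul m RL)) F \* cpull (mul12 m R2) F) (X, (Y, (Z, W))).
Proof.
move=> hx hy hz hw.
exact: (sum_sweedler4 hx hy hz hw (lconv_kernel
  (cpull (mor_prod (mor_id RL) (id_mul m RL)) F) (cpull (mul12 m R2) F))).
Qed.

Lemma sum_cochain_pentagonr (F : cochain R3) (X Y Z W : L)
    (x w : seq (2.-tuple L)) (y z : seq (3.-tuple L)) :
  sweedler X x -> sweedler Y y -> sweedler Z z -> sweedler W w ->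
  \sum_(p <- x) \sum_(q <- y) \sum_(r <- z) \sum_(o <- w)
    F (p`_0, (lact (F (q`_0, (r`_0, o`_0))) (m (q`_1, r`_1)), o`_1)) *
    F (p`_1, (q`_2, r`_2)) =
  (cfirst RL F \* cpull (id_mul12 m RL RL) F \* cfront3 F) (X, (Y, (Z, W))).
Proof.
move=> hx hy hz hw.
exact: (sum_pentagon m F (sweedler_rep Q hx) (sweedler_rep Q hy) (sweedler_rep Q hz) (sweedler_rep Q hw)).
Qed.

Lemma sum_cochain_assocl (F : cochain R3) (X Y Z : L) (x y z : seq (2.-tuple L)) :
  sweedler X x -> sweedler Y y -> sweedler Z z ->
  \sum_(p <- x) \sum_(q <- y) \sum_(r <- z)
    lact (F (p`_0, (q`_0, r`_0))) (m (m (p`_1, q`_1), r`_1)) =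
  lconv F (hpull (mulL m) idL) (X, (Y, Z)).
Proof.
move=> hx hy hz.
exact: (sum_sweedler3 hx hy hz (lconv_kernel F (hpull (mulL m) idL))).
Qed.

Lemma sum_cochain_assocr (F : cochain R3) (X Y Z : L) (x y z : seq (2.-tuple L)) :
  sweedler X x -> sweedler Y y -> sweedler Z z ->
  \sum_(p <- x) \sum_(q <- y) \sum_(r <- z)
    lbact (F (p`_1, (q`_1, r`_1))) (m (p`_0, m (q`_0, r`_0))) =
  rconv (hpull (mulR m) idL) F (X, (Y, Z)).
Proof.
move=> hx hy hz.
exact: (sum_sweedler3 hx hy hz (rconv_kernel (hpull (mulR m) idL) F)).
Qed.

(** The universal balanced map: testing [mor_dec] on it gives an equality in L <> L, hence axiom (i)
    in [cop_mor]. *)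
Lemma dpure_kernel2 : ker2 (fun x y : RL => dpure [tuple x; y] : diamond L 2).
Proof.
split=> [y a u v|x a u v|b x y].
- exact: (@pure_linear _ _ _ _ _ _ [::] [:: y]).
- exact: (@pure_linear _ _ _ _ _ _ [:: x] [::]).
- exact: (@pure_balanced _ _ _ _ _ _ [::] [::]).
Qed.

Lemma cop_mor (X Y : L) (x y : seq (2.-tuple L)) : sweedler X x -> sweedler Y y ->
  cop L (m (X, Y)) = \sum_(p <- x) \sum_(q <- y)
    dpure [tuple (m (p`_0, q`_0) : L); (m (p`_1, q`_1) : L)].
Proof.
move=> hx hy.
apply: etrans (esym (sum_sweedler2 hx hy (mor_kernel2 m dpure_kernel2))).
rewrite -(mor_dec m _ dpure_kernel2).
rewrite (sum_ldec (fun u v : L => dpure [tuple u; v] : diamond L 2)).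
rewrite [LHS]cop_listP; apply: eq_bigr => p _; congr dpure.
by rewrite -[LHS]pair_tuple_eta; apply: val_inj.
Qed.

Lemma sum_sweedler_twist_mul (f g : cochain R2) (X Y : L) (x y : seq (3.-tuple L)) :
  sweedler X x -> sweedler Y y ->
  lconv f (rconv (hpull m idL) g) (X, Y) =
  \sum_(p <- x) \sum_(q <- y)
    lact (f (p`_0, q`_0)) (lbact (g (p`_2, q`_2)) (m (p`_1, q`_1))).
Proof.
move=> hx hy; have KP := kern2 (lrconv_kernel f (hpull m idL) g).
have [_ h] := rep_prod (sweedler_rep Q hx) (sweedler_rep Q hy).
rewrite /=; under eq_bigr do rewrite (linear_big _ _ (@lact_linear _ _ L _)).
apply: etrans (esym (h _ _ KP)) _.
rewrite big_allpairs_dep big_map; apply: eq_bigr => p _.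
by rewrite big_map.
Qed.

End Properties.

Lemma eps_pair (X Y : L) : eps ((X, Y) : R2) = counit L (mul X Y).
Proof. exact: counit_ract Q X Y. Qed.

Lemma ract_one_counit b : counit L (ract one b) = b.
Proof. by rewrite -(lact_one Q) counit_lact (counit1 Q) mulr1. Qed.

Section Normalisation.
Variables (f g : cochain R2) (F : cochain R3).
Hypotheses (fg : f \* g = cone R2).
Hypotheses (f1l : forall X, f (one, X) = counit L X) (f1r : forall X, f (X, one) = counit L X).

Let m := mor_mul Q.

(** Pullback along X |-> (1, X) preserves products and units; since it sends f to the unit, it sends
    the inverse of f there too. *)
Lemma unital_inversel : cpull (mor_unitl Q RL) f = cone RL /\ cpull (mor_unitl Q RL) g = cone RL.
Proof.
have fl : cpull (mor_unitl Q RL) f = cone RL by apply: cochain_ext => X; apply: f1l.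
by split=> //; rewrite -[LHS]cmul1l -fl -cpullM fg cpull1.
Qed.

Lemma unital_inverser : cpull (mor_unitr Q) f = cone RL /\ cpull (mor_unitr Q) g = cone RL.
Proof.
have fr : cpull (mor_unitr Q) f = cone RL by apply: cochain_ext => X; apply: f1r.
by split=> //; rewrite -[LHS]cmul1l -fr -cpullM fg cpull1.
Qed.

Lemma inverse_unitl X : g (one, X) = counit L X.
Proof. by have [_ e] := unital_inversel; rewrite -[RHS]/(cone RL X) -e. Qed.

Lemma inverse_unitr X : g (X, one) = counit L X.
Proof. by have [_ e] := unital_inverser; rewrite -[RHS]/(cone RL X) -e. Qed.

(** With 1 in the first slot the five factors become f, 1, 1, g, 1. In the middle slot they become
    1, f, 1, g, 1 and in the last 1, f, 1, 1, g. *)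
Lemma twist3_unitl : (forall X Y, F (one, (X, Y)) = counit L (mul X Y)) ->
  cpull (mor_unitl Q R2) (twist3 m f g F) = cone R2.
Proof.
move=> F1; rewrite /twist3 4!cpullM.
have -> : cpull (mor_unitl Q R2) (cfirst RL f) = f.
  by apply: cochain_ext => -[X Y]; apply: ract_one_counit.
have -> : cpull (mor_unitl Q R2) (cpull (id_mul m RL) f) = cone R2.
  by apply: cochain_ext => -[X Y]; apply: etrans (f1l _) (mor_eps m (X, Y)).
have -> : cpull (mor_unitl Q R2) F = cone R2.
  by apply: cochain_ext => -[X Y]; apply: etrans (F1 X Y) (esym (eps_pair X Y)).
have -> : cpull (mor_unitl Q R2) (cpull (mul12 m RL) g) = g.
  apply: cochain_ext => -[X Y]; rewrite -[LHS]/(g (mul one X, Y)).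
  by rewrite (mul_1l Q).
have -> : cpull (mor_unitl Q R2) (cfront RL g) = cone R2.
  apply: cochain_ext => -[X Y].
  transitivity (cfront RL g (one, (X, Y))); first by [].
  by rewrite cfrontE inverse_unitl.
by rewrite !cmul1r.
Qed.

Lemma twist3_unitm : (forall X Y, F (X, (one, Y)) = counit L (mul X Y)) ->
  cpull (mor_prod (mor_id RL) (mor_unitl Q RL)) (twist3 m f g F) = cone R2.
Proof.
move=> F1; set u := mor_prod _ _; rewrite /twist3 4!cpullM.
have -> : cpull u (cfirst RL f) = cone R2.
  apply: cochain_ext => -[X Y]; rewrite -[LHS]/(counit L (ract X (f (one, Y)))).
  by rewrite f1l.
have -> : cpull u (cpull (id_mul m RL) f) = f.
  apply: cochain_ext => -[X Y]; rewrite -[LHS]/(f (X, mul one Y)).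
  by rewrite (mul_1l Q).
have -> : cpull u F = cone R2.
  by apply: cochain_ext => -[X Y]; apply: etrans (F1 X Y) (esym (eps_pair X Y)).
have -> : cpull u (cpull (mul12 m RL) g) = g.
  apply: cochain_ext => -[X Y]; rewrite -[LHS]/(g (mul X one, Y)).
  by rewrite (mul_1r Q).
have -> : cpull u (cfront RL g) = cone R2.
  apply: cochain_ext => -[X Y].
  (* Written as a left action on 1, eps(Y) crosses the tensor sign, leaving g(X eps(Y), 1) = eps(X
     eps(Y)). *)
  have e : tr (one : RL) (eps Y) = tl (eps Y) (one : RL) := esym (lact_one Q _).
  have [_ _ g3 _] := hom_adm g.
  transitivity (cfront RL g (X, (one, Y))); first by [].
  by rewrite cfrontE e -g3 inverse_unitr.
by rewrite !cmul1r cmul1l fg.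
Qed.

Lemma twist3_unitr : (forall X Y, F (X, (Y, one)) = counit L (mul X Y)) ->
  cpull (mor_prod (mor_id RL) (mor_unitr Q)) (twist3 m f g F) = cone R2.
Proof.
move=> F1; set u := mor_prod _ _; rewrite /twist3 4!cpullM.
have -> : cpull u (cfirst RL f) = cone R2.
  apply: cochain_ext => -[X Y]; rewrite -[LHS]/(counit L (ract X (f (Y, one)))).
  by rewrite f1r.
have -> : cpull u (cpull (id_mul m RL) f) = f.
  apply: cochain_ext => -[X Y]; rewrite -[LHS]/(f (X, mul Y one)).
  by rewrite (mul_1r Q).
have -> : cpull u F = cone R2.
  by apply: cochain_ext => -[X Y]; apply: etrans (F1 X Y) (esym (eps_pair X Y)).
have -> : cpull u (cpull (mul12 m RL) g) = cone R2.
  by apply: cochain_ext => -[X Y]; apply: etrans (inverse_unitr _) (mor_eps m (X, Y)).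
have -> : cpull u (cfront RL g) = g.
  apply: cochain_ext => -[X Y].
  transitivity (cfront RL g (X, (Y, one))); first by [].
  have e : tr (Y : RL) (eps (one : RL)) = Y by apply: etrans (ract1 Y); congr ract; apply: (counit1 Q).
  by rewrite cfrontE e.
by rewrite !cmul1r cmul1l fg.
Qed.

End Normalisation.

End Assembly.

(** * The theorem *)

Section Main.
Variables (k : fieldType) (B : algType k) (L : coalgebroid B).
Variables (mul : L -> L -> L) (one : L) (s t : B -> L) (Phi : L -> L -> L -> B).
Hypothesis Q : coquasi_bialgebroid mul one s t Phi.

Local Notation RL := (carrier (coquasi_cop_ract Q) (coquasi_cop_rbact Q) (coquasi_counit_right Q)).
Local Notation R2 := (RL ** RL).
Local Notation R3 := (RL ** (RL ** RL)).
Local Notation "f \* g" := (cmul f g) (at level 40, left associativity).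
Local Notation idL := (hom_id (coquasi_cop_ract Q) (coquasi_cop_rbact Q) (coquasi_counit_right Q)).
Local Notation m := (mor_mul Q).

(** Passage from maps on L to cochains. The inverse receives its right compatibility from
    [inverse_cochain_tr]. *)
Lemma cochain2_exists (Sigma SigmaV : L -> L -> B) :
  hom2 Sigma -> hom2 SigmaV -> conv_inverse2 mul Sigma SigmaV ->
  (forall X Y b, Sigma X (rbact Y b) = Sigma X (ract Y b)) ->
  exists f g : cochain R2,
    [/\ forall X Y, Sigma X Y = f (X, Y), forall X Y, SigmaV X Y = g (X, Y),
        f \* g = cone R2 & g \* f = cone R2].
Proof.
move=> hS hV inv hr.
have [f fE] := hom2_behom Q hS; have [g gE] := hom2_behom Q hV.
have f_tr (x : R2) b : f (tr x b) = f (trb x b).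
  by case: x => X Y; rewrite -[LHS]fE -[RHS]fE; apply/esym/hr.
pose fc := Cochain f_tr.
have fg : lconv fc g = hom_eps R2.
  apply: hom_ext => -[X Y].
  have [e _] := inv X Y _ _ (sweedler_cop_list X) (sweedler_cop_list Y).
  apply: etrans (esym (sum_sweedler2 (sweedler_cop_list X) (sweedler_cop_list Y) (lconv_kernel fc g))) _.
  apply: etrans (esym (eps_pair Q X Y)); rewrite -e.
  by apply: eq_bigr => p _; apply: eq_bigr => q _; rewrite fE gE.
have gf : lconv g fc = hom_eps R2.
  apply: hom_ext => -[X Y].
  have [_ e] := inv X Y _ _ (sweedler_cop_list X) (sweedler_cop_list Y).
  apply: etrans (esym (sum_sweedler2 (sweedler_cop_list X) (sweedler_cop_list Y) (lconv_kernel g fc))) _.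
  apply: etrans (esym (eps_pair Q X Y)); rewrite -e.
  by apply: eq_bigr => p _; apply: eq_bigr => q _; rewrite fE gE.
exists fc, (Cochain (inverse_cochain_tr fg gf)).
by split=> //; apply: cochain_hom_inj.
Qed.

Lemma cochain3_exists : exists F G : cochain R3,
  [/\ forall X Y Z, Phi X Y Z = F (X, (Y, Z)), F \* G = cone R3 & G \* F = cone R3].
Proof.
have [Psi hPsi inv] := cocycle_invertible (cocycle Q).
have [f fE] := hom3_behom Q (cocycle_hom (cocycle Q)); have [g gE] := hom3_behom Q hPsi.
have f_tr (x : R3) b : f (tr x b) = f (trb x b).
  by case: x => X [Y Z]; rewrite -[LHS]fE -[RHS]fE; apply: (cocycle_right (cocycle Q)).
pose fc := Cochain f_tr.
have fg : lconv fc g = hom_eps R3.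
  apply: hom_ext => -[X [Y Z]].
  have [_ e _] := inv X Y Z _ _ _ (sweedler_cop_list X) (sweedler_cop_list Y) (sweedler_cop_list Z).
  apply: etrans (esym (sum_sweedler3 (sweedler_cop_list X) (sweedler_cop_list Y)
    (sweedler_cop_list Z) (lconv_kernel fc g))) _.
  apply: etrans (mor_eps (mulL m) (X, (Y, Z))); rewrite -[RHS]e.
  by apply: eq_bigr => p _; apply: eq_bigr => q _; apply: eq_bigr => r _; rewrite fE gE.
have gf : lconv g fc = hom_eps R3.
  apply: hom_ext => -[X [Y Z]].
  have [_ _ e] := inv X Y Z _ _ _ (sweedler_cop_list X) (sweedler_cop_list Y) (sweedler_cop_list Z).
  apply: etrans (esym (sum_sweedler3 (sweedler_cop_list X) (sweedler_cop_list Y)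
    (sweedler_cop_list Z) (lconv_kernel g fc))) _.
  apply: etrans (mor_eps (mulL m) (X, (Y, Z))); rewrite -[RHS]e.
  by apply: eq_bigr => p _; apply: eq_bigr => q _; apply: eq_bigr => r _; rewrite fE gE.
exists fc, (Cochain (inverse_cochain_tr fg gf)).
by split=> //; apply: cochain_hom_inj.
Qed.

Section Original.
Variable F : cochain R3.
Hypothesis FE : forall X Y Z, Phi X Y Z = F (X, (Y, Z)).

Lemma original_pentagon : pentagon m F.
Proof.
apply: cochain_ext => -[X [Y [Z W]]].
have s2 := @sweedler_cop_list k B L.
have s3 U : sweedler U (iter_cop (@cop_list _ _ L) 2 U).
  by exists (@cop_list _ _ L) => //; apply: cop_listP.
rewrite -(sum_cochain_pentagonl m F (s2 X) (s2 Y) (s2 Z) (s2 W)).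
rewrite -(sum_cochain_pentagonr m F (s2 X) (s3 Y) (s3 Z) (s2 W)).
have e := cocycle_eq (cocycle Q) (s2 X) (s2 Y) (s3 Y) (s2 Z) (s3 Z) (s2 W).
apply: etrans (etrans _ e) _.
  apply: eq_bigr => p _; apply: eq_bigr => q _; apply: eq_bigr => r _.
  by apply: eq_bigr => o _; rewrite !FE.
apply: eq_bigr => p _; apply: eq_bigr => q _; apply: eq_bigr => r _.
by apply: eq_bigr => o _; rewrite !FE.
Qed.

Lemma original_assoc :
  lconv F (hpull (mulL m) idL) = rconv (hpull (mulR m) idL) F.
Proof.
apply: hom_ext => -[X [Y Z]].
have s2 := @sweedler_cop_list k B L.
rewrite -(sum_cochain_assocl m F (s2 X) (s2 Y) (s2 Z)).
rewrite -(sum_cochain_assocr m F (s2 X) (s2 Y) (s2 Z)).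
have e := cocycle_assoc (cocycle Q) (s2 X) (s2 Y) (s2 Z).
apply: etrans (etrans _ e) _.
  apply: eq_bigr => p _; apply: eq_bigr => q _.
  by apply: eq_bigr => r _; rewrite !FE.
apply: eq_bigr => p _; apply: eq_bigr => q _.
by apply: eq_bigr => r _; rewrite !FE.
Qed.

(** Linearity of G carries the identity in L over to its tested form. *)
Lemma original_reassociates : reassociates m F.
Proof.
move=> V G GP x.
transitivity (G (lconv F (hpull (mulL m) idL) x)).
  rewrite -[RHS]/(G (\sum_(p <- dec x) lact (F p.1) (mulL m p.2))) (linear_big _ _ GP).
  by apply: eq_bigr => p _; apply: (mor_tl (mulL m) _ _ GP).
rewrite original_assoc.
rewrite -[LHS]/(G (\sum_(p <- dec x) lbact (F p.2) (mulR m p.1))) (linear_big _ _ GP).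
by apply: eq_bigr => p _; apply/esym; apply: (mor_tlb (mulR m) _ _ GP).
Qed.

End Original.

Section Twisted.
Variables (f g : cochain R2) (F G : cochain R3).
Hypotheses (fg : f \* g = cone R2) (gf : g \* f = cone R2).
Hypotheses (f1l : forall X, f (one, X) = counit L X) (f1r : forall X, f (X, one) = counit L X).
Hypotheses (FE : forall X Y Z, Phi X Y Z = F (X, (Y, Z))).
Hypotheses (FG : F \* G = cone R3) (GF : G \* F = cone R3).

Definition twisted_mor : mor R2 RL := mor_twist m fg gf.

Let mt := twisted_mor.
Let Ft := twist3 m f g F.

Lemma twisted_morP : twist_of mt m f g.
Proof. exact: mor_twistP. Qed.

Definition twisted_mul (X Y : L) : L := mt (X, Y).
Definition twisted_cocycle (X Y Z : L) : B := Ft (X, (Y, Z)).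

Lemma twisted_mulE X Y : twisted_mul X Y = lconv f (rconv (hpull m idL) g) (X, Y).
Proof. by []. Qed.

Lemma twisted_mul_lact b X Y : twisted_mul (lact b X) Y = lact b (twisted_mul X Y).
Proof. exact: (mor_tl mt b (X, Y) (adm_id Q)). Qed.

Lemma twisted_mul_lbact b X Y : twisted_mul (lbact b X) Y = lbact b (twisted_mul X Y).
Proof. exact: (mor_tlb mt b (X, Y) (adm_id Q)). Qed.

Lemma twisted_mul_ract b X Y : twisted_mul X (ract Y b) = ract (twisted_mul X Y) b.
Proof. exact: (mor_tr mt b (X, Y) (adm_id Q)). Qed.

Lemma twisted_mul_rbact b X Y : twisted_mul X (rbact Y b) = rbact (twisted_mul X Y) b.
Proof. exact: (mor_trb mt b (X, Y) (adm_id Q)). Qed.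

(** Along X |-> (1, X) both f and g become the convolution unit and drop out of the product. *)
Lemma twisted_mul1l X : twisted_mul one X = X.
Proof.
have [u1 u2] := unital_inversel fg f1l.
rewrite twisted_mulE.
rewrite -[LHS]/(hpull (mor_unitl Q RL) (lconv f (rconv (hpull m idL) g)) X).
rewrite hpull_lconv hpull_rconv.
rewrite -[hpull _ f]/(cochain_hom (cpull (mor_unitl Q RL) f)).
rewrite -[hpull _ g]/(cochain_hom (cpull (mor_unitl Q RL) g)) u1 u2 lconv1 rconv1.
exact: mul_1l Q X.
Qed.

Lemma twisted_mul1r X : twisted_mul X one = X.
Proof.
have [u1 u2] := unital_inverser fg f1r.
rewrite twisted_mulE.
rewrite -[LHS]/(hpull (mor_unitr Q) (lconv f (rconv (hpull m idL) g)) X).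
rewrite hpull_lconv hpull_rconv.
rewrite -[hpull _ f]/(cochain_hom (cpull (mor_unitr Q) f)).
rewrite -[hpull _ g]/(cochain_hom (cpull (mor_unitr Q) g)) u1 u2 lconv1 rconv1.
exact: mul_1r Q X.
Qed.

Lemma twisted_counit X Y : counit L (twisted_mul X Y) = counit L (mul X Y).
Proof. exact: etrans (mor_eps mt (X, Y)) (eps_pair Q X Y). Qed.

Lemma twisted_normalised_3cocycle : normalised_3cocycle twisted_mul one twisted_cocycle.
Proof.
have [inv1 inv2] := twist3_inverse m fg gf FG GF.
have Fn X Y : [/\ F (one, (X, Y)) = counit L (mul X Y), F (X, (one, Y)) = counit L (mul X Y)
    & F (X, (Y, one)) = counit L (mul X Y)].
  by rewrite -!FE; apply: (cocycle_normalised (cocycle Q)).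
split.
- exact: behom_hom3 Ft.
- exists (fun X Y Z => twist3V m f g G (X, (Y, Z))); first exact: behom_hom3.
  have h := conv_inverse3_cochain mt inv1 inv2.
  exact: h.
- move=> X Y; rewrite twisted_counit -(eps_pair Q) -[eps _]/(cone R2 (X, Y)); split.
  + rewrite -(twist3_unitl fg f1l (F := F)) // => X' Y'; by case: (Fn X' Y').
  + rewrite -(twist3_unitm fg f1l f1r (F := F)) // => X' Y'; by case: (Fn X' Y').
  + rewrite -(twist3_unitr fg f1r (F := F)) // => X' Y'; by case: (Fn X' Y').
- by move=> X Y Z b; apply: (cochain_tr Ft (X, (Y, Z)) b).
- move=> X Y Z W x y2 y3 z2 z3 w hx hy2 hy3 hz2 hz3 hw.
  apply: etrans (sum_cochain_pentagonl mt Ft hx hy2 hz2 hw) _.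
  apply: etrans (esym (sum_cochain_pentagonr mt Ft hx hy3 hz3 hw)).
  by rewrite (pentagon_twist gf twisted_morP (original_reassociates FE) (original_pentagon FE)).
- move=> X Y Z x y z hx hy hz.
  apply: etrans (sum_cochain_assocl mt Ft hx hy hz) _.
  apply: etrans (esym (sum_cochain_assocr mt Ft hx hy hz)).
  by rewrite (reassociates_twist gf twisted_morP (original_assoc FE)).
Qed.

(** The new product is B^e-linear on both sides and has the same unit, so the same s and t induce
    all four actions. The counit axioms persist because the counit of a product does not change. *)
Lemma twisted_coquasi : coquasi_bialgebroid twisted_mul one s t twisted_cocycle.
Proof.
have [l1 l2 _ _] := mor_adm mt (adm_id Q).
have sE b : s b = lact b one := source_lact Q b.
have tE b : t b = lbact b one := target_lbact Q b.
have sE' b : s b = ract one b by rewrite sE (lact_one Q).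
have tE' b : t b = rbact one b by rewrite tE (lbact_one Q).
split.
- by move=> X; apply: (l2 X).
- by move=> Y; apply: (l1 Y).
- exact: twisted_mul1l.
- exact: twisted_mul1r.
- exact: source_linear Q.
- exact: source1 Q.
- by move=> b c; rewrite !sE twisted_mul_lact twisted_mul1l lactM.
- exact: target_linear Q.
- exact: target1 Q.
- by move=> b c; rewrite !tE twisted_mul_lbact twisted_mul1l lbactM.
- by move=> b c; rewrite sE tE twisted_mul_lact twisted_mul_lbact !twisted_mul1l lact_lbact.
- by move=> b X; rewrite sE twisted_mul_lact twisted_mul1l.
- by move=> b X; rewrite tE twisted_mul_lbact twisted_mul1l.
- by move=> b X; rewrite sE' twisted_mul_ract twisted_mul1r.
- by move=> b X; rewrite tE' twisted_mul_rbact twisted_mul1r.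
- exact: cop1 Q.
- by move=> X Y x y hx hy; apply: (cop_mor mt hx hy).
- exact: counit1 Q.
- by move=> X Y; rewrite twisted_counit (counit_ract Q).
- by move=> X Y; rewrite twisted_counit (counit_rbact Q).
- exact: twisted_normalised_3cocycle.
Qed.

End Twisted.

End Main.

Theorem theorem2p4 (k : fieldType) (B : algType k) (L : coalgebroid B)
    (mul : L -> L -> L) (one : L) (s t : B -> L) (Phi : L -> L -> L -> B)
    (Sigma SigmaV : L -> L -> B) :
  coquasi_bialgebroid mul one s t Phi ->
  hom2 Sigma ->
  hom2 SigmaV -> conv_inverse2 mul Sigma SigmaV ->
  (forall X, Sigma one X = counit L X /\ Sigma X one = counit L X) ->
  (forall X Y b, Sigma X (rbact Y b) = Sigma X (ract Y b)) ->
  exists (mulS : L -> L -> L) (PhiS : L -> L -> L -> B),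
    [/\ forall X Y (x y : seq (3.-tuple L)), sweedler X x -> sweedler Y y ->
          mulS X Y =
          \sum_(p <- x) \sum_(q <- y)
            lact (Sigma p`_0 q`_0)
              (lbact (SigmaV p`_2 q`_2) (mul p`_1 q`_1)),
        forall X Y Z (x : seq (4.-tuple L)) (y : seq (5.-tuple L))
            (z : seq (4.-tuple L)),
          sweedler X x -> sweedler Y y -> sweedler Z z ->
          PhiS X Y Z =
          \sum_(p <- x) \sum_(q <- y) \sum_(r <- z)
            Sigma p`_0 (lact (Sigma q`_0 r`_0) (mul q`_1 r`_1)) *
            Phi p`_1 q`_2 r`_2 *
            SigmaV (lbact (SigmaV p`_3 q`_4) (mul p`_2 q`_3)) r`_3
      & coquasi_bialgebroid mulS one s t PhiS].
Proof.
move=> Q hS hV inv unital hr.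
have [f [g [fE gE fg gf]]] := cochain2_exists Q hS hV inv hr.
have [F [G [FE FG GF]]] := cochain3_exists Q.
have f1l X : f (one, X) = counit L X by rewrite -fE; case: (unital X).
have f1r X : f (X, one) = counit L X by rewrite -fE; case: (unital X).
exists (twisted_mul fg gf), (twisted_cocycle f g F); split.
- move=> X Y x y hx hy; apply: etrans (sum_sweedler_twist_mul (mor_mul Q) f g hx hy) _.
  by apply: eq_bigr => p _; apply: eq_bigr => q _; rewrite fE gE.
- move=> X Y Z x y z hx hy hz.
  apply: etrans (esym (sum_twist3 (mor_mul Q) f g F (sweedler_rep Q hx) (sweedler_rep Q hy) (sweedler_rep Q hz))) _.
  apply: eq_bigr => p _; apply: eq_bigr => q _; apply: eq_bigr => r _.
  by rewrite !fE !gE FE.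
- exact: (twisted_coquasi fg gf f1l f1r FE FG GF).
Qed.
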